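(* Let $f_*$ be the optimal value of problem $(\mathcal{P})$, and let $r>0$, $\varepsilon>0$, and $\gamma>f_*$ be such that: (1) $f$, $g_i$, $i\in M$, and $F$ are twice continuously Fréchet differentiable on $\Omega$, $\phi$ is continuously differentiable on its effective domain, and $\phi'(0)>0$; (2) the set $\Omega_r(\gamma+\varepsilon)$ is bounded and there exists $a>0$ such that for all $x\in\Omega_r(\gamma+\varepsilon)$ one has $Q(x)[\lambda,\mu]\ge a(\|\lambda\|^2+|\mu|^2)$ for all $\lambda\in H$, $\mu\in\mathbb{R}^m$; (3) the functions $f$, $g_i$, $i\in M$, and $F$, as well as their first and second order Fréchet derivatives, are bounded on $\Omega_r(\gamma+\varepsilon)$. Suppose also that the function $(x,\lambda,\mu)\mapsto\mathcal{L}(x,\lambda,\mu,c)$ is weakly sequentially lower semicontinuous for all $c>0$. Then there exists $c_*>0$ such that for all $c\ge c_*$ the following statements hold: (i) $\inf_{(x,\lambda,\mu)\in X\times H\times\mathbb{R}^m}\mathcal{L}(x,\lambda,\mu,c)=f_*$; (ii) $(x_*,\lambda_*,\mu_* )$ is a point of global minimum of $\mathcal{L}(\cdot,c)$ if and only if $x_*$ is a globally optimal solution of $(\mathcal{P})$ and $(x_*,\lambda_*,\mu_* )$ is a KKT-point of $(\mathcal{P})$; (iii) $(x_*,\lambda_*,\mu_* )\in S_c(\gamma)$ and is a stationary point of $\mathcal{L}(\cdot,c)$ (that is, $\nabla\mathcal{L}(x_*,\lambda_*,\mu_*,c)=0$) if and only if $(x_*,\lambda_*,\mu_* )$ is a KKT-point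 of $(\mathcal{P})$ and $f(x_* )\le\gamma$; (iv) if $(x_*,\lambda_*,\mu_* )\in S_c(\gamma)$ is a point of local minimum of $\mathcal{L}(\cdot,c)$, then $x_*$ is a locally optimal solution of $(\mathcal{P})$, $f(x_* )\le\gamma$, and $(x_*,\lambda_*,\mu_* )$ is a KKT-point of $(\mathcal{P})$.
   Context: Setting. $X$ and $H$ are real Hilbert spaces, $M=\{1,\dots,m\}$, and $f,g_i\colon X\to\mathbb{R}$ ($i\in M$), $F\colon X\to H$ are continuously Fréchet differentiable; $g=(g_1,\dots,g_m)$. Problem $(\mathcal{P})$: minimise $f(x)$ subject to $F(x)=0$, $g_i(x)\le 0$, $i\in M$. It is assumed that $(\mathcal{P})$ has a globally optimal solution. $|\cdot|$ is the Euclidean norm; $\max\{y,z\}$ of vectors is taken coordinatewise; $\nabla g(x)y\in\mathbb{R}^m$ is the vector with coordinates $\langle\nabla g_i(x),y\rangle$; $DF(x)[\cdot]\colon X\to H$ is the Fréchet derivative, $DF(x)^*$ its adjoint; $\mathrm{diag}(\cdot)$ is the diagonal matrix. Product spaces carry the Hilbert product norm. The function $\phi\colon[0,+\infty)\to[0,+\infty]$ is convex, non-decreasing, lower semicontinuous, $\phi(t)=0$ iff $t=0$, $\mathrm{dom}\,\phi\ne\{0\}$, and either $\mathrm{dom}\,\phi=[0,+\infty)$ and $\phi(t)\to+\infty$ as $t\to\infty$, or $\mathrm{dom}\,\phi=[0,\alpha)$ for some $\alpha>0$ and $\phi(t)\to+\infty$ as $t\to\alpha$. The function $\psi\colon[0,+\infty)^m\to\mathbb{R}$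 is continuously differentiable and concave, $\psi(0)>0$, $0$ is a global maximum point of $\psi$, and $\frac{\partial\psi}{\partial y_i}(y)=0$ whenever $y\in[0,+\infty)^m$, $y_i=0$. Put $b(x)=\psi(\max\{g(x),0\})$, $p(x,\mu)=b(x)/(1+|\mu|^2)$, $\Omega=\{x\in X\mid b(x)>0,\ \phi(\|F(x)\|^2)<+\infty\}$, $L(x,\lambda,\mu)=f(x)+\langle\lambda,F(x)\rangle+\langle\mu,g(x)\rangle$ for $\lambda\in H$, $\mu\in\mathbb{R}^m$, and $$\eta(x,\lambda,\mu)=\tfrac12\big\|DF(x)[\nabla_xL(x,\lambda,\mu)]\big\|^2+\tfrac12\sum_{i=1}^m\big(\langle\nabla g_i(x),\nabla_xL(x,\lambda,\mu)\rangle+g_i(x)^2\mu_i\big)^2.$$ For $c>0$ the augmented Lagrangian is $$\mathcal{L}(x,\lambda,\mu,c)=f(x)+\langle\lambda,F(x)\rangle+\tfrac c2(1+\|\lambda\|^2)\phi(\|F(x)\|^2)+\langle\mu,q\rangle+\tfrac{c}{2p(x,\mu)}|q|^2+\eta(x,\lambda,\mu),\quad q=\max\{g(x),-\tfrac1c p(x,\mu)\mu\},$$ if $x\in\Omega$, and $\mathcal{L}(x,\lambda,\mu,c)=+\infty$ otherwise. $\nabla\mathcal{L}(x,\lambda,\mu,c)$ denotes the gradient of $(x,\lambda,\mu)\mapsto\mathcal{L}(x,\lambda,\mu,c)$ at a point of $\Omega\times H\times\mathbb{R}^m$ (under assumption (1) this function is continuously Fréchet differentiable there). $S_c(\gamma)=\{(x,\lambda,\mu)\in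 X\times H\times\mathbb{R}^m\mid\mathcal{L}(x,\lambda,\mu,c)\le\gamma\}$, and $\Omega_c(\gamma)=\{x\in\Omega\mid f(x)+c(\|F(x)\|^2+|\max\{g(x),0\}|^2)\le\gamma\}$. Also $$Q(x)[\lambda,\mu]=\tfrac12\Big\|DF(x)\Big[DF(x)^*[\lambda]+\sum_{i=1}^m\mu_i\nabla g_i(x)\Big]\Big\|^2+\tfrac12\Big|\nabla g(x)\Big(DF(x)^*[\lambda]+\sum_{i=1}^m\mu_i\nabla g_i(x)\Big)+\mathrm{diag}(g_i(x)^2)\mu\Big|^2.$$ A triplet $(x_*,\lambda_*,\mu_* )\in X\times H\times\mathbb{R}^m$ is a KKT-point of $(\mathcal{P})$ if $\nabla_xL(x_*,\lambda_*,\mu_* )=0$, $F(x_* )=0$, $\max\{g(x_* ),-\mu_*\}=0$. Standing assumption: for every globally optimal solution $x_*$ of $(\mathcal{P})$ there exist $\lambda_*,\mu_*$ such that $(x_*,\lambda_*,\mu_* )$ is a KKT-point. *)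

(* Defs.v *)
From HB Require Import structures.
From mathcomp Require Import all_boot all_order all_algebra.
From mathcomp Require Import all_classical all_reals all_analysis.

Set Implicit Arguments.
Unset Strict Implicit.
Unset Printing Implicit Defensive.

Import Order.TTheory GRing.Theory Num.Theory.
Import numFieldNormedType.Exports.

Local Open Scope classical_set_scope.
Local Open Scope ring_scope.

HB.mixin Record CompleteNormedModule_isHilbert (R : realType) V
    & CompleteNormedModule R V := {
  dotp : V -> V -> R;
  dotpC : forall u v, dotp u v = dotp v u;
  dotpDl : forall u v w, dotp (u + v) w = dotp u w + dotp v w;
  dotpZl : forall (a : R) u v, dotp (a *: u) v = a * dotp u v;
  dotp_norm : forall u, dotp u u = `|u| ^+ 2
}.

#[short(type="hilbertType")]
HB.structure Definition Hilbert (R : realType) :=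
  {V of CompleteNormedModule R V & CompleteNormedModule_isHilbert R V}.

Section Euclidean.
Context {R : realType} {m : nat}.
Implicit Types u v : 'rV[R]_m.

(* The library norm on 'rV[R]_m is the sup norm; the Euclidean structure is
   given by [edot] and [enorm], and both norms define the same topology. *)
Definition edot u v : R := \sum_(i < m) u 0 i * v 0 i.
Definition enorm u : R := Num.sqrt (edot u u).

Definition vmax u v : 'rV[R]_m := \row_i Num.max (u 0 i) (v 0 i).

Definition orthant : set 'rV[R]_m := [set y | forall i, 0 <= y 0 i].

End Euclidean.

Section FrechetCalculus.
Context {R : realType} {U V : normedModType R}.
Implicit Types (f : U -> V) (x : U) (D : set U).

Definition opnorm_le (A : U -> V) (C : R) := forall h, `|A h| <= C * `|h|.
Definition bilnorm_le (B : U -> U -> V) (C : R) :=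
  forall h k, `|B h k| <= C * `|h| * `|k|.

Definition cont_differentiable f :=
  (forall x, differentiable f x) /\
  forall x (e : R), 0 < e ->
    \forall y \near x, opnorm_le (fun h => 'd f y h - 'd f x h) e.

(* [B] is the Frechet derivative at [x], for the operator norm, of the map
   [y |-> 'd f y]; [B h k] is the derivative of ['d f y k] in direction [h]. *)
Definition is_diff2 f x (B : U -> U -> V) :=
  [/\ \forall y \near x, differentiable f y,
      (forall h, linear (B h)) /\ (forall k, linear (B ^~ k)),
      exists C, bilnorm_le B C
    & forall e : R, 0 < e -> \forall y \near x,
        opnorm_le (fun k => 'd f y k - 'd f x k - B (y - x) k) (e * `|y - x|)].

Definition twice_differentiable f x := exists B, is_diff2 f x B.

Definition diff2 f x : U -> U -> V := xget (fun _ _ => 0) [set B | is_diff2 f x B].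

Definition twice_cont_differentiable_on D f :=
  (forall x, D x -> twice_differentiable f x) /\
  forall x (e : R), D x -> 0 < e ->
    \forall y \near x, D y ->
      bilnorm_le (fun h k => diff2 f y h k - diff2 f x h k) e.

Definition bounded_with_derivatives_on D f :=
  [/\ [bounded f x | x in D],
      exists C, forall x, D x -> opnorm_le ('d f x) C
    & exists C, forall x, D x -> bilnorm_le (diff2 f x) C].

End FrechetCalculus.

Section Gradient.
Context {R : realType}.

(* [v] represents the Frechet derivative of [f] at [x] through the inner
   product [ip]. *)
Definition is_gradient (U : normedModType R) (ip : U -> U -> R) (f : U -> R)
    (x v : U) :=
  differentiable f x /\ forall h, 'd f x h = ip v h.

Definition grad (X : hilbertType R) (f : X -> R) (x : X) : X :=
  xget 0 [set v | is_gradient (@dotp R X) f x v].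

Definition adjoint (X H : hilbertType R) (A : X -> H) (l : H) : X :=
  xget 0 [set v | forall h, dotp v h = dotp l (A h)].

End Gradient.

Section WeakTopology.
Context {R : realType} {V : normedModType R}.

Definition weakly_cvg (u : nat -> V) (v : V) :=
  forall l : {linear V -> R^o}, continuous l -> l (u n) @[n --> \oo] --> l v.

Definition weakly_seq_lsc (Phi : V -> \bar R) :=
  forall u v, weakly_cvg u v -> (Phi v <= limn_einf (Phi \o u))%E.

End WeakTopology.

Section Penalty.
Context {R : realType}.

(* A function on [0, +oo[ is represented by a function on R of which only the
   values at nonnegative arguments are ever used; likewise for functions on the
   nonnegative orthant. *)
Definition edom (phi : R -> \bar R) : set R :=
  [set t | 0 <= t /\ (phi t < +oo)%E].

Record phi_admissible (phi : R -> \bar R) : Prop := PhiAdmissible {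
  phi_ge0 : forall t : R, 0 <= t -> (0 <= phi t)%E;
  phi_convex : forall s t l : R, 0 <= s -> 0 <= t -> 0 <= l <= 1 ->
    (phi (l * s + (1 - l) * t)%R <= l%:E * phi s + (1 - l)%:E * phi t)%E;
  phi_nondecreasing : forall s t : R, 0 <= s -> s <= t -> (phi s <= phi t)%E;
  phi_lsc : forall (t : R) (a : \bar R), 0 <= t -> (a < phi t)%E ->
    \forall s \near t, 0 <= s -> (a < phi s)%E;
  phi_eq0 : forall t : R, 0 <= t -> (phi t = 0%E <-> t = 0);
  phi_dom : edom phi <> [set 0];
  phi_growth :
    (edom phi = [set t | 0 <= t] /\ phi t @[t --> +oo] --> +oo%E) \/
    (exists alpha : R, [/\ 0 < alpha, edom phi = [set t | 0 <= t < alpha]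
                         & phi t @[t --> alpha^'-] --> +oo%E])
}.

(* derivative of [h] at [t] relative to [D] (one-sided at an end point of an
   interval [D]) *)
Definition is_derive_within (D : set R) (h : R -> R) (t l : R) :=
  (h s - h t) / (s - t) @[s --> within D t^'] --> l.

Definition is_cont_derive_on_dom (phi : R -> \bar R) (dphi : R -> R) :=
  (forall t, edom phi t -> is_derive_within (edom phi) (fine \o phi) t (dphi t))
  /\ {within edom phi, continuous dphi}.

(* [dpsi y] is the vector of partial derivatives of [psi] at [y], one-sided in
   the coordinates where [y] vanishes. *)
Definition is_cont_gradient_on_orthant (m : nat) (psi : 'rV[R]_m -> R)
    (dpsi : 'rV[R]_m -> 'rV[R]_m) :=
  (forall y (e : R), orthant y -> 0 < e ->
     \forall z \near y, orthant z ->
       `|psi z - psi y - edot (dpsi y) (z - y)| <= e * enorm (z - y))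
  /\ {within orthant, continuous dpsi}.

Record psi_admissible (m : nat) (psi : 'rV[R]_m -> R) : Prop := PsiAdmissible {
  psi_C1 : exists dpsi, is_cont_gradient_on_orthant psi dpsi /\
    forall y i, orthant y -> y 0 i = 0 -> dpsi y 0 i = 0;
  psi_concave : forall y z (l : R), orthant y -> orthant z -> 0 <= l <= 1 ->
    l * psi y + (1 - l) * psi z <= psi (l *: y + (1 - l) *: z);
  psi0_gt0 : 0 < psi 0;
  psi0_max : forall y, orthant y -> psi y <= psi 0
}.

End Penalty.

Section Problem.
Context {R : realType} {X H : hilbertType R} {m : nat}.
Variables (f : X -> R) (F : X -> H) (g : 'I_m -> X -> R).
Variables (phi : R -> \bar R) (psi : 'rV[R]_m -> R).
Implicit Types (x : X) (lambda : H) (mu : 'rV[R]_m) (z : X * H * 'rV[R]_m).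

Definition gvec x : 'rV[R]_m := \row_i g i x.

Definition feasible : set X := [set x | F x = 0 /\ forall i, g i x <= 0].

Definition glob_opt x := feasible x /\ forall y, feasible y -> f x <= f y.

Definition loc_opt x :=
  feasible x /\ \forall y \near x, feasible y -> f x <= f y.

(* attained, hence a genuine minimum, as soon as some [glob_opt x] holds *)
Definition opt_value : R := inf (f @` feasible).

Definition lagr x lambda mu : R :=
  f x + dotp lambda (F x) + edot mu (gvec x).

Definition grad_lagr x lambda mu : X := grad (fun y => lagr y lambda mu) x.

Definition kkt x lambda mu :=
  [/\ grad_lagr x lambda mu = 0, F x = 0 & vmax (gvec x) (- mu) = 0].

Definition bfun x : R := psi (vmax (gvec x) 0).

Definition pfun x mu : R := bfun x / (1 + enorm mu ^+ 2).

Definition Omega : set X :=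
  [set x | 0 < bfun x /\ (phi (`|F x| ^+ 2)%R < +oo)%E].

Definition kkt_penalty x lambda mu : R :=
  2^-1 * `|'d F x (grad_lagr x lambda mu)| ^+ 2 +
  2^-1 * \sum_(i < m)
    (dotp (grad (g i) x) (grad_lagr x lambda mu) + g i x ^+ 2 * mu 0 i) ^+ 2.

Definition auglagr (c : R) z : \bar R :=
  let: (x, lambda, mu) := z in
  let q := vmax (gvec x) (- (c^-1 * pfun x mu) *: mu) in
  if `[< Omega x >] then
    (f x + dotp lambda (F x)
     + c / 2 * (1 + `|lambda| ^+ 2) * fine (phi (`|F x| ^+ 2))
     + edot mu q + c / (2 * pfun x mu) * enorm q ^+ 2
     + kkt_penalty x lambda mu)%:E
  else +oo%E.

(* inner product of the Hilbert space X x H x R^m; the library norm on the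
   product is equivalent to the induced one, so it has the same topology and
   the same Frechet derivatives *)
Definition prod_dot z w : R :=
  dotp z.1.1 w.1.1 + dotp z.1.2 w.1.2 + edot z.2 w.2.

(* [auglagr c] is real-valued on the open set Omega x H x R^m. *)
Definition stationary (c : R) z :=
  Omega z.1.1 /\ is_gradient prod_dot (fine \o auglagr c) z 0.

Definition glob_min (c : R) z := forall w, (auglagr c z <= auglagr c w)%E.

Definition loc_min (c : R) z :=
  \forall w \near z, (auglagr c z <= auglagr c w)%E.

Definition sublevel (c gamma : R) : set (X * H * 'rV[R]_m) :=
  [set z | (auglagr c z <= gamma%:E)%E].

Definition Omega_sub (c gamma : R) : set X :=
  [set x | Omega x /\
    f x + c * (`|F x| ^+ 2 + enorm (vmax (gvec x) 0) ^+ 2) <= gamma].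

Definition nabla_g x (y : X) : 'rV[R]_m := \row_i dotp (grad (g i) x) y.

Definition Qform x lambda mu : R :=
  let w := adjoint ('d F x) lambda + \sum_(i < m) mu 0 i *: grad (g i) x in
  2^-1 * `|'d F x w| ^+ 2 +
  2^-1 * enorm (nabla_g x w + mu *m diag_mx (\row_i g i x ^+ 2)) ^+ 2.

End Problem.

(* Main.v *)
(** In every sublevel set the augmented Lagrangian controls, uniformly in large c,
  c (|F|^2 + |g+|^2) and the penalty eta; hence x stays in Omega_r(gamma + eps)
  and, by coercivity of Q, the multipliers stay bounded. Let
  T u = (DF (S u), nabla g (S u) + diag (g^2) u_2) with
  S u = DF^* u_1 + sum_i u_2i nabla g_i, so that T is self-adjoint,
  |T u|^2 >= 2 a |u|^2, and let res be the residual with eta = |res|^2 / 2. At a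
  stationary point, vanishing of the derivative in the multipliers reads
  T res = - (F + c phi lambda, q + (c / b) |q|^2 mu), which gives
  |res| = O(sqrt c N) with N = |(F, q)|. Testing the derivative in x along S (T v),
  where v = (c (1 + |lambda|^2) phi' F, (c / p) q), gives |T v| = O(sqrt c N),
  while |T v| >= const c N. For large c this forces N = 0, that is, a KKT point.
  Minimisers exist by weak sequential compactness of balls, so the infimum is the
  optimal value; a local minimum (x, lambda, mu) yields local optimality of x by
  re-solving eta (y, . , .) = 0 at nearby feasible points y. *)

(* The scale [sqrt c N] comes from the bound [c N^2 = O(1)] on sublevel sets: [c phi lambda] and
   [(c / b) |q|^2 mu] are of order [c N^2 = (sqrt c N)^2], hence at most a constant times
   [sqrt c N]. The lower bound on [|T v|] exceeds the upper one by a single factor [sqrt c].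

   The obstacle is the entry [diag (g^2)] of [T]: [<S v, S (T v)>] falls short of [|T v|^2] by a sum
   of terms [g_i^2 v_i (T v)_i] in which [v_i] carries the factor [c]. They become harmless once
   joined with the same terms in [mu_i] produced by the gradient of the Lagrangian: either
   [q_i = g_i] and [c g_i^2 q_i / p] is cubic in [N], or [mu_i + v_i = 0].

   The infimum is found without any limit in [c]. A KKT point over an optimal solution has value
   [f_* < gamma], so a minimiser lies in the sublevel set; being stationary, it is a KKT point too,
   and its value is [f] at a feasible point. The margin [eps] absorbs the [O(1 / c)] lost in
   completing squares in the multipliers. *)
From HB Require Import structures.
Require Import Defs.
From mathcomp Require Import all_boot all_order all_algebra.
From mathcomp Require Import all_classical all_reals all_analysis.
From mathcomp Require Import ring lra.

Set Implicit Arguments.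
Unset Strict Implicit.
Unset Printing Implicit Defensive.

Import Order.TTheory GRing.Theory Num.Theory.
Import numFieldNormedType.Exports.

Local Open Scope classical_set_scope.
Local Open Scope ring_scope.

(** * Explicit Frechet derivatives *)

Section Frechet.
Context {R : realType}.
Implicit Types U V W Y Z : normedModType R.

(** The derivative is an arbitrary function [A], with linearity and boundedness as conjuncts, so
    that rules produce explicit formulas which [frechet_eq] can reshape; [diff_frechet] and
    [frechet_diff] translate from and to ['d]. *)
Definition frechet U V (f : U -> V) (x : U) (A : U -> V) :=
  [/\ linear A, exists C, opnorm_le A C
    & forall e : R, 0 < e ->
        \forall y \near x, `|f y - f x - A (y - x)| <= e * `|y - x|].

Lemma opnorm_le_gt0 U V (A : U -> V) : (exists C, opnorm_le A C) ->
  exists2 C, 0 < C & opnorm_le A C.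
Proof.
move=> [C leA]; exists (`|C| + 1); first by rewrite ltr_wpDl.
move=> h; apply: (le_trans (leA h)); rewrite ler_wpM2r//.
by rewrite (le_trans (ler_norm C))// lerDl.
Qed.

Lemma bilinear_bound_gt0 Z U V (B : Z -> U -> V) :
  (exists C, forall h k, `|B h k| <= C * `|h| * `|k|) ->
  exists2 C, 0 < C & forall h k, `|B h k| <= C * `|h| * `|k|.
Proof.
move=> [C BC]; exists (`|C| + 1) => [|h k]; first by rewrite ltr_wpDl.
rewrite (le_trans (BC _ _))// !ler_wpM2r//.
by rewrite (le_trans (ler_norm _))// lerDl.
Qed.

Lemma linear_opnorm_le U V (A : {linear U -> V}) :
  continuous A -> exists C, opnorm_le A C.
Proof.
move=> /linear_bounded_continuous /linear_boundedP[M [_ MA]].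
by exists (M + 1) => h; apply: MA; rewrite ltrDl.
Qed.

Lemma diff_frechet U V (f : U -> V) x : differentiable f x ->
  frechet f x ('d f x).
Proof.
move=> dfx; split; first by move=> a u v; rewrite linearP.
  by apply: linear_opnorm_le; exact: diff_continuous.
move=> e e0.
have [_ /eqaddoP/(_ e e0) H] := (diff_locallyP x f).1 dfx.
rewrite (near_shift 0 x) subr0 /=.
by apply: filterS H => h; rewrite /= addrK opprD addrA.
Qed.

Lemma frechet_diff U V (f : U -> V) x A : frechet f x A ->
  differentiable f x /\ 'd f x = A :> (U -> V).
Proof.
move=> [linA [C leA] fA].
pose L : {linear U -> V} := HB.pack A (GRing.isLinear.Build R U V *:%R A linA).
have cL : continuous L.
  apply/linear_bounded_continuous/linear_boundedP; exists C.
  split=> [|M CM h]; first exact: num_real.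
  by apply: (le_trans (leA h)); rewrite ler_wpM2r// ltW.
have dL : f \o shift x = cst (f x) + L +o_ 0 id.
  apply/eqaddoP => e e0.
  have := fA e e0; rewrite (near_shift 0 x) subr0 /=.
  by apply: filterS => h; rewrite /= addrK opprD addrA.
have := diff_unique cL dL => dE; split => //.
by apply/diff_locallyP; rewrite dE.
Qed.

Lemma near_dist U (x : U) (d : R) : 0 < d -> \forall y \near x, `|y - x| <= d.
Proof.
move=> d0; apply/nbhs_normP; exists d => //= y /=.
by rewrite distrC => /ltW.
Qed.

Lemma frechet_eq U V (f : U -> V) x A B :
  frechet f x A -> A =1 B -> frechet f x B.
Proof. by move=> fA /funext <-. Qed.

Lemma frechet_near_eq U V (f g : U -> V) x A :
  (\forall y \near x, f y = g y) -> frechet f x A -> frechet g x A.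
Proof.
move=> fg [lA bA fA]; split => // e e0.
have fgx := nbhs_singleton fg.
apply: filterS2 fg (fA e e0) => y.
by rewrite fgx => ->.
Qed.

Lemma frechet_linear U V (f : U -> V) x A : frechet f x A -> linear A.
Proof. by case. Qed.

Lemma linear_for_add U V (A : U -> V) u v : linear A -> A (u + v) = A u + A v.
Proof. by move=> lA; rewrite -[u]scale1r lA !scale1r. Qed.

Lemma linear_for0 U V (A : U -> V) : linear A -> A 0 = 0.
Proof. by move=> lA; rewrite -(scaler0 U (-1)) -[_ *: _]addr0 lA scaleN1r addNr. Qed.

Lemma linear_for_scale U V (A : U -> V) a u : linear A -> A (a *: u) = a *: A u.
Proof. by move=> lA; rewrite -[a *: u]addr0 lA linear_for0// addr0. Qed.

Lemma linear_for_sub U V (A : U -> V) u v : linear A -> A (u - v) = A u - A v.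
Proof.
by move=> lA; rewrite linear_for_add// -scaleN1r linear_for_scale// scaleN1r.
Qed.

Lemma frechet_calm U V (f : U -> V) x A : frechet f x A ->
  exists2 C, 0 < C & \forall y \near x, `|f y - f x| <= C * `|y - x|.
Proof.
move=> [_ /opnorm_le_gt0[C C0 leA] fA]; exists (C + 1); first by rewrite addr_gt0.
apply: filterS (fA 1 ltr01) => y H.
rewrite -(subrK (A (y - x)) (f y - f x)).
rewrite (le_trans (ler_normD _ _))// mulrDl addrC lerD// leA//.
Qed.

Lemma frechet_continuous U V (f : U -> V) x A : frechet f x A ->
  {for x, continuous f}.
Proof. by move=> /frechet_diff[df _]; exact: differentiable_continuous. Qed.

Lemma frechet_cst U V (v : V) (x : U) : frechet (fun _ => v) x (fun _ => 0).
Proof.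
split; first by move=> a u w; rewrite scaler0 addr0.
  by exists 0 => h; rewrite normr0 mul0r.
move=> e e0; near=> y; rewrite subrr subr0 normr0 mulr_ge0// ltW//.
Unshelve. all: by end_near. Qed.

Lemma frechet_lin U V (A : U -> V) (x : U) : linear A ->
  (exists C, opnorm_le A C) -> frechet A x A.
Proof.
move=> lA bA; split => // e e0; near=> y.
by rewrite (linear_for_sub y x lA) subrr normr0 mulr_ge0// ltW.
Unshelve. all: by end_near. Qed.

Lemma frechetD U V (f g : U -> V) x A B : frechet f x A -> frechet g x B ->
  frechet (fun y => f y + g y) x (fun h => A h + B h).
Proof.
move=> [lA [C leA] fA] [lB [D BD] gB]; split.
- by move=> a u v; rewrite lA lB scalerDr addrACA.
- exists (C + D) => h; rewrite mulrDl (le_trans (ler_normD _ _))// lerD//.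
move=> e e0; have e2 : 0 < e / 2 by rewrite divr_gt0.
apply: filterS2 (fA _ e2) (gB _ e2) => y Hf Hg.
have -> : f y + g y - (f x + g x) - (A (y - x) + B (y - x)) =
  (f y - f x - A (y - x)) + (g y - g x - B (y - x)).
  by rewrite !opprD (AC ((2*2)*2) ((1*3*5)*(2*4*6))).
by rewrite (le_trans (ler_normD _ _))// [e in leRHS]splitr mulrDl lerD.
Qed.

Lemma frechet_sum U V (I : finType) (f : I -> U -> V) x (A : I -> U -> V) :
  (forall i, frechet (f i) x (A i)) ->
  frechet (fun y => \sum_i f i y) x (fun h => \sum_i A i h).
Proof.
move=> fA.
have -> : (fun y => \sum_i f i y) = \sum_i (f i).
  by apply/funext => y; rewrite fct_sumE.
have -> : (fun y => \sum_i A i y) = \sum_i (A i).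
  by apply/funext => y; rewrite fct_sumE.
apply: (big_ind2 (fun f A => frechet f x A)) => [|????|i _]; last exact: fA.
  exact: frechet_cst.
exact: frechetD.
Qed.

(* [D] need not be a neighbourhood of [f x], and [f] itself need not be
   differentiable: only its composition with the derivative of [G] is. *)
Lemma frechet_comp_within U V W (f : U -> V) (G : V -> W) (D : set V)
    x (A' : V -> W) A :
  (exists2 C, 0 < C & \forall y \near x, `|f y - f x| <= C * `|y - x|) ->
  (\forall y \near x, D (f y)) ->
  (forall e, 0 < e -> \forall v \near f x, D v ->
     `|G v - G (f x) - A' (v - f x)| <= e * `|v - f x|) ->
  frechet (fun y => A' (f y - f x)) x A -> A' 0 = 0 ->
  frechet (G \o f) x A.
Proof.
move=> [C C0 fC] Df GA [lA bA fA] A'0; split => // e e0.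
have cf : {for x, continuous f}.
  apply/cvgrPdist_le => d d0.
  have dC : 0 < d / C by rewrite divr_gt0.
  apply: filterS2 fC (near_dist x dC) => y H1 H2.
  by rewrite distrC (le_trans H1)// mulrC -ler_pdivlMr.
(* Half of [e] pays for [G], after division by the growth constant [C] of [f] at [x]; the other half
   pays for the derivative of [A' (f y - f x)]. *)
have e2 : 0 < e / 2 by rewrite divr_gt0.
have e2C : 0 < e / 2 / C by rewrite divr_gt0.
have H1 : \forall y \near x, D (f y) ->
    `|G (f y) - G (f x) - A' (f y - f x)| <= e / 2 / C * `|f y - f x|.
  exact: (cf _ (GA _ e2C)).
near=> y.
have Dy : D (f y) by near: y.
have h1 : `|G (f y) - G (f x) - A' (f y - f x)| <= e / 2 / C * `|f y - f x|.
  by move: Dy; near: y; exact: H1.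
have h2 : `|f y - f x| <= C * `|y - x| by near: y.
have h3 : `|A' (f y - f x) - A' (f x - f x) - A (y - x)| <= e / 2 * `|y - x|.
  by near: y; exact: fA.
rewrite subrr A'0 subr0 in h3.
rewrite /= -(subrK (A' (f y - f x)) (G (f y) - G (f x))) -addrA.
rewrite (le_trans (ler_normD _ _))// [e in leRHS]splitr mulrDl lerD//.
rewrite (le_trans h1)//.
by rewrite mulrAC ler_pdivrMr// -[leRHS]mulrA ler_wpM2l ?(ltW e2)// [leRHS]mulrC.
Unshelve. all: by end_near. Qed.

Lemma frechet_comp U V W (f : U -> V) (G : V -> W) x A B :
  frechet f x A -> frechet G (f x) B -> frechet (G \o f) x (B \o A).
Proof.
move=> fA [lB [D BD] GB]; have [lA [C leA] fA'] := fA.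
apply: (@frechet_comp_within _ _ _ f G setT x B) => //.
- exact: frechet_calm fA.
- by near=> y.
- by move=> e e0; apply: filterS (GB e e0).
- split.
  + by move=> a u v; rewrite /= lA lB.
  + exists (`|D| * C) => h; rewrite -mulrA /=.
    rewrite (le_trans (BD _))// (@le_trans _ _ (`|D| * `|A h|))//.
      by rewrite ler_wpM2r// ler_norm.
    by rewrite ler_wpM2l.
  move=> e e0; have eD : 0 < e / (`|D| + 1).
    by rewrite divr_gt0// ltr_wpDl.
  apply: filterS (fA' _ eD) => y H.
  rewrite subrr (linear_for0 lB) subr0 /= -linear_for_sub//.
  rewrite (le_trans (BD _))// (@le_trans _ _ ((`|D| + 1) * (e / (`|D| + 1) * `|y - x|)))//.
    rewrite (le_trans (y := (`|D| + 1) * `|f y - f x - A (y - x)|))//.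
      by rewrite ler_wpM2r// (le_trans (ler_norm D))// lerDl.
    by rewrite ler_wpM2l// addr_ge0.
  by rewrite mulrA [(_ + 1) * _]mulrC divfK// gt_eqF// ltr_wpDl.
- exact: linear_for0.
Unshelve. all: by end_near. Qed.

(* Frechet differentiability, for the operator norm, of an operator-valued map;
   normed spaces of operators are avoided by spelling out the estimate. *)
Definition opfrechet Z U V (A : Z -> U -> V) (z0 : Z) (B : Z -> U -> V) :=
  [/\ linear (A z0) /\ (exists C, opnorm_le (A z0) C),
      (forall h, linear (B h)) /\ (forall k, linear (B ^~ k)),
      exists C, forall h k, `|B h k| <= C * `|h| * `|k|
    & forall e : R, 0 < e -> \forall z \near z0,
        opnorm_le (fun k => A z k - A z0 k - B (z - z0) k) (e * `|z - z0|)].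

(** The remainder is the error of [A] evaluated at [v z], the error of [v] pushed through [A z0],
    and the mixed term [B (z - z0) (v z - v z0)], which is quadratic in [z - z0]. Each takes a third
    of [e]. *)
Lemma opfrechet_app Z U V (A : Z -> U -> V) (z0 : Z) (B : Z -> U -> V)
    (v : Z -> U) dv :
  opfrechet A z0 B -> frechet v z0 dv ->
  frechet (fun z => A z (v z)) z0 (fun h => B h (v z0) + A z0 (dv h)).
Proof.
move=> [[lA bA] [lB1 lB2] /bilinear_bound_gt0[CB CB0 BC] AB] vv; have [ldv [Cd dvC] vdv] := vv.
have [CA CA0 leA] := opnorm_le_gt0 bA.
have [Cv Cv0 vC] := frechet_calm vv.
split.
- by move=> a h k; rewrite ldv lA lB2 scalerDr addrACA.
- exists (CB * `|v z0| + CA * `|Cd|) => h; rewrite mulrDl.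
  rewrite (le_trans (ler_normD _ _))// lerD//.
    by rewrite (le_trans (BC _ _))// mulrAC.
  rewrite (le_trans (leA _))// -mulrA ler_wpM2l// ?(ltW CA0)//.
  by rewrite (le_trans (dvC _))// ler_wpM2r// ler_norm.
move=> e e0; pose N := `|v z0| + 1; have N0 : 0 < N by rewrite ltr_wpDl.
have e30 : 0 < e / 3 by rewrite divr_gt0.
have e1 : 0 < e / 3 / N by rewrite divr_gt0.
have e2 : 0 < e / 3 / CA by rewrite divr_gt0.
have e3 : 0 < e / 3 / (CB * Cv) by rewrite divr_gt0// mulr_gt0.
have eN : 0 < Cv^-1 by rewrite invr_gt0.
near=> z.
have h1 : `|A z (v z) - A z0 (v z) - B (z - z0) (v z)| <=
    e / 3 / N * `|z - z0| * `|v z|.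
  by move: (v z); near: z; exact: AB.
have h2 : `|v z - v z0 - dv (z - z0)| <= e / 3 / CA * `|z - z0|.
  by near: z; exact: vdv.
have h3 : `|v z - v z0| <= Cv * `|z - z0| by near: z.
have h4 : `|z - z0| <= e / 3 / (CB * Cv) by near: z; exact: near_dist.
have h5 : `|z - z0| <= Cv^-1 by near: z; exact: near_dist.
have h6 : `|v z| <= N.
  rewrite /N -(subrK (v z0) (v z)) addrC (le_trans (ler_normD _ _))// lerD//.
  by rewrite (le_trans h3)// -ler_pdivlMl// mulr1.
have -> : A z (v z) - A z0 (v z0) - (B (z - z0) (v z0) + A z0 (dv (z - z0))) =
  (A z (v z) - A z0 (v z) - B (z - z0) (v z)) + B (z - z0) (v z - v z0)
   + A z0 (v z - v z0 - dv (z - z0)).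
  rewrite (linear_for_sub _ _ (lB1 _)) 2!(linear_for_sub _ _ lA) opprD.
  rewrite [RHS](AC (3*2*3) (1*(3*4)*(2*6)*(7*5*8))) /= addNr addr0 addNr addr0.
  by rewrite !addrA.
set t := `|z - z0| in h1 h2 h3 h4 h5 *.
have t0 : 0 <= t by rewrite /t.
have -> : e * t = e / 3 * t + e / 3 * t + e / 3 * t by field.
rewrite (le_trans (ler_normD _ _))// lerD//.
  rewrite (le_trans (ler_normD _ _))// lerD//.
    rewrite (le_trans h1)//.
    have -> : e / 3 / N * t * `|v z| = e / 3 * t * (`|v z| / N) by ring.
    apply: ler_piMr; first by rewrite mulr_ge0// ltW.
    by rewrite ler_pdivrMr// mul1r.
  rewrite (le_trans (BC _ _))// -/t.
  rewrite (@le_trans _ _ (CB * t * (Cv * t)))//.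
    by rewrite ler_wpM2l// mulr_ge0// ltW.
  by rewrite mulrACA mulrA ler_wpM2r// mulrC -ler_pdivlMr// mulr_gt0.
rewrite (le_trans (leA _))// mulrC -ler_pdivlMr// (le_trans h2)//.
by rewrite mulrAC.
Unshelve. all: by end_near. Qed.

(** A bounded bilinear map curried in its first argument is an operator-valued map; this makes the
    product rule [frechet_bilin] an instance of [opfrechet_app]. *)
Lemma opfrechet_cst_bilinear Z U V W (b : U -> V -> W) (f : Z -> U) z0 df :
  (forall u, linear (b u)) -> (forall v, linear (b ^~ v)) ->
  (exists C, forall u v, `|b u v| <= C * `|u| * `|v|) ->
  frechet f z0 df -> opfrechet (b \o f) z0 (b \o df).
Proof.
move=> lb1 lb2 /bilinear_bound_gt0[C C0 bC] [ldf [D dfD] fdf].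
split.
- by split; [exact: lb1|exists (C * `|f z0|) => k; exact: bC].
- split=> [h|k a u v] /=; first exact: lb1.
  by rewrite ldf lb2.
- exists (C * D) => h k; rewrite (le_trans (bC _ _))// ler_wpM2r//.
  by rewrite -mulrA ler_wpM2l ?(ltW C0).
move=> e e0; have eC : 0 < e / C by rewrite divr_gt0.
apply: filterS (fdf _ eC) => z H k /=.
rewrite -(linear_for_sub (A := b ^~ k))// -(linear_for_sub (A := b ^~ k))//.
rewrite (le_trans (bC _ _))// ler_wpM2r//.
by rewrite mulrC -ler_pdivlMr// mulrAC.
Qed.

Lemma frechet_bilin Z U V W (b : U -> V -> W) (f : Z -> U) (g : Z -> V)
    z0 df dg :
  (forall u, linear (b u)) -> (forall v, linear (b ^~ v)) ->
  (exists C, forall u v, `|b u v| <= C * `|u| * `|v|) ->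
  frechet f z0 df -> frechet g z0 dg ->
  frechet (fun z => b (f z) (g z)) z0
    (fun h => b (df h) (g z0) + b (f z0) (dg h)).
Proof.
move=> lb1 lb2 bb fdf gdg.
exact: (opfrechet_app (opfrechet_cst_bilinear lb1 lb2 bb fdf) gdg).
Qed.

(** The inner map is exactly affine, as is the projection [z.1.1] for which this serves, so the
    remainder estimate transfers at the cost of the factor [C]. *)
Lemma opfrechet_comp Y Z U V (A : Z -> U -> V) B (p : Y -> Z) dp y0 :
  opfrechet A (p y0) B -> linear dp -> (exists C, opnorm_le dp C) ->
  (forall y, p y = p y0 + dp (y - y0)) ->
  opfrechet (A \o p) y0 (B \o dp).
Proof.
move=> [[lA bA] [lB1 lB2] /bilinear_bound_gt0[CB CB0 BC] AB] ldp /opnorm_le_gt0[C C0 dpC] pE.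
split => //.
- by split=> [h|k a u v] /=; [exact: lB1|rewrite ldp lB2].
- exists (CB * C) => h k /=.
  rewrite (le_trans (BC _ _))// ler_wpM2r//.
  by rewrite -mulrA ler_wpM2l// ltW.
move=> e e0; have eC : 0 < e / C by rewrite divr_gt0.
have H : \forall y \near y0,
  opnorm_le (fun k => A (p y) k - A (p y0) k - B (p y - p y0) k)
     (e / C * `|p y - p y0|).
  have : {for y0, continuous p}.
    apply/cvgrPdist_le => d d0; have dC : 0 < d / C by rewrite divr_gt0.
    apply: filterS (near_dist y0 dC) => y H.
    rewrite (pE y) opprD addrA subrr add0r normrN (le_trans (dpC _))//.
    by rewrite mulrC -ler_pdivlMr.
  by move=> cp; exact: (cp _ (AB _ eC)).
apply: filterS H => y /= H k.
have pB : p y - p y0 = dp (y - y0) by rewrite (pE y) addrAC subrr add0r.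
have := H k; rewrite pB => /le_trans; apply.
rewrite ler_wpM2r// (@le_trans _ _ (e / C * (C * `|y - y0|)))//.
  by rewrite ler_wpM2l// ltW.
by rewrite mulrA divfK// gt_eqF.
Qed.

End Frechet.

(** * Inner products: projection, Riesz representation, weak compactness *)

(** The diagonal extraction in [weak_sequential_compactness] sees the product topology only through
    these neighbourhoods, which control finitely many coordinates. *)
Lemma nbhs_prod_initial {R : realType} (c : prod_topology (fun _ : nat => R)) j (e : R) :
  0 < e -> nbhs c [set f : prod_topology (fun _ : nat => R) |
             forall k : 'I_j, `|(f k : R) - c k| < e].
Proof.
move=> e0; have FF : Filter (nbhs c) by exact: nbhs_filter.
apply: (@filter_forall _ 'I_j (fun k => [set f : prod_topology (fun _ : nat => R) |
  `|(f k : R) - c k| < e]) _ FF) => k.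
have H := @proj_continuous _ (fun _ : nat => R) k c.
have /(@cvgrPdist_lt _ _ _ _ _
  (fun f : prod_topology (fun _ : nat => R) => f k : R) (c k)) := H.
by move/(_ e e0); apply: filterS => f /=; rewrite distrC.
Qed.

Section InnerProduct.
Context {R : realType}.
Implicit Types V : normedModType R.

Definition sequentially_complete V := forall u : nat -> V,
  (forall e : R, 0 < e -> exists N, forall n p, (N <= n)%N -> (N <= p)%N ->
     `|u n - u p| <= e) ->
  exists l : V, u n @[n --> \oo] --> l.

(* An inner product whose norm is only equivalent to the ambient one, as is the
   case for products carrying the sup norm. *)
Record hilbertian V (ip : V -> V -> R) : Prop := Hilbertian {
  ipC : forall u v, ip u v = ip v u;
  ipDl : forall u v w, ip (u + v) w = ip u w + ip v w;
  ipZl : forall a u v, ip (a *: u) v = a * ip u v;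
  ip_coercive : exists2 k : R, 0 < k & forall u, k * `|u| ^+ 2 <= ip u u;
  ip_bounded : exists2 K : R, 0 < K & forall u v, `|ip u v| <= K * `|u| * `|v|;
  ip_complete : sequentially_complete V
}.

Context {V : normedModType R} {ip : V -> V -> R} (hip : hilbertian ip).
Implicit Types u v w : V.

Lemma ipDr u v w : ip w (u + v) = ip w u + ip w v.
Proof. by rewrite (ipC hip) (ipDl hip) !(ipC hip w). Qed.
Lemma ipZr a u v : ip v (a *: u) = a * ip v u.
Proof. by rewrite (ipC hip) (ipZl hip) (ipC hip). Qed.
Lemma ipNl u v : ip (- u) v = - ip u v.
Proof. by rewrite -scaleN1r (ipZl hip) mulN1r. Qed.
Lemma ipNr u v : ip u (- v) = - ip u v.
Proof. by rewrite -scaleN1r ipZr mulN1r. Qed.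
Lemma ip0l u : ip 0 u = 0.
Proof. by rewrite -(scale0r 0) (ipZl hip) mul0r. Qed.
Lemma ip0r u : ip u 0 = 0.
Proof. by rewrite (ipC hip) ip0l. Qed.
Definition ipE := (ipDl hip, ipDr, ipZl hip, ipZr, ipNl, ipNr, ip0l, ip0r).

Lemma ip_ge0 u : 0 <= ip u u.
Proof.
have [k k0 kV] := ip_coercive hip.
by apply: le_trans (kV u); rewrite mulr_ge0// ltW.
Qed.

Lemma ip_eq0 u : ip u u = 0 -> u = 0.
Proof.
have [k k0 kV] := ip_coercive hip => u0.
have := kV u; rewrite u0 pmulr_rle0// => H.
by apply/normr0_eq0/eqP; rewrite -sqrf_eq0 eq_le H sqr_ge0.
Qed.

Lemma ip_inj u v : (forall w, ip u w = ip v w) -> u = v.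
Proof.
move=> uv; apply/subr0_eq/ip_eq0.
by rewrite (ipDl hip) ipNl uv subrr.
Qed.

Lemma ip_cauchy_schwarz u v : ip u v ^+ 2 <= ip u u * ip v v.
Proof.
have [->|v0] := eqVneq v 0; first by rewrite !ip0r expr0n mulr0.
have vv0 : 0 < ip v v.
  rewrite lt0r ip_ge0 andbT; apply: contra v0 => /eqP/ip_eq0 ->//.
have := ip_ge0 (ip v v *: u - ip u v *: v).
rewrite !ipE (ipC hip v u) => H.
rewrite -subr_ge0 -(pmulr_rge0 _ vv0).
apply: le_trans H _; rewrite le_eqVlt; apply/orP; left; apply/eqP; ring.
Qed.

(** Here [a] stands for the inner product of a projection error with a test vector, [Q] for the
    squared norm of that vector and [e] for the defect of a minimising sequence. The choice
    [t = a / (Q + 1)] keeps its meaning when [Q = 0]. *)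
Lemma ip_near_orthogonal a Q : (forall t e, 0 < e -> 2 * t * a <= t ^+ 2 * Q + e) ->
  0 <= Q -> a = 0 :> R.
Proof.
move=> H Q0; have Q1 : 0 < Q + 1 by rewrite ltr_wpDl.
have H1 : 2 * (a / (Q + 1)) * a <= (a / (Q + 1)) ^+ 2 * Q.
  by apply/ler_addgt0Pr => e; exact: H.
apply/eqP; rewrite -sqrf_eq0 eq_le sqr_ge0 andbT.
have E : 2 * (a / (Q + 1)) * a - (a / (Q + 1)) ^+ 2 * Q =
   a ^+ 2 * ((Q + 2) / (Q + 1) ^+ 2) by field; rewrite gt_eqF.
rewrite -subr_le0 E in H1.
by rewrite pmulr_lle0// in H1; rewrite divr_gt0// ?exprn_gt0// ltr_wpDl.
Qed.

(** A minimising sequence for the distance to [W] is Cauchy by the parallelogram law. Orthogonality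
    at its limit comes from comparing [w n] with [w n + t w'] and letting the defect tend to
    zero. *)
Lemma orthogonal_projection (W : set V) v :
  W 0 -> (forall a u w, W u -> W w -> W (a *: u + w)) ->
  (forall u, (forall e, 0 < e -> exists2 w, W w & `|u - w| <= e) -> W u) ->
  exists2 w, W w & forall w', W w' -> ip (v - w) w' = 0.
Proof.
move=> W0 Wlin Wcl.
pose S := [set ip (v - w) (v - w) | w in W].
have Sinf : has_inf S.
  split; first by exists (ip (v - 0) (v - 0)), 0.
  by exists 0 => _ [w _ <-]; exact: ip_ge0.
have dS w : W w -> inf S <= ip (v - w) (v - w).
  by move=> Ww; apply: ge_inf; [exact: Sinf.2|exists w].
have ex n : exists w, W w /\ ip (v - w) (v - w) < inf S + n.+1%:R^-1.
  have [|_ [w Ww <-] H] := @inf_adherent R S n.+1%:R^-1 _ Sinf.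
    by rewrite invr_gt0.
  by exists w.
have [w wP] := choice ex.
have [k k0 kV] := ip_coercive hip; have [K K0 KV] := ip_bounded hip.
have wd n p : k * `|w n - w p| ^+ 2 <= 2 * n.+1%:R^-1 + 2 * p.+1%:R^-1.
  apply: (le_trans (kV _)).
  have [Wn Hn] := wP n; have [Wp Hp] := wP p.
  have := dS (2^-1 *: w n + 2^-1 *: w p).
  (* Closure of [W] is stated for [a *: u + w], so the midpoint is reached by two applications
     starting from [0]. *)
  have -> : 2^-1 *: w n + 2^-1 *: w p = 2^-1 *: w n + (2^-1 *: w p + 0).
    by rewrite addr0.
  move=> /(_ (Wlin _ _ _ Wn (Wlin _ _ _ Wp W0))); rewrite addr0.
  move: Hn Hp; rewrite !ipE (ipC hip (w n) v) (ipC hip (w p) v) (ipC hip (w p) (w n)).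
  move: (inf S) (n.+1%:R^-1) (p.+1%:R^-1) => d a b; lra.
have small e : 0 < e -> exists N, forall n, (N <= n)%N -> n.+1%:R^-1 <= e :> R.
  move=> e0; exists (Num.truncn e^-1) => n Nn.
  rewrite invf_ple ?posrE//.
  by rewrite (le_trans (ltW (truncnS_gt _)))// ler_nat.
have [l wl] : exists l : V, w n @[n --> \oo] --> l.
  apply: ((ip_complete hip) w) => e e0.
  have [|N NP] := small (k * e ^+ 2 / 4); first by rewrite divr_gt0 ?mulr_gt0 ?exprn_gt0.
  exists N => n p /NP Hn /NP Hp.
  rewrite -(@ler_pXn2r _ 2) ?nnegrE ?(ltW e0)// -(ler_pM2l k0).
  apply: (le_trans (wd n p)); move: Hn Hp; move: (n.+1%:R^-1) (p.+1%:R^-1) => a b; lra.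
have wl' e : 0 < e -> exists N, forall n, (N <= n)%N -> `|l - w n| <= e.
  move=> e0; have /cvgrPdist_le/(_ e e0)[N _ NP] := wl.
  by exists N => n; exact: NP.
exists l.
  apply: Wcl => e /wl'[N NP]; exists (w N); first by have [] := wP N.
  exact: NP.
move=> w' Ww'; apply: (@ip_near_orthogonal _ (ip w' w')); last exact: ip_ge0.
move=> t e e0.
(* [M] bounds the price, per unit of [|l - w n|], of replacing the limit [l] by [w n] in the test;
   the [+ 1] makes it invertible. *)
pose M := 2 * `|t| * (K * `|w'|) + 1.
have M0 : 0 < M by rewrite ltr_wpDl// !mulr_ge0// ltW.
have [|N1 N1P] := small (e / 2); first by rewrite divr_gt0.
have [|N2 N2P] := wl' (e / 2 / M); first by rewrite !divr_gt0.
pose n := maxn N1 N2.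
have h1 := N1P n (leq_maxl _ _); have h2 := N2P n (leq_maxr _ _).
have [Wn Hn] := wP n.
have := dS _ (Wlin t w' (w n) Ww' Wn).
have h3 : 2 * t * (ip (v - l) w' - ip (v - w n) w') <= e / 2.
  have -> : ip (v - l) w' - ip (v - w n) w' = ip (w n - l) w'.
    by rewrite !ipE; ring.
  rewrite (le_trans (ler_norm _))// 2!normrM normr_nat.
  rewrite (@le_trans _ _ (2 * `|t| * (K * `|w n - l| * `|w'|)))//.
    by rewrite ler_wpM2l// mulr_ge0.
  rewrite distrC.
  rewrite (@le_trans _ _ (M * `|l - w n|))//.
    rewrite -subr_ge0.
    have -> : M * `|l - w n| - 2 * `|t| * (K * `|l - w n| * `|w'|) = `|l - w n|.
      by rewrite /M; ring.
    by [].
  by rewrite mulrC -ler_pdivlMr.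
have -> : v - (t *: w' + w n) = (v - w n) - t *: w' by rewrite opprD addrAC addrA.
move: h3 Hn h1; move: (v - w n) (v - l) (inf S) (n.+1%:R^-1) => y y' d a.
rewrite !ipE (ipC hip w' y); lra.
Qed.

(** If [y] is orthogonal to the kernel of [l] and [l y != 0], then [h - (l h / l y) y] lies in the
    kernel for every [h], which forces [l h = (l y / ip y y) ip y h]. *)
Lemma riesz (l : V -> R) : linear l -> (exists C, opnorm_le l C) ->
  exists u, forall v, l v = ip u v.
Proof.
move=> ll /opnorm_le_gt0[C C0 lC].
have [[v lv]|l0] := pselect (exists v, l v != 0); last first.
  exists 0 => v; rewrite ip0l; apply/eqP.
  by apply: contrapT => /negP H; apply: l0; exists v.
have [||u uP|w lw wP] := @orthogonal_projection [set u | l u = 0] v.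
- exact: (linear_for0 ll).
- by move=> a u w /= lu lw; rewrite ll lu lw scaler0 addr0.
- apply/eqP; rewrite -normr_le0; apply/ler_addgt0Pr => e e0; rewrite add0r.
  have [|w /= lw] := uP (e / C); first by rewrite divr_gt0.
  rewrite ler_pdivlMr// mulrC => H.
  by rewrite -[l u]subr0 -lw -(linear_for_sub _ _ ll) (le_trans (lC _)).
pose y := v - w.
have ly : l y = l v by rewrite (linear_for_sub _ _ ll) lw subr0.
have yy : ip y y != 0.
  apply: contra lv => /eqP/ip_eq0 y0; rewrite -ly y0.
  by rewrite (linear_for0 ll).
rewrite -/y in wP; clearbody y; exists ((l y / ip y y) *: y) => h.
have := wP (h - (l h / l y) *: y).
rewrite /= (linear_for_sub _ _ ll) (linear_for_scale _ _ ll).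
rewrite /GRing.scale /= divfK ?ly// subrr => /(_ erefl).
rewrite !ipE => /subr0_eq ->; field.
by rewrite yy lv.
Qed.

(** Tychonoff gives a cluster point of the bounded sequences of products with the [z k]; a diagonal
    choice makes these products converge along [s], convergence extends to every vector, and [riesz]
    represents the limit functional. The condition [n <= s n] is what passing to limits along [s]
    relies on. *)
Lemma weak_sequential_compactness (z : nat -> V) (M : R) :
  (forall n, `|z n| <= M) ->
  exists2 s : nat -> nat, (forall n, (n <= s n)%N) &
    exists w, forall v, ip (z (s n)) v @[n --> \oo] --> ip w v.
Proof.
move=> zM; have [K K0 KV] := ip_bounded hip.
have M0 : 0 <= M by apply: (le_trans _ (zM 0)).
pose B := K * M * M.
have [c [_ cc]] : [set f : prod_topology (fun _ : nat => R) | forall k, `[- B, B]%classic (f k)] `&`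
    cluster ((fun n => (fun k => ip (z n) (z k)) : prod_topology (fun _ : nat => R)) @ \oo) !=set0.
  apply: (tychonoff (T := fun _ : nat => R) (A := fun _ => `[- B, B]%classic)).
    by move=> k; exact: segment_compact.
  exists 0%N => // n _ k /=; rewrite in_itv/= -ler_norml (le_trans (KV _ _))//.
  by rewrite /B !ler_pM// ?mulr_ge0// ltW.
have pick j N : exists n, (N <= n)%N /\
    forall k, (k <= j)%N -> `|ip (z n) (z k) - c k| < j.+1%:R^-1.
  have nA := @nbhs_prod_initial _ c j.+1 j.+1%:R^-1 _.
  have F : ((fun n => (fun k => ip (z n) (z k)) : prod_topology (fun _ : nat => R)) @ \oo)
     [set f | exists2 n, (N <= n)%N & f = (fun k => ip (z n) (z k))].
    by exists N => // n /= Nn; exists n.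
  have [|_ [[n Nn ->] An]] := cc _ _ F (nA _); first by rewrite invr_gt0.
  exists n; split => // k kj.
  by have := An (inord k); rewrite inordK.
pose p j := projT1 (choice (pick j)).
have pP j := projT2 (choice (pick j)); rewrite -/(p _) in pP.
(* Passing [(s n').+1] as lower bound makes [s] strictly increasing, whence [n <= s n]. *)
pose s := fix s n := if n is n'.+1 then p n'.+1 (s n').+1 else p 0%N 0%N.
have sP j k : (k <= j)%N -> `|ip (z (s j)) (z k) - c k| < j.+1%:R^-1.
  by case: j => [|j] kj /=; [have [_] := pP 0%N 0%N|have [_] := pP j.+1 (s j).+1]; exact.
have sge n : (n <= s n)%N.
  elim: n => // n IH /=; have [H _] := pP n.+1 (s n).+1.
  exact: leq_ltn_trans IH H.
exists s => //.
(* [W] is a closed subspace containing every [z k]; the component of [v]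
   orthogonal to [W] is orthogonal to all [z k], hence lies in [W] as well. *)
pose W := [set v | forall e : R, 0 < e -> exists N, forall n q, (N <= n)%N -> (N <= q)%N ->
  `|ip (z (s n) - z (s q)) v| <= e].
have Wz k : W (z k).
  move=> e e0; exists (maxn k (Num.truncn (2 / e))) => n q.
  have aux r : (maxn k (Num.truncn (2 / e)) <= r)%N ->
      `|ip (z (s r)) (z k) - c k| <= e / 2.
    rewrite geq_max => /andP[kr er].
    rewrite (le_trans (ltW (sP _ _ kr)))// invf_ple ?posrE ?divr_gt0//.
    by rewrite invf_div (le_trans (ltW (truncnS_gt _)))// ler_nat.
  move=> /aux Hn /aux Hq.
  have -> : ip (z (s n) - z (s q)) (z k) =
      (ip (z (s n)) (z k) - c k) - (ip (z (s q)) (z k) - c k).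
    by rewrite (ipDl hip) ipNl; ring.
  by rewrite [e]splitr (le_trans (ler_normB _ _))// lerD.
have WV v : W v.
  have [||u uP|w Ww wP] := @orthogonal_projection W v.
  - by move=> e e0; exists 0%N => n q _ _; rewrite ip0r normr0 ltW.
  - move=> a u w Wu Ww e e0.
    have [|N1 N1P] := Wu (e / 2 / (`|a| + 1)).
      by rewrite !divr_gt0// ltr_wpDl.
    have [|N2 N2P] := Ww (e / 2); first by rewrite divr_gt0.
    exists (maxn N1 N2) => n q; rewrite !geq_max => /andP[n1 n2] /andP[q1 q2].
    rewrite ipDr ipZr [e]splitr (le_trans (ler_normD _ _))// lerD ?N2P//.
    have := N1P n q n1 q1; rewrite ler_pdivlMr ?ltr_wpDl//; apply: le_trans.
    by rewrite normrM mulrC ler_wpM2l// lerDl.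
  - move=> e e0.
    have [|w Ww uw] := uP (e / 2 / (K * (2 * M) + 1)).
      by rewrite !divr_gt0// ltr_wpDl// !mulr_ge0// ltW.
    have [|N NP] := Ww (e / 2); first by rewrite divr_gt0.
    exists N => n q Nn Nq.
    rewrite -(subrK w u) ipDr [e]splitr (le_trans (ler_normD _ _))// lerD ?NP//.
    rewrite (le_trans (KV _ _))//.
    move: uw; rewrite ler_pdivlMr ?ltr_wpDl// ?mulr_ge0 ?(ltW K0)//; apply: le_trans.
    rewrite [leRHS]mulrC ler_wpM2r//.
    rewrite (@le_trans _ _ (K * (2 * M)))// ?lerDl// ler_wpM2l ?(ltW K0)//.
    by rewrite (le_trans (ler_normB _ _))// mulrDl !mul1r lerD.
  have Wvw : W (v - w).
    move=> e e0; exists 0%N => n q _ _.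
    by rewrite (ipDl hip) ipNl !(ipC hip _ (v - w)) !wP// subrr normr0 ltW.
  by have /ip_eq0/subr0_eq -> := wP _ Wvw.
have lim_ex v : exists a : R, ip (z (s n)) v @[n --> \oo] --> a.
  apply/cvg_ex/cauchy_cvgP/cauchy_ballP => e e0.
  have [|N NP] := WV v (e / 2); first by rewrite divr_gt0.
  near_simpl; exists ([set n | (N <= n)%N], [set n | (N <= n)%N]) => /=.
    by split; exists N.
  move=> [n q] /= [Nn Nq]; rewrite /ball/= (le_lt_trans (y := e / 2))//.
    by have := NP n q Nn Nq; rewrite (ipDl hip) ipNl.
  by rewrite ltr_pdivrMr// mulr_natr mulr2n ltrDl.
have [L LP] := choice lim_ex.
have cvgu (u : nat -> R) (a b : R) : u @ \oo --> a -> u @ \oo --> b -> a = b.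
  by move=> ua ub; rewrite -(cvg_lim (@Rhausdorff R) ua) (cvg_lim (@Rhausdorff R) ub).
have [w wP] : exists w, forall v, L v = ip w v.
  apply: riesz.
    move=> a u v; apply: (cvgu _ _ _ (LP _)).
    under eq_fun do rewrite ipDr ipZr.
    by apply: cvgD; [apply: cvgM; [exact: cvg_cst|]|].
  exists (K * M) => v.
  apply: (ler_cvg_to (cvg_norm (LP v)) (cvg_cst (K * M * `|v|))).
  by apply: nearW => n; rewrite (le_trans (KV _ _))// ler_wpM2r// ler_wpM2l ?(ltW K0).
by exists w => v; rewrite -wP.
Unshelve. all: by end_near. Qed.

End InnerProduct.

(** * The inner products of the spaces at hand *)

Section HilbertianInstances.
Context {R : realType}.

Lemma cauchy_sequentially_complete (V : normedModType R) :
  (forall u : nat -> V, cauchy (u @ \oo) -> exists l : V, u @ \oo --> l) ->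
  sequentially_complete V.
Proof.
move=> cV u uC; apply: cV; apply/cauchy_ballP => e e0.
have [|N NP] := uC (e / 2); first by rewrite divr_gt0.
near_simpl; exists ([set n | (N <= n)%N], [set n | (N <= n)%N]) => /=.
  by split; exists N.
move=> [n q] /= [Nn Nq]; rewrite -ball_normE/= (le_lt_trans (NP n q Nn Nq))//.
by rewrite ltr_pdivrMr// mulr_natr mulr2n ltrDl.
Qed.

Lemma sequentially_complete_cnorm (V : completeNormedModType R) :
  sequentially_complete V.
Proof.
apply: cauchy_sequentially_complete => u /cauchy_cvg uC.
by apply/cvg_ex.
Qed.

Lemma sequentially_complete_rV m : sequentially_complete 'rV[R]_m.
Proof.
apply: cauchy_sequentially_complete => u /cauchy_cvg uC.
by apply/cvg_ex.
Qed.

Lemma prod_norm_le (U V : normedModType R) (z : U * V) (e : R) :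
  (`|z| <= e) = (`|z.1| <= e) && (`|z.2| <= e).
Proof. by rewrite ge_max. Qed.

Lemma norm_fst_le (U V : normedModType R) (z : U * V) : `|z.1| <= `|z|.
Proof. by have := lexx `|z|; rewrite {1}prod_norm_le => /andP[]. Qed.

Lemma norm_snd_le (U V : normedModType R) (z : U * V) : `|z.2| <= `|z|.
Proof. by have := lexx `|z|; rewrite {1}prod_norm_le => /andP[]. Qed.

Lemma sequentially_complete_prod (U V : normedModType R) :
  sequentially_complete U -> sequentially_complete V ->
  sequentially_complete (U * V)%type.
Proof.
move=> cU cV u uC.
have [e e0|l1 ul1] := cU (fst \o u).
  have [N NP] := uC e e0; exists N => n p Nn Np.
  exact: le_trans (norm_fst_le (u n - u p)) (NP _ _ Nn Np).
have [e e0|l2 ul2] := cV (snd \o u).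
  have [N NP] := uC e e0; exists N => n p Nn Np.
  exact: le_trans (norm_snd_le (u n - u p)) (NP _ _ Nn Np).
exists (l1, l2).
have -> : u = fun n => ((fst \o u) n, (snd \o u) n).
  by apply/funext => n /=; case: (u n).
exact: cvg_pair.
Qed.

Lemma hilbertian_dotp (X : hilbertType R) : hilbertian (@dotp R X).
Proof.
split.
- exact: dotpC.
- exact: dotpDl.
- exact: dotpZl.
- by exists 1 => // u; rewrite mul1r dotp_norm.
- exists 1 => // u v; rewrite mul1r.
  have dotpBB a : dotp (u - a *: v) (u - a *: v) =
      `|u| ^+ 2 - 2 * a * dotp u v + a ^+ 2 * `|v| ^+ 2.
    rewrite -!dotp_norm dotpDl -scaleNr dotpZl [dotp u _]dotpC [dotp v _]dotpC.
    by rewrite !dotpDl !dotpZl (dotpC v u); ring.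
  have [->|v0] := eqVneq v 0.
    by rewrite normr0 mulr0 dotpC -(scale0r 0) dotpZl mul0r normr0.
  have vv0 : 0 < `|v| ^+ 2 by rewrite exprn_gt0// normr_gt0.
  rewrite -(@ler_pXn2r _ 2) ?nnegrE ?mulr_ge0// real_normK ?num_real// exprMn.
  have := dotpBB (dotp u v / `|v| ^+ 2); rewrite dotp_norm => H.
  have : 0 <= `|u| ^+ 2 * `|v| ^+ 2 - dotp u v ^+ 2.
    have -> : `|u| ^+ 2 * `|v| ^+ 2 - dotp u v ^+ 2 =
       `|u - (dotp u v / `|v| ^+ 2) *: v| ^+ 2 * `|v| ^+ 2.
      rewrite H; field.
      by rewrite normr_eq0.
    by rewrite mulr_ge0// exprn_ge0.
  by rewrite subr_ge0.
exact: sequentially_complete_cnorm.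
Qed.

Lemma norm_coord_le m (u : 'rV[R]_m) i : `|u 0 i| <= `|u|.
Proof.
rewrite -[leRHS]/(mx_norm u) mx_normrE.
by apply: (le_bigmax_cond _ (fun i => `|u i.1 i.2|) (j := (0, i))).
Qed.

Lemma hilbertian_edot m : hilbertian (@edot R m).
Proof.
split.
- by move=> u v; apply: eq_bigr => i _; rewrite mulrC.
- by move=> u v w; rewrite -big_split/=; apply: eq_bigr => i _; rewrite mxE mulrDl.
- by move=> a u v; rewrite big_distrr/=; apply: eq_bigr => i _; rewrite mxE mulrA.
- exists 1 => // u; rewrite mul1r -[`|u|]/(mx_norm u).
  have [->|/mx_norm_neq0[[j i] ->]] := eqVneq (mx_norm u) 0.
    by rewrite expr0n/= sumr_ge0// => i _; rewrite -expr2 sqr_ge0.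
  rewrite /= (ord1 j) /edot (bigD1 i)//= real_normK ?num_real// -expr2 lerDl.
  by rewrite sumr_ge0// => k _; rewrite -expr2 sqr_ge0.
(* [m.+1] rather than [m], because the constant must be positive even when [m = 0]. *)
- exists m.+1%:R => [|u v]; first by rewrite ltr0n.
  rewrite (le_trans (ler_norm_sum _ _ _))//.
  rewrite (@le_trans _ _ (\sum_(i < m) `|u| * `|v|))//.
    by apply: ler_sum => i _; rewrite normrM ler_pM// norm_coord_le.
  rewrite sumr_const card_ord -mulrA -[leLHS]mulr_natl ler_wpM2r ?mulr_ge0//.
  by rewrite ler_nat.
exact: sequentially_complete_rV.
Qed.

Lemma hilbertian_prod (U V : normedModType R) ipU ipV :
  @hilbertian R U ipU -> @hilbertian R V ipV ->
  @hilbertian R (U * V)%type (fun z w => ipU z.1 w.1 + ipV z.2 w.2).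
Proof.
move=> hU hV; split.
- by move=> u v; rewrite (ipC hU) (ipC hV).
- by move=> u v w; rewrite /= (ipDl hU) (ipDl hV); ring.
- by move=> a u v; rewrite /= (ipZl hU) (ipZl hV); ring.
- have [k k0 kU] := ip_coercive hU; have [l l0 lV] := ip_coercive hV.
  exists (Num.min k l) => [|z]; first by rewrite lt_min k0.
  have m0 : 0 <= Num.min k l by rewrite le_min !ltW.
  have [E|E] : `|z| = `|z.1| \/ `|z| = `|z.2|.
    have zE : `|z| = Num.max `|z.1| `|z.2| by [].
    by rewrite zE maxEle; case: ifP => _; [right|left].
  + rewrite E -[leLHS]addr0 lerD ?(ip_ge0 hV)// (le_trans _ (kU _))//.
    by rewrite ler_wpM2r ?sqr_ge0// ge_min lexx.
  + rewrite E -[leLHS]add0r lerD ?(ip_ge0 hU)// (le_trans _ (lV _))//.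
    by rewrite ler_wpM2r ?sqr_ge0// ge_min lexx orbT.
- have [k k0 kU] := ip_bounded hU; have [l l0 lV] := ip_bounded hV.
  exists (k + l) => [|z w]; first by rewrite addr_gt0.
  rewrite (le_trans (ler_normD _ _))// !mulrDl lerD//.
    by rewrite (le_trans (kU _ _))// !ler_pM ?norm_fst_le ?mulr_ge0// ?(ltW k0)//.
  by rewrite (le_trans (lV _ _))// !ler_pM ?norm_snd_le ?mulr_ge0// ?(ltW l0)//.
exact: sequentially_complete_prod (ip_complete hU) (ip_complete hV).
Qed.

Lemma hilbertian_prod_dot (X H : hilbertType R) m : hilbertian (@prod_dot R X H m).
Proof.
exact: hilbertian_prod (hilbertian_prod (hilbertian_dotp X) (hilbertian_dotp H))
  (hilbertian_edot m).
Qed.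

(** This is the energy inner product of an operator bounded below; through it the Riesz theorem
    becomes the solvability result [residual_solvable]. *)
Lemma hilbertian_pullback (V : normedModType R) (ip : V -> V -> R) (T : V -> V) (a : R) :
  hilbertian ip -> linear T -> (exists C, opnorm_le T C) ->
  0 < a -> (forall u, a * ip u u <= ip (T u) (T u)) ->
  hilbertian (fun u v => ip (T u) (T v)).
Proof.
move=> hip lT /opnorm_le_gt0[C C0 TC] a0 aT; split.
- by move=> u v; rewrite (ipC hip).
- by move=> u v w; rewrite (linear_for_add _ _ lT) (ipDl hip).
- by move=> b u v; rewrite (linear_for_scale _ _ lT) (ipZl hip).
- have [k k0 kV] := ip_coercive hip.
  exists (a * k) => [|u]; first by rewrite mulr_gt0.
  by rewrite (le_trans _ (aT u))// -mulrA ler_wpM2l ?(ltW a0).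
- have [K K0 KV] := ip_bounded hip.
  exists (K * C * C) => [|u v]; first by rewrite !mulr_gt0.
  rewrite (le_trans (KV _ _))// -!mulrA ler_wpM2l ?(ltW K0)//.
  by apply: (le_trans (ler_pM _ _ (TC u) (TC v))) => //; rewrite mulrACA [leRHS]mulrA.
exact: ip_complete hip.
Qed.

Lemma dotp_le (X : hilbertType R) (u v : X) : `|dotp u v| <= `|u| * `|v|.
Proof.
rewrite -(@ler_pXn2r _ 2) ?nnegrE ?mulr_ge0// real_normK ?num_real// exprMn.
rewrite -!dotp_norm; exact: ip_cauchy_schwarz (hilbertian_dotp X) u v.
Qed.

End HilbertianInstances.

(** * Gradients and adjoints *)

Section FrechetRules.
Context {R : realType}.
Implicit Types U V Z : normedModType R.

Lemma frechet_mul Z (f g : Z -> R) z df dg : frechet f z df -> frechet g z dg ->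
  frechet (fun y => f y * g y) z (fun h => df h * g z + f z * dg h).
Proof.
apply: (frechet_bilin (b := fun u v : R => u * v)).
- by move=> u a v w; rewrite mulrDr scalerAr.
- by move=> u a v w; rewrite mulrDl scalerAl.
- by exists 1 => u v; rewrite mul1r normrM.
Qed.

Lemma frechet_scaler Z V (f : Z -> R) (v : Z -> V) z df dv :
  frechet f z df -> frechet v z dv ->
  frechet (fun y => f y *: v y) z (fun h => df h *: v z + f z *: dv h).
Proof.
apply: (frechet_bilin (b := fun (u : R) v => u *: v)).
- by move=> u a v' w; rewrite scalerDr !scalerA mulrC.
- by move=> u a v' w; rewrite scalerDl scalerA.
- by exists 1 => u v'; rewrite mul1r normrZ.
Qed.

Lemma frechet_ip Z V (ip : V -> V -> R) (hip : hilbertian ip)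
    (f g : Z -> V) z df dg : frechet f z df -> frechet g z dg ->
  frechet (fun y => ip (f y) (g y)) z (fun h => ip (df h) (g z) + ip (f z) (dg h)).
Proof.
have [K _ KV] := ip_bounded hip.
apply: frechet_bilin.
- by move=> u a v w; rewrite (ipDr hip) (ipZr hip).
- by move=> u a v w; rewrite (ipDl hip) (ipZl hip).
- by exists K.
Qed.

Lemma frechet_inv Z (f : Z -> R) z df : frechet f z df -> f z != 0 ->
  frechet (fun y => (f y)^-1) z (fun h => - df h / f z ^+ 2).
Proof.
move=> fz f0; have := diff_frechet (differentiable_Rinv f0).
move=> /(frechet_comp fz)/frechet_eq; apply => h /=.
by rewrite diff_Rinv//= mulNr mulrC /GRing.scale/= mulNr.
Qed.

(** Squaring removes the kink of the positive part: the first-order remainder of [Num.max t 0 ^+ 2]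
    at [s] is at most [(t - s)^2] in every sign configuration. *)
Lemma frechet_sqr_pos Z (f : Z -> R) z df : frechet f z df ->
  frechet (fun y => Num.max (f y) 0 ^+ 2) z (fun h => 2 * Num.max (f z) 0 * df h).
Proof.
move=> fz; have fc := frechet_comp fz.
apply: (fc _ (fun t => Num.max t 0 ^+ 2) (fun h => 2 * Num.max (f z) 0 * h)).
split.
- by move=> a u v; rewrite mulrDr scalerAr.
- by exists `|2 * Num.max (f z) 0| => h; rewrite normrM.
move=> e e0; apply: filterS (near_dist (f z) e0) => t te.
rewrite (@le_trans _ _ (`|t - f z| * `|t - f z|))//; last by rewrite ler_wpM2r.
rewrite -normrM ger0_norm; last by rewrite -expr2 sqr_ge0.
move: (f z) (t : R) => s {te}t; rewrite ler_norml; apply/andP.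
have := sqr_ge0 (t - s); rewrite expr2 => ?.
by rewrite !maxEle; case: (lerP t 0) => ?; case: (lerP s 0) => ?; split; nra.
Qed.

Lemma frechet_pre U V Z (f : U -> V) (p : Z -> U) z A :
  linear p -> (exists C, opnorm_le p C) -> frechet f (p z) A ->
  frechet (fun y => f (p y)) z (fun h => A (p h)).
Proof. by move=> lp bp fA; exact: frechet_comp (frechet_lin z lp bp) fA. Qed.

End FrechetRules.

Section Representation.
Context {R : realType} {X : hilbertType R}.
Implicit Types (H : hilbertType R) (Z : normedModType R).

Definition rieszv (l : X -> R) : X := xget 0 [set v | forall h, dotp v h = l h].

Lemma dotp_rieszv (l : X -> R) h : linear l -> (exists C, opnorm_le l C) ->
  dotp (rieszv l) h = l h.
Proof.
move=> ll bl; rewrite /rieszv; case: xgetP => [v _ -> //|].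
have [u uP] := riesz (hilbertian_dotp X) ll bl.
by move=> /(_ u) []; move=> k; rewrite uP.
Qed.

Lemma dotp_inj (u v : X) : (forall h, dotp u h = dotp v h) -> u = v.
Proof. exact: ip_inj (hilbertian_dotp X) u v. Qed.

Lemma norm_le_dotp (u : X) C : 0 <= C -> (forall h, dotp u h <= C * `|h|) -> `|u| <= C.
Proof.
move=> C0 uC; have := uC u; rewrite dotp_norm expr2.
have [->|u0] := eqVneq u 0; first by rewrite normr0.
by rewrite ler_pM2r// normr_gt0.
Qed.

Lemma rieszv_norm_le (l : X -> R) C : linear l -> 0 <= C -> opnorm_le l C ->
  `|rieszv l| <= C.
Proof.
move=> ll C0 lC; apply: norm_le_dotp => // h.
by rewrite dotp_rieszv//; [exact: le_trans (ler_norm _) (lC _)|exists C].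
Qed.

Lemma rieszv_unique (l : X -> R) v : (forall h, dotp v h = l h) -> rieszv l = v.
Proof.
move=> vl; rewrite /rieszv; case: xgetP => [u _ uP|]; last by move=> /(_ v)[].
by apply: dotp_inj => h; rewrite uP vl.
Qed.

Lemma dotp_grad (f : X -> R) x h : differentiable f x ->
  dotp (grad f x) h = 'd f x h.
Proof.
move=> df; rewrite /grad; case: xgetP => [v _ [_ ->]//|].
have [ld bd _] := diff_frechet df.
have [u uP] := riesz (hilbertian_dotp X) ld bd.
by move=> /(_ u) []; split.
Qed.

Lemma grad_rieszv (f : X -> R) x : differentiable f x -> grad f x = rieszv ('d f x).
Proof.
move=> df; apply/esym/rieszv_unique => h; exact: dotp_grad.
Qed.

Lemma frechet_grad (f : X -> R) x A v : frechet f x A ->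
  (forall h, A h = dotp v h) -> grad f x = v.
Proof.
move=> /frechet_diff[df dfE] Av; apply: dotp_inj => h.
by rewrite dotp_grad// dfE Av.
Qed.

Lemma dotp_comp_linear H (A : X -> H) l : linear A -> (exists C, opnorm_le A C) ->
  linear (fun h => dotp l (A h)) /\ exists C, opnorm_le (fun h => dotp l (A h)) C.
Proof.
move=> lA /opnorm_le_gt0[C C0 AC]; split.
  by move=> a u v; rewrite lA (ipDr (hilbertian_dotp H)) (ipZr (hilbertian_dotp H)).
exists (`|l| * C) => h; rewrite (le_trans (dotp_le _ _))// -mulrA ler_wpM2l//.
Qed.

Lemma dotp_adjoint H (A : X -> H) l h : linear A -> (exists C, opnorm_le A C) ->
  dotp (adjoint A l) h = dotp l (A h).
Proof.
by move=> lA bA; have [? ?] := dotp_comp_linear l lA bA; exact: dotp_rieszv.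
Qed.

Lemma linear_adjoint H (A : X -> H) : linear A -> (exists C, opnorm_le A C) ->
  linear (adjoint A).
Proof.
move=> lA bA a u v; apply: dotp_inj => h.
by rewrite dotpDl dotpZl !dotp_adjoint// dotpDl dotpZl.
Qed.

Lemma opnorm_adjoint H (A : X -> H) C : linear A -> 0 <= C -> opnorm_le A C ->
  opnorm_le (adjoint A) C.
Proof.
move=> lA C0 AC l; apply: norm_le_dotp; first by rewrite mulr_ge0.
move=> h; rewrite dotp_adjoint//; last by exists C.
rewrite (le_trans (ler_norm _))// (le_trans (dotp_le _ _))//.
by rewrite [leRHS]mulrAC [leRHS]mulrC ler_wpM2l.
Qed.

(** Representing a functional by a vector is linear and does not increase norms, so it commutes with
    differentiation. This turns second derivatives into derivatives of gradients. *)
Lemma opfrechet_rieszv Z (A : Z -> X -> R) z0 B :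
  opfrechet A z0 B -> (forall z, linear (A z)) ->
  (forall z, exists C, opnorm_le (A z) C) ->
  frechet (fun z => rieszv (A z)) z0 (fun h => rieszv (B h)).
Proof.
move=> [_ [lB1 lB2] /bilinear_bound_gt0[C C0 BC] AB] lA bA.
have bB h : exists D, opnorm_le (B h) D by exists (C * `|h|) => k; exact: BC.
split.
- move=> a u v; apply: dotp_inj => h.
  by rewrite dotpDl dotpZl !dotp_rieszv// lB2.
- by exists C => h; apply: rieszv_norm_le => //; rewrite mulr_ge0// ltW.
move=> e e0; apply: filterS (AB e e0) => z H.
apply: norm_le_dotp; first by rewrite mulr_ge0// ltW.
move=> h; rewrite !dotpDl !(ipNl (hilbertian_dotp X)) !dotp_rieszv//.
by rewrite (le_trans (ler_norm _))// H.
Qed.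

(** The same mechanism for adjoints, which are additive in the operator and keep its bounds; it
    differentiates the adjoint of [DF(x)] in [x]. *)
Lemma opfrechet_adjoint H Z (A : Z -> X -> H) z0 B :
  opfrechet A z0 B -> (forall z, linear (A z)) ->
  (forall z, exists C, opnorm_le (A z) C) ->
  opfrechet (fun z => adjoint (A z)) z0 (fun h => adjoint (B h)).
Proof.
move=> [_ [lB1 lB2] /bilinear_bound_gt0[C C0 BC] AB] lA bA.
have bB h : exists D, opnorm_le (B h) D by exists (C * `|h|) => k; exact: BC.
split.
- split; first exact: linear_adjoint.
  have [D D0 AD] := opnorm_le_gt0 (bA z0).
  by exists D; apply: opnorm_adjoint => //; exact: ltW.
- split=> [h|k a u v]; first exact: linear_adjoint.
  apply: dotp_inj => h; rewrite dotpDl dotpZl !dotp_adjoint// lB2.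
  by rewrite (ipDr (hilbertian_dotp H)) (ipZr (hilbertian_dotp H)).
- exists C => h k.
  by apply: (@opnorm_adjoint _ _ (C * `|h|)) => //; rewrite mulr_ge0// ltW.
move=> e e0; apply: filterS (AB e e0) => z Hz l.
apply: norm_le_dotp; first by rewrite !mulr_ge0// ltW.
move=> h; rewrite !dotpDl !(ipNl (hilbertian_dotp X)) !dotp_adjoint//.
rewrite -!(ipNr (hilbertian_dotp H)) -!(ipDr (hilbertian_dotp H)).
rewrite (le_trans (ler_norm _))// (le_trans (dotp_le _ _))//.
by rewrite [leRHS]mulrAC [leRHS]mulrC ler_wpM2l// Hz.
Qed.

Lemma is_diff2_opfrechet (V : normedModType R) (f : X -> V) x B :
  is_diff2 f x B -> opfrechet (fun y => 'd f y) x B.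
Proof.
move=> [df [lB1 lB2] [C BC] fB].
have [ld bd _] := diff_frechet (nbhs_singleton df).
by split => //; exists C.
Qed.

Lemma twice_differentiable_diff2 (V : normedModType R) (f : X -> V) x :
  twice_differentiable f x -> is_diff2 f x (diff2 f x).
Proof.
move=> fx; rewrite /diff2.
exact: (@xgetPex _ (fun _ _ => 0) [set B | is_diff2 f x B] fx).
Qed.

End Representation.

(** * The gradient of the Lagrangian and the KKT penalty *)

Section LagrangianCalculus.
Context {R : realType} {X H : hilbertType R} {m : nat}.
Variables (f : X -> R) (F : X -> H) (g : 'I_m -> X -> R).
Hypothesis df : forall x, differentiable f x.
Hypothesis dF : forall x, differentiable F x.
Hypothesis dg : forall i x, differentiable (g i) x.
Implicit Types (x : X) (z w : X * H * 'rV[R]_m) (u v : H * 'rV[R]_m).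

Definition mult_dot u v : R := dotp u.1 v.1 + edot u.2 v.2.

Lemma hilbertian_mult_dot : hilbertian mult_dot.
Proof. exact: hilbertian_prod (hilbertian_dotp H) (hilbertian_edot m). Qed.

(** This is [S], and [mult_op] is [T]: [gradL] is [grad f] plus [S] of the multipliers, and
    [residual] is affine in them with linear part [T]. *)
Definition mult_grad x u : X :=
  adjoint ('d F x) u.1 + \sum_(i < m) u.2 0 i *: grad (g i) x.

Definition mult_op x u : H * 'rV[R]_m :=
  ('d F x (mult_grad x u),
   \row_i ('d (g i) x (mult_grad x u) + g i x ^+ 2 * u.2 0 i)).

Definition gradL z : X := grad_lagr f F g z.1.1 z.1.2 z.2.

Definition residual z : H * 'rV[R]_m :=
  ('d F (z.1.1) (gradL z),
   \row_i ('d (g i) (z.1.1) (gradL z) + g i z.1.1 ^+ 2 * z.2 0 i)).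

(** The second derivative in [x] of the Lagrangian, applied to [h] and represented as a vector. *)
Definition hessL z (h : X) : X :=
  rieszv (diff2 f z.1.1 h) + adjoint (diff2 F z.1.1 h) z.1.2
  + \sum_(i < m) z.2 0 i *: rieszv (diff2 (g i) z.1.1 h).

Let linF x : linear ('d F x) := frechet_linear (diff_frechet (dF x)).
Let bndF x : exists C, opnorm_le ('d F x) C.
Proof. by have [] := diff_frechet (dF x). Qed.

Lemma dotp_mult_grad x u h : dotp (mult_grad x u) h =
  dotp u.1 ('d F x h) + \sum_(i < m) u.2 0 i * 'd (g i) x h.
Proof.
rewrite dotpDl dotp_adjoint//; congr (_ + _).
have dotp_sum (v : 'I_m -> X) : dotp (\sum_i v i) h = \sum_i dotp (v i) h.
  by elim/big_rec2 : _ => [|i a b _ <-]; rewrite ?(ip0l (hilbertian_dotp X)) ?dotpDl.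
by rewrite dotp_sum; apply: eq_bigr => i _; rewrite dotpZl dotp_grad.
Qed.

Lemma linear_mult_grad x : linear (mult_grad x).
Proof.
move=> a u v; apply: dotp_inj => h; rewrite [RHS]dotpDl dotpZl !dotp_mult_grad.
rewrite /= dotpDl dotpZl mulrDr addrACA; congr (_ + _).
rewrite mulr_sumr -big_split; apply: eq_bigr => i _ /=.
by rewrite !mxE; ring.
Qed.

Lemma linear_mult_op x : linear (mult_op x).
Proof.
move=> a u v; rewrite /mult_op linear_mult_grad; congr (_, _).
  exact: linearP.
by apply/rowP => i; rewrite !mxE linearP/= /GRing.scale/=; ring.
Qed.

(** [<T u, v>] equals [<S u, S v>] plus a diagonal form with coefficients [g_i^2], visibly symmetric
    in [u] and [v]. *)
Lemma mult_op_sym x u v : mult_dot (mult_op x u) v = mult_dot u (mult_op x v).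
Proof.
have E u' v' : mult_dot (mult_op x u') v' =
   dotp (mult_grad x u') (mult_grad x v') + \sum_i g i x ^+ 2 * u'.2 0 i * v'.2 0 i.
  rewrite [dotp (mult_grad x u') _]dotpC dotp_mult_grad /mult_dot /= dotpC -addrA.
  congr (_ + _); rewrite -big_split; apply: eq_bigr => i _ /=.
  by rewrite mxE; ring.
rewrite [RHS](ipC hilbertian_mult_dot) !E dotpC; congr (_ + _).
by apply: eq_bigr => i _; ring.
Qed.

(** Turns the coercivity hypothesis on [Q] into a lower bound for [|T u|]. *)
Lemma QformE x u : Qform F g x u.1 u.2 =
  2^-1 * mult_dot (mult_op x u) (mult_op x u).
Proof.
rewrite /Qform /mult_dot mulrDr /= dotp_norm; congr (_ * _ + _ * _).
rewrite /enorm sqr_sqrtr; last exact: (ip_ge0 (hilbertian_edot m)).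
apply: eq_bigr => i _; rewrite mul_mx_diag !mxE.
by rewrite dotp_grad// mulrC (mulrC (u.2 0 i)).
Qed.

Lemma lagr_frechet x (l : H) (mu : 'rV[R]_m) :
  frechet (fun y => lagr f F g y l mu) x
   (fun h => 'd f x h + dotp l ('d F x h) + \sum_i mu 0 i * 'd (g i) x h).
Proof.
have fF := frechet_ip (hilbertian_dotp H) (frechet_cst l x) (diff_frechet (dF x)).
have fG := frechet_sum (fun i => frechet_mul (frechet_cst (mu 0 i) x) (diff_frechet (dg i x))).
have := frechetD (frechetD (diff_frechet (df x)) fF) fG.
have -> : (fun y => f y + dotp l (F y) + \sum_i mu 0 i * g i y) =
  (fun y => lagr f F g y l mu).
  apply/funext => y; congr (_ + _); apply: eq_bigr => i _; by rewrite mxE.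
move=> /frechet_eq; apply => h.
rewrite (ip0l (hilbertian_dotp H)) add0r; congr (_ + _).
by apply: eq_bigr => i _; rewrite mul0r add0r.
Qed.

Lemma gradLE z : gradL z = grad f z.1.1 + mult_grad z.1.1 (z.1.2, z.2).
Proof.
apply: (frechet_grad (lagr_frechet _ _ _)) => h.
by rewrite dotpDl dotp_mult_grad dotp_grad// addrA.
Qed.

Lemma kkt_penaltyE z : kkt_penalty f F g z.1.1 z.1.2 z.2 =
  2^-1 * mult_dot (residual z) (residual z).
Proof.
rewrite /kkt_penalty /mult_dot mulrDr /= dotp_norm; congr (_ + _ * _).
by apply: eq_bigr => i _; rewrite mxE dotp_grad// -expr2.
Qed.

Section SecondOrder.
Variable z0 : X * H * 'rV[R]_m.
Hypothesis f2 : twice_differentiable f z0.1.1.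
Hypothesis F2 : twice_differentiable F z0.1.1.
Hypothesis g2 : forall i, twice_differentiable (g i) z0.1.1.

Lemma linear_fst11 : linear (fun z : X * H * 'rV[R]_m => z.1.1).
Proof. by []. Qed.

Lemma opnorm_fst11 : exists C, opnorm_le (fun z : X * H * 'rV[R]_m => z.1.1) C.
Proof.
by exists 1 => z; rewrite mul1r (le_trans (norm_fst_le _))// norm_fst_le.
Qed.

Lemma opnorm_snd11 : exists C, opnorm_le (fun z : X * H * 'rV[R]_m => z.1.2) C.
Proof.
by exists 1 => z; rewrite mul1r (le_trans (norm_snd_le _))// norm_fst_le.
Qed.

Lemma frechet_lam z : frechet (fun z : X * H * 'rV[R]_m => z.1.2) z (fun w => w.1.2).
Proof. by apply: frechet_lin => //; exact: opnorm_snd11. Qed.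

Lemma frechet_mu i z :
  frechet (fun z : X * H * 'rV[R]_m => z.2 0 i) z (fun w => w.2 0 i).
Proof.
apply: frechet_lin => [a u v|]; first by rewrite /= !mxE.
exists 1 => u; rewrite mul1r; exact: le_trans (norm_coord_le _ _) (norm_snd_le _).
Qed.

Lemma frechet_x (V : normedModType R) (G : X -> V) A z : frechet G z.1.1 A ->
  frechet (fun z : X * H * 'rV[R]_m => G z.1.1) z (fun w => A w.1.1).
Proof. exact: (frechet_pre linear_fst11 opnorm_fst11). Qed.

Lemma opfrechet_x (U V : normedModType R) (A : X -> U -> V) B z :
  opfrechet A z.1.1 B ->
  opfrechet (fun z : X * H * 'rV[R]_m => A z.1.1) z (fun w => B w.1.1).
Proof.
move=> AB; apply: (opfrechet_comp (p := fun z : X * H * 'rV[R]_m => z.1.1)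
  AB linear_fst11 opnorm_fst11).
by move=> y /=; rewrite addrC subrK.
Qed.

Lemma frechet_gradL : frechet gradL z0
  (fun w => hessL z0 w.1.1 + mult_grad z0.1.1 (w.1.2, w.2)).
Proof.
have lb (V : normedModType R) (G : X -> V) : (forall x, differentiable G x) ->
    (forall x, linear ('d G x)) /\ (forall x, exists C, opnorm_le ('d G x) C).
  by move=> dG; split => x; have [] := diff_frechet (dG x).
have fgrad (k : X -> R) : (forall x, differentiable k x) ->
    twice_differentiable k z0.1.1 ->
    frechet (fun z : X * H * 'rV[R]_m => grad k z.1.1) z0 (fun w => rieszv (diff2 k z0.1.1 w.1.1)).
  move=> dk /twice_differentiable_diff2/is_diff2_opfrechet kk.
  have [lk bk] := lb _ _ dk.
  have -> : (fun z : X * H * 'rV[R]_m => grad k z.1.1) = (fun z => rieszv ('d k (z.1.1))).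
    by apply/funext => z; rewrite grad_rieszv.
  exact: (frechet_x (opfrechet_rieszv kk lk bk)).
have [lF bF] := lb _ _ dF.
have FF := is_diff2_opfrechet (twice_differentiable_diff2 F2).
have H1 := opfrechet_app (opfrechet_x (opfrechet_adjoint FF lF bF)) (frechet_lam z0).
have H2 := frechet_sum (fun i => frechet_scaler (frechet_mu i z0) (fgrad _ (dg i) (g2 i))).
have := frechetD (frechetD (fgrad _ df f2) H1) H2.
have -> : gradL = (fun z => grad f z.1.1 + adjoint ('d F (z.1.1)) z.1.2 +
   \sum_i z.2 0 i *: grad (g i) z.1.1).
  by apply/funext => z; rewrite gradLE addrA.
move=> /frechet_eq; apply => w; rewrite /hessL /mult_grad /= big_split/=.
by rewrite !addrA; rewrite [LHS](AC 5 (1*2*5*3*4)).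
Qed.

(** The [x]-part of the derivative of [eta]. Every summand carries a component of [residual], so for
    bounded data this term is of the order of the residual. *)
Definition penalty_x (h : X) : R :=
  dotp (residual z0).1 (diff2 F z0.1.1 h (gradL z0) + 'd F (z0.1.1) (hessL z0 h)) +
  \sum_i (residual z0).2 0 i * (diff2 (g i) z0.1.1 h (gradL z0) +
    'd (g i) (z0.1.1) (hessL z0 h) + 2 * g i z0.1.1 * 'd (g i) (z0.1.1) h * z0.2 0 i).

(** Since [residual] is affine in the multipliers with linear part [T], the multiplier part of the
    derivative of [eta] is [<res, T u>]. *)
Lemma frechet_kkt_penalty :
  frechet (fun z => kkt_penalty f F g z.1.1 z.1.2 z.2) z0
   (fun w => penalty_x w.1.1 +
             mult_dot (residual z0) (mult_op z0.1.1 (w.1.2, w.2))).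
Proof.
have opf (V : normedModType R) (G : X -> V) : twice_differentiable G z0.1.1 ->
    frechet (fun z => 'd G (z.1.1) (gradL z)) z0
      (fun w => diff2 G z0.1.1 w.1.1 (gradL z0) +
        'd G (z0.1.1) (hessL z0 w.1.1 + mult_grad z0.1.1 (w.1.2, w.2))).
  move=> /twice_differentiable_diff2/is_diff2_opfrechet GG.
  exact: (opfrechet_app (opfrechet_x GG) frechet_gradL).
have fg i := frechet_x (diff_frechet (dg i z0.1.1)).
have fz i := frechetD (opf _ _ (g2 i))
  (frechet_mul (frechet_mul (fg i) (fg i)) (frechet_mu i z0)).
have H1 := frechet_ip (hilbertian_dotp H) (opf _ _ F2) (opf _ _ F2).
have H2 := frechet_sum (fun i => frechet_mul (fz i) (fz i)).
have := frechet_mul (frechet_cst (2^-1 : R) z0) (frechetD H1 H2).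
have -> : (fun y => 2^-1 * (dotp ('d F (y.1.1) (gradL y)) ('d F (y.1.1) (gradL y)) +
    \sum_i ('d (g i) (y.1.1) (gradL y) + g i y.1.1 * g i y.1.1 * y.2 0 i) *
           ('d (g i) (y.1.1) (gradL y) + g i y.1.1 * g i y.1.1 * y.2 0 i))) =
   (fun z => kkt_penalty f F g z.1.1 z.1.2 z.2).
  apply/funext => z; rewrite kkt_penaltyE /mult_dot /edot /=.
  by congr (_ * (_ + _)); apply: eq_bigr => i _; rewrite mxE -expr2.
move=> /frechet_eq; apply => w.
rewrite mul0r add0r.
rewrite /penalty_x /mult_dot /= [RHS]addrACA [LHS]mulrDr; congr (_ + _).
  rewrite (linear_for_add _ _ (linF z0.1.1)) addrA.
  move: ('d F (z0.1.1) (gradL z0)) (diff2 F _ _ _) ('d F _ _) ('d F _ _) => a b c d.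
  by rewrite [dotp _ a]dotpC !(ipDr (hilbertian_dotp H)); field.
rewrite mulr_sumr -big_split /=; apply: eq_bigr => i _.
by rewrite !mxE linearD/=; field.
Qed.

End SecondOrder.
End LagrangianCalculus.

(** * The derivative of the augmented Lagrangian *)

Section PenaltyCalculus.
Context {R : realType}.
Implicit Types Z : normedModType R.

Lemma max_penalty_active (c mu t p : R) : 0 < c -> 0 < p ->
  (- (c^-1 * p) * mu <= t) = (0 <= mu + c * t / p).
Proof.
move=> c0 p0; rewrite -subr_ge0.
have -> : t - - (c^-1 * p) * mu = (mu + c * t / p) * (p / c).
  by field; rewrite !gt_eqF.
by rewrite pmulr_lge0// divr_gt0.
Qed.

(** The classical form of the inequality terms of an augmented Lagrangian: the maximum enters only
    through a squared positive part, which is differentiable. *)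
Lemma max_penaltyE (c mu t p : R) : 0 < c -> 0 < p ->
  let q := Num.max t (- (c^-1 * p) * mu) in
  mu * q + c / (2 * p) * q ^+ 2 =
  p / (2 * c) * (Num.max (mu + c * t / p) 0 ^+ 2 - mu ^+ 2).
Proof.
move=> c0 p0 q; rewrite /q.
rewrite [in LHS]maxC !maxEle max_penalty_active//.
have [s0|s0] := lerP 0 (mu + c * t / p).
  have [s1|s1] := lerP (mu + c * t / p) 0.
    have s2 : mu + c * t / p = 0 by apply/eqP; rewrite eq_le s0 s1.
    have -> : mu = - (c * t / p) by apply/eqP; rewrite -addr_eq0 s2.
    by field; rewrite !gt_eqF.
  by field; rewrite !gt_eqF.
rewrite ifT ?ltW//.
by field; rewrite !gt_eqF.
Qed.

(** [Num.max (mu + c * t / p) 0] is the updated multiplier, and the second equation is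
    complementarity: it vanishes unless [q = t]. *)
Lemma max_penalty_slope (c mu t p : R) : 0 < c -> 0 < p ->
  let q := Num.max t (- (c^-1 * p) * mu) in
  Num.max (mu + c * t / p) 0 = mu + c * q / p /\
  (mu + c * q / p) * t = (mu + c * q / p) * q.
Proof.
move=> c0 p0 q; rewrite /q.
rewrite [Num.max t _]maxC [in Num.max _ t]maxEle max_penalty_active//.
have [s0|s0] := lerP 0 (mu + c * t / p); first by [].
have -> : mu + c * (- (c^-1 * p) * mu) / p = 0 by field; rewrite !gt_eqF.
by rewrite !mul0r.
Qed.

(** As [q] itself has a kink, the form of [max_penaltyE] is differentiated and [max_penalty_slope]
    rewrites the result in [q]. The outcome is what formal differentiation would give with [dq]
    replaced by [dt]. *)
Lemma frechet_max_penalty Z (mu t p : Z -> R) z dmu dt dp (c : R) :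
  frechet mu z dmu -> frechet t z dt -> frechet p z dp -> 0 < c -> 0 < p z ->
  let q y := Num.max (t y) (- (c^-1 * p y) * mu y) in
  frechet (fun y => mu y * q y + c / (2 * p y) * q y ^+ 2) z
    (fun h => - (c * q z ^+ 2 / (2 * p z ^+ 2)) * dp h
      + (mu z + c * q z / p z) * dt h + q z * dmu h).
Proof.
move=> fmu ft fp c0 p0 q.
have pn0 : p z != 0 by rewrite gt_eqF.
have fs := frechetD fmu (frechet_mul (frechet_mul (frechet_cst c z) ft)
  (frechet_inv fp pn0)).
have H := frechet_mul (frechet_mul fp (frechet_cst ((2 * c)^-1 : R) z))
  (frechetD (frechet_sqr_pos fs)
     (frechet_mul (frechet_cst (-1 : R) z) (frechet_mul fmu fmu))).
have pnear : \forall y \near z, 0 < p y.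
  have /cvgrPdist_lt/(_ _ p0) := frechet_continuous fp.
  by apply: filterS => y; rewrite ltr_distlC subrr => /andP[].
apply: (@frechet_eq _ _ _ _ _
  (fun h => (dp h * (2 * c)^-1 + p z * 0) *
    (Num.max (mu z + c * t z / p z) 0 ^+ 2 + -1 * (mu z * mu z)) +
    p z * (2 * c)^-1 * (2 * Num.max (mu z + c * t z / p z) 0 *
      (dmu h + ((0 * t z + c * dt h) * (p z)^-1 + c * t z * (- dp h / p z ^+ 2)))
      + (0 * (mu z * mu z) + -1 * (dmu h * mu z + mu z * dmu h))))).
  apply: frechet_near_eq H; apply: filterS pnear => y py.
  by rewrite /q max_penaltyE// mulN1r -expr2.
move=> h; have [E1 E2] := max_penalty_slope (mu z) (t z) c0 p0.
rewrite E1 -/(q z); rewrite /= -/(q z) in E2.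
have -> : c * t z * (- dp h / p z ^+ 2) = - (c * dp h / p z ^+ 2) * t z by ring.
move: (q z) E2 => qz E2.
(* [t] is kept only next to the factor [mu + c q / p], where [E2] may turn it into [q]. *)
transitivity (dp h / (2 * c) * ((mu z + c * qz / p z) ^+ 2 - mu z ^+ 2)
  + (mu z + c * qz / p z) * dt h
  + p z / c * (mu z + c * qz / p z - mu z) * dmu h
  - (mu z + c * qz / p z) * t z * dp h / p z).
  by field; rewrite pn0 gt_eqF.
by rewrite E2; field; rewrite pn0 gt_eqF.
Qed.

Lemma edom_near (phi : R -> \bar R) t : phi_admissible phi -> edom phi t ->
  \forall s \near t, 0 <= s -> edom phi s.
Proof.
move=> pA; have [[-> _]|[a [a0 -> _]]] := phi_growth pA; first by move=> _; near=> s.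
move=> /= /andP[t0 ta]; near=> s => /= ->/=.
by near: s; exact: lt_nbhsl.
Unshelve. all: by end_near. Qed.

Lemma is_derive_within_near (D : set R) (h : R -> R) t l :
  is_derive_within D h t l -> forall e, 0 < e ->
  \forall s \near t, D s -> `|h s - h t - l * (s - t)| <= e * `|s - t|.
Proof.
move=> /cvgrPdist_le H e /H.
rewrite !near_withinE; apply: filterS => s H1 Ds.
have [->|st] := eqVneq s t; first by rewrite !subrr mulr0 subr0 normr0 mulr0.
have st0 : s - t != 0 by rewrite subr_eq0.
have -> : h s - h t - l * (s - t) = - ((l - (h s - h t) / (s - t)) * (s - t)) by field.
by rewrite normrN normrM ler_wpM2r// H1.
Qed.

Lemma frechet_sqr_norm Z (H : hilbertType R) (F : Z -> H) x A : frechet F x A ->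
  frechet (fun y => `|F y| ^+ 2) x (fun h => 2 * dotp (F x) (A h)).
Proof.
move=> fF; have := frechet_ip (hilbertian_dotp H) fF fF.
have -> : (fun y => dotp (F y) (F y)) = (fun y => `|F y| ^+ 2).
  by apply/funext => y; rewrite dotp_norm.
by move=> /frechet_eq; apply => h; rewrite dotpC; ring.
Qed.

(** Where [F x = 0] only a one-sided derivative of [phi] is available; [frechet_comp_within] applies
    because [|F y|^2] never leaves the half-line and stays in the domain near [x]. *)
Lemma frechet_phi (X H : hilbertType R) (F : X -> H) (phi : R -> \bar R) dphi x :
  phi_admissible phi -> is_cont_derive_on_dom phi dphi ->
  (forall x, differentiable F x) -> (phi (`|F x| ^+ 2)%R < +oo)%E ->
  frechet (fun y => fine (phi (`|F y| ^+ 2)%R)) x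
    (fun h => dphi (`|F x| ^+ 2) * (2 * dotp (F x) ('d F x h))).
Proof.
move=> pA [dphiP _] dF phix.
have fF := frechet_sqr_norm (diff_frechet (dF x)).
have Dx : edom phi (`|F x| ^+ 2) by split => //; exact: sqr_ge0.
apply: (@frechet_comp_within _ _ _ _ (fun y => `|F y| ^+ 2) (fine \o phi)
  (edom phi) x (fun h => dphi (`|F x| ^+ 2) * h)).
- exact: frechet_calm fF.
- have cF := frechet_continuous fF.
  have H1 : \forall y \near x, 0 <= `|F y| ^+ 2 -> edom phi (`|F y| ^+ 2) :=
    cF _ (edom_near pA Dx).
  by apply: filterS H1 => y; apply; exact: sqr_ge0.
- by move=> e e0; apply: is_derive_within_near => //; exact: dphiP.
- have := frechet_mul (frechet_cst (dphi (`|F x| ^+ 2)) x)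
    (frechetD fF (frechet_cst (- `|F x| ^+ 2) x)).
  by move=> /frechet_eq; apply => h; rewrite mul0r add0r addr0.
- by rewrite mulr0.
Qed.

Lemma enorm_ge0 m (u : 'rV[R]_m) : 0 <= enorm u.
Proof. exact: sqrtr_ge0. Qed.

Lemma enorm_sqr m (u : 'rV[R]_m) : enorm u ^+ 2 = edot u u.
Proof. by rewrite sqr_sqrtr// (ip_ge0 (hilbertian_edot m)). Qed.

Lemma norm_le_enorm m (u : 'rV[R]_m) : `|u| <= enorm u.
Proof.
rewrite -(@ler_pXn2r _ 2) ?nnegrE ?enorm_ge0// enorm_sqr -[`|u|]/(mx_norm u).
have [->|/mx_norm_neq0[[j i] ->]] := eqVneq (mx_norm u) 0.
  by rewrite expr0n/= (ip_ge0 (hilbertian_edot m)).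
rewrite /= (ord1 j) /edot (bigD1 i)//= real_normK ?num_real// -expr2 lerDl.
by rewrite sumr_ge0// => k _; rewrite -expr2 sqr_ge0.
Qed.

Lemma enorm_le_norm m : exists2 K : R, 0 < K & forall u : 'rV[R]_m, enorm u <= K * `|u|.
Proof.
have [K K0 KV] := ip_bounded (hilbertian_edot (R := R) m).
exists (Num.sqrt K) => [|u]; first by rewrite sqrtr_gt0.
rewrite -(@ler_pXn2r _ 2) ?nnegrE ?enorm_ge0// ?mulr_ge0 ?sqrtr_ge0//.
rewrite enorm_sqr exprMn sqr_sqrtr ?(ltW K0)//.
by rewrite (le_trans (ler_norm _))// (le_trans (KV _ _))// -mulrA expr2.
Qed.

Lemma rV_norm_le m (u : 'rV[R]_m) C : 0 <= C -> (forall i, `|u 0 i| <= C) -> `|u| <= C.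
Proof.
move=> C0 uC; rewrite -[`|u|]/(mx_norm u).
have [->//|/mx_norm_neq0[[j i] ->]] := eqVneq (mx_norm u) 0.
by rewrite /= (ord1 j).
Qed.

Lemma orthant_vmax0 m (u : 'rV[R]_m) : orthant (vmax u 0).
Proof. by move=> i; rewrite !mxE le_max lexx orbT. Qed.

(** The positive part of [g i] has a kink, but where [g i x <= 0] the corresponding partial
    derivative of [psi] vanishes, and where [g i x > 0] the positive part agrees with [g i] near
    [x]. Hence the pairing of [dpsi] with the increment of the positive part is differentiable, as
    [frechet_comp_within] asks. *)
Lemma frechet_bfun (X : hilbertType R) m (g : 'I_m -> X -> R) (psi : 'rV[R]_m -> R)
    dpsi x :
  is_cont_gradient_on_orthant psi dpsi ->
  (forall y i, orthant y -> y 0 i = 0 -> dpsi y 0 i = 0) ->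
  (forall i x, differentiable (g i) x) ->
  frechet (bfun g psi) x
    (fun h => \sum_i dpsi (vmax (gvec g x) 0) 0 i * 'd (g i) x h).
Proof.
move=> [psiP _] dpsi0 dg.
pose gp y := vmax (gvec g y) 0; have gpE y i : gp y 0 i = Num.max (g i y) 0.
  by rewrite !mxE.
have fg i := diff_frechet (dg i x).
apply: (@frechet_comp_within _ _ _ _ gp psi orthant x (edot (dpsi (gp x)))).
- have /choice[C CP] i : exists C : R, 0 < C /\ \forall y \near x, `|g i y - g i x| <= C * `|y - x|.
    by have [C C0 CP] := frechet_calm (fg i); exists C.
  exists (\sum_i C i + 1).
    by rewrite ltr_wpDl// sumr_ge0// => i _; have [/ltW] := CP i.
  have : \forall y \near x, forall i, `|g i y - g i x| <= C i * `|y - x|.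
    by apply: filter_forall => i; have [] := CP i.
  apply: filterS => y H; apply: rV_norm_le.
    by rewrite mulr_ge0// addr_ge0// sumr_ge0// => i _; have [/ltW] := CP i.
  move=> i; have -> : (gp y - gp x) 0 i = Num.max (g i y) 0 - Num.max (g i x) 0.
    by rewrite -!gpE !mxE.
  apply: (@le_trans _ _ `|g i y - g i x|).
    move: (g i y) (g i x) => a b.
    rewrite ler_norml !maxEle; apply/andP.
    have := ler_norm (a - b); have := ler_norm (b - a); rewrite distrC => ? ?.
    have := normr_ge0 (a - b) => ?.
    by case: (lerP a 0) => ?; case: (lerP b 0) => ?; split; lra.
  apply: le_trans (H i) _; rewrite ler_wpM2r// (bigD1 i)//= -addrA lerDl.
  by rewrite addr_ge0// sumr_ge0// => j _; have [/ltW] := CP j.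
- by near=> y; exact: orthant_vmax0.
- move=> e e0; have [K K0 KP] := enorm_le_norm m.
  have eK : 0 < e / K by rewrite divr_gt0.
  apply: filterS (psiP _ _ (orthant_vmax0 _) eK) => v H ov.
  apply: le_trans (H ov) _.
  by rewrite mulrAC ler_pdivrMr// -mulrA ler_wpM2l ?(ltW e0)// mulrC.
- have H i : frechet (fun y => dpsi (gp x) 0 i * (gp y - gp x) 0 i) x
      (fun h => dpsi (gp x) 0 i * 'd (g i) x h).
    have [g0|g0] := lerP (g i x) 0.
      have -> : dpsi (gp x) 0 i = 0.
        by apply: dpsi0; [exact: orthant_vmax0|rewrite gpE max_r].
      by apply: frechet_near_eq (frechet_eq (frechet_cst (0 : R) x) _) => [|h];
        [near=> y|]; rewrite mul0r.
    have H := frechetD (fg i) (frechet_cst (- g i x) x).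
    have := frechet_mul (frechet_cst (dpsi (gp x) 0 i) x) H.
    move=> /frechet_eq E; apply: (frechet_near_eq _ (E _ _)); last first.
      by move=> h; rewrite mul0r add0r addr0.
    have /cvgrPdist_lt/(_ _ g0) := frechet_continuous (fg i).
    apply: filterS => y; rewrite ltr_distlC subrr => /andP[gy _].
    have -> : (gp y - gp x) 0 i = gp y 0 i - gp x 0 i by rewrite !mxE.
    by rewrite !gpE !max_l ?ltW.
  exact: frechet_sum H.
- exact: (ip0r (hilbertian_edot m)).
Unshelve. all: by end_near. Qed.

End PenaltyCalculus.

Section AugmentedLagrangianCalculus.
Context {R : realType} {X H : hilbertType R} {m : nat}.
Variables (f : X -> R) (F : X -> H) (g : 'I_m -> X -> R).
Variables (phi : R -> \bar R) (psi : 'rV[R]_m -> R).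
Variables (dphi : R -> R) (dpsi : 'rV[R]_m -> 'rV[R]_m).
Hypothesis df : forall x, differentiable f x.
Hypothesis dF : forall x, differentiable F x.
Hypothesis dg : forall i x, differentiable (g i) x.
Hypothesis phi_adm : phi_admissible phi.
Hypothesis dphiP : is_cont_derive_on_dom phi dphi.
Hypothesis dpsiP : is_cont_gradient_on_orthant psi dpsi.
Hypothesis dpsi0 : forall y i, orthant y -> y 0 i = 0 -> dpsi y 0 i = 0.
Implicit Types (x : X) (z w : X * H * 'rV[R]_m) (u v : H * 'rV[R]_m).

Notation b := (bfun g psi).
Notation p := (pfun g psi).
Notation Omega := (Omega F g phi psi).
Notation auglagr := (auglagr f F g phi psi).
Notation gradL := (gradL f F g).
Notation residual := (residual f F g).

Definition qvec c z : 'rV[R]_m :=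
  vmax (gvec g z.1.1) (- (c^-1 * p z.1.1 z.2) *: z.2).

Definition phiF x : R := fine (phi (`|F x| ^+ 2)%R).

Lemma auglagr_fineE c z : Omega z.1.1 -> fine (auglagr c z) =
  f z.1.1 + dotp z.1.2 (F z.1.1) + c / 2 * (1 + `|z.1.2| ^+ 2) * phiF z.1.1
  + edot z.2 (qvec c z) + c / (2 * p z.1.1 z.2) * enorm (qvec c z) ^+ 2
  + kkt_penalty f F g z.1.1 z.1.2 z.2.
Proof. by case: z => [[x l] mu] /= Ox; rewrite asboolT. Qed.

Lemma auglagrE c z : Omega z.1.1 -> auglagr c z = (fine (auglagr c z))%:E.
Proof. by case: z => [[x l] mu] /= Ox; rewrite asboolT. Qed.

Lemma auglagr_notin c z : ~ Omega z.1.1 -> auglagr c z = +oo%E.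
Proof. by case: z => [[x l] mu] /= Ox; rewrite asboolF. Qed.

Lemma pfun_gt0 x mu : 0 < b x -> 0 < p x mu.
Proof. by move=> b0; rewrite /pfun divr_gt0// ltr_wpDr// sqr_ge0. Qed.

Lemma Omega_near x : Omega x -> \forall y \near x, Omega y.
Proof.
move=> [b0 phix].
have fb := frechet_bfun x dpsiP dpsi0 dg.
have H1 : \forall y \near x, 0 < b y.
  have /cvgrPdist_lt/(_ _ b0) := frechet_continuous fb.
  by apply: filterS => y; rewrite ltr_distlC subrr => /andP[].
have cF := frechet_continuous (frechet_sqr_norm (diff_frechet (dF x))).
have H2 : \forall y \near x, 0 <= `|F y| ^+ 2 -> edom phi (`|F y| ^+ 2) :=
  cF _ (edom_near phi_adm (conj (sqr_ge0 _) phix)).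
by apply: filterS2 H1 H2 => y b1 /(_ (sqr_ge0 _))[].
Qed.

Lemma near_fst11 (P : X -> Prop) z : (\forall y \near z.1.1, P y) ->
  \forall y \near z, P y.1.1.
Proof.
have fx : frechet (fun z : X * H * 'rV[R]_m => z.1.1) z (fun w => w.1.1).
  by apply: frechet_lin; [exact: linear_fst11|exact: opnorm_fst11].
have cx := frechet_continuous fx.
by move=> zP; exact: (cx P zP).
Qed.

(** The vector [v] of the overview: what the penalty terms add to the multipliers in the derivative
    in [x]. *)
Definition penalty_weight c z : H * 'rV[R]_m :=
  ((c * (1 + `|z.1.2| ^+ 2) * dphi (`|F z.1.1| ^+ 2)) *: F z.1.1,
   (c / p z.1.1 z.2) *: qvec c z).

(** Minus the derivative of [c / (2 p) |q|^2] with respect to the value [b] inside [p], with [q]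
    held fixed. *)
Definition barrier_weight c z : R :=
  c * (1 + edot z.2 z.2) / (2 * b z.1.1 ^+ 2) * edot (qvec c z) (qvec c z).

Definition dL_x c z (h : X) : R :=
  dotp (gradL z + mult_grad F g z.1.1 (penalty_weight c z)) h
  - barrier_weight c z *
    \sum_i dpsi (vmax (gvec g z.1.1) 0) 0 i * 'd (g i) (z.1.1) h
  + penalty_x f F g z h.

(** The gradient in the multipliers of all terms but [eta]; the second summands come from the factor
    [1 + |lambda|^2] and from the dependence of [p] on [mu]. *)
Definition mult_rhs c z : H * 'rV[R]_m :=
  (F z.1.1 + (c * phiF z.1.1) *: z.1.2,
   qvec c z + (c / b z.1.1 * edot (qvec c z) (qvec c z)) *: z.2).

Definition dL_u c z u : R :=
  mult_dot (mult_rhs c z) u + mult_dot (residual z) (mult_op F g z.1.1 u).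

Lemma dotp_gradL z h : dotp (gradL z) h =
  'd f (z.1.1) h + dotp z.1.2 ('d F (z.1.1) h) + \sum_i z.2 0 i * 'd (g i) (z.1.1) h.
Proof. by rewrite gradLE// dotpDl dotp_grad// dotp_mult_grad// addrA. Qed.

Lemma auglagr_frechet c z : 0 < c -> Omega z.1.1 ->
  twice_differentiable f z.1.1 -> twice_differentiable F z.1.1 ->
  (forall i, twice_differentiable (g i) z.1.1) ->
  frechet (fine \o auglagr c) z (fun w => dL_x c z w.1.1 + dL_u c z (w.1.2, w.2)).
Proof.
move=> c0 Oz f2 F2 g2; have [b0 phiz] := Oz.
have p0 := pfun_gt0 z.2 b0.
have fb := frechet_x (H := H) (m := m) (frechet_bfun z.1.1 dpsiP dpsi0 dg).
have fmu i := frechet_mu (X := X) (H := H) i z.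
have fmm := frechetD (frechet_cst (1 : R) z)
  (frechet_sum (fun i => frechet_mul (fmu i) (fmu i))).
have mm0 (mu : 'rV[R]_m) : 0 < 1 + edot mu mu.
  by rewrite ltr_wpDr// (ip_ge0 (hilbertian_edot m)).
have fp : frechet (fun y : X * H * 'rV[R]_m => p y.1.1 y.2) z (fun w =>
   (\sum_i dpsi (vmax (gvec g z.1.1) 0) 0 i * 'd (g i) (z.1.1) w.1.1)
     / (1 + edot z.2 z.2)
   - b z.1.1 * (2 * edot z.2 w.2) / (1 + edot z.2 z.2) ^+ 2).
  have := frechet_mul fb (frechet_inv fmm (lt0r_neq0 (mm0 _))).
  have -> : (fun y : X * H * 'rV[R]_m =>
    b y.1.1 * (1 + \sum_i y.2 0 i * y.2 0 i)^-1) = (fun y => p y.1.1 y.2).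
    by apply/funext => y; rewrite /pfun enorm_sqr.
  move=> /frechet_eq; apply => w; congr (_ + _).
  have -> : \sum_i (w.2 0 i * z.2 0 i + z.2 0 i * w.2 0 i) = 2 * edot z.2 w.2.
    by rewrite mulr_sumr; apply: eq_bigr => i _; ring.
  by rewrite -/(edot z.2 z.2); field; rewrite gt_eqF.
have fg i := frechet_x (H := H) (m := m) (diff_frechet (dg i z.1.1)).
have fG := frechet_sum (fun i => frechet_max_penalty (fmu i) (fg i) fp c0 p0).
have flam := frechet_lam z.
have fFx := frechet_x (H := H) (m := m) (diff_frechet (dF z.1.1)).
have fl := frechetD (frechet_cst (1 : R) z) (frechet_ip (hilbertian_dotp H) flam flam).
have fphi := frechet_x (H := H) (m := m) (frechet_phi phi_adm dphiP dF phiz).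
have f3 := frechet_mul (frechet_mul (frechet_cst (c / 2 : R) z) fl) fphi.
have ff := frechet_x (H := H) (m := m) (diff_frechet (df z.1.1)).
have f12 := frechetD ff (frechet_ip (hilbertian_dotp H) flam fFx).
have fK := frechet_kkt_penalty df dF dg f2 F2 g2.
have fL := frechetD (frechetD (frechetD f12 f3) fG) fK.
apply: frechet_eq (frechet_near_eq _ fL) _ => [|w].
  (* Off [Omega] the value is [+oo] and its [fine] a default, so the smooth formula is matched only
     near [z], [Omega] being open. *)
  apply: filterS (near_fst11 (Omega_near Oz)) => y Oy.
  rewrite [RHS]/= auglagr_fineE// -/(phiF _) dotp_norm; congr (_ + _).
  rewrite -[RHS]addrA; congr (_ + _); rewrite enorm_sqr mulr_sumr -big_split.
  by apply: eq_bigr => i _ /=; rewrite !mxE expr2.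
rewrite /dL_x /dL_u (dotpDl _ _ w.1.1) dotp_gradL dotp_mult_grad//.
have -> : \sum_i (penalty_weight c z).2 0 i * 'd (g i) (z.1.1) w.1.1 =
   c / p z.1.1 z.2 * \sum_i qvec c z 0 i * 'd (g i) (z.1.1) w.1.1.
  by rewrite mulr_sumr; apply: eq_bigr => i _; rewrite !mxE; ring.
rewrite /mult_dot /penalty_weight /mult_rhs /=.
rewrite !(ipDl (hilbertian_edot m)) !(ipZl (hilbertian_edot m)) !dotpDl !dotpZl.
set dw := (_ / (1 + edot z.2 z.2) - _).
have -> : \sum_i (- (c * Num.max (g i z.1.1) (- (c^-1 * p z.1.1 z.2) * z.2 0 i) ^+ 2 /
       (2 * p z.1.1 z.2 ^+ 2)) * dw +
     (z.2 0 i + c * Num.max (g i z.1.1) (- (c^-1 * p z.1.1 z.2) * z.2 0 i) /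
       p z.1.1 z.2) * 'd (g i) (z.1.1) w.1.1 +
     Num.max (g i z.1.1) (- (c^-1 * p z.1.1 z.2) * z.2 0 i) * w.2 0 i) =
  - (c * edot (qvec c z) (qvec c z) / (2 * p z.1.1 z.2 ^+ 2)) * dw +
  (\sum_i z.2 0 i * 'd (g i) (z.1.1) w.1.1 +
   c / p z.1.1 z.2 * \sum_i qvec c z 0 i * 'd (g i) (z.1.1) w.1.1) +
  edot (qvec c z) w.2.
  rewrite /edot [c * _]mulr_sumr mulr_suml -sumrN mulr_suml mulr_sumr -!big_split.
  apply: eq_bigr => i _ /=.
  have -> : qvec c z 0 i = Num.max (g i z.1.1) (- (c^-1 * p z.1.1 z.2) * z.2 0 i).
    by rewrite !mxE.
  by ring.
rewrite /dw /barrier_weight -(dotp_norm z.1.2) /phiF /pfun enorm_sqr.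
rewrite (dotpC w.1.2 (F _)) (dotpC w.1.2 z.1.2).
have := mm0 z.2; move: (edot z.2 z.2) => M M0.
by field; rewrite !gt_eqF.
Qed.

End AugmentedLagrangianCalculus.

(** * KKT points *)

Section InnerProductNorm.
Context {R : realType} {V : normedModType R} {ip : V -> V -> R} (hip : hilbertian ip).
Implicit Types u v : V.

Definition ipnorm (ip : V -> V -> R) u : R := Num.sqrt (ip u u).

Lemma ipnorm_ge0 u : 0 <= ipnorm ip u. Proof. exact: sqrtr_ge0. Qed.

Lemma ipnorm_sqr u : ipnorm ip u ^+ 2 = ip u u.
Proof. by rewrite sqr_sqrtr// (ip_ge0 hip). Qed.

Lemma ip_le_ipnorm u v : `|ip u v| <= ipnorm ip u * ipnorm ip v.
Proof.
rewrite -(@ler_pXn2r _ 2) ?nnegrE ?mulr_ge0 ?ipnorm_ge0//.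
by rewrite real_normK ?num_real// exprMn !ipnorm_sqr (ip_cauchy_schwarz hip).
Qed.

Lemma ipnormD u v : ipnorm ip (u + v) <= ipnorm ip u + ipnorm ip v.
Proof.
rewrite -(@ler_pXn2r _ 2) ?nnegrE ?addr_ge0 ?ipnorm_ge0//.
rewrite ipnorm_sqr sqrrD !ipnorm_sqr !(ipE hip) (ipC hip v u).
have := le_trans (ler_norm _) (ip_le_ipnorm u v); lra.
Qed.

Lemma ipnormN u : ipnorm ip (- u) = ipnorm ip u.
Proof. by rewrite /ipnorm !(ipE hip) opprK. Qed.

Lemma ipnorm_eq0 u : ipnorm ip u = 0 -> u = 0.
Proof. by move=> u0; apply: (ip_eq0 hip); rewrite -ipnorm_sqr u0 expr0n. Qed.

End InnerProductNorm.

Section KktPoints.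
Context {R : realType} {X H : hilbertType R} {m : nat}.
Variables (f : X -> R) (F : X -> H) (g : 'I_m -> X -> R).
Variables (phi : R -> \bar R) (psi : 'rV[R]_m -> R).
Variables (dphi : R -> R) (dpsi : 'rV[R]_m -> 'rV[R]_m).
Hypothesis df : forall x, differentiable f x.
Hypothesis dF : forall x, differentiable F x.
Hypothesis dg : forall i x, differentiable (g i) x.
Hypothesis phi_adm : phi_admissible phi.
Hypothesis psi_adm : psi_admissible psi.
Implicit Types (x : X) (z w : X * H * 'rV[R]_m) (u v : H * 'rV[R]_m).

Notation Omega := (Omega F g phi psi).
Notation auglagr := (auglagr f F g phi psi).
Notation kkt := (kkt f F g).

(** A vanishing maximum of [g_i] and [- mu_i] leaves two cases: [mu_i = 0] with [g_i <= 0], or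
    [g_i = 0] with [mu_i > 0]. *)
Lemma kkt_slackness z : kkt z.1.1 z.1.2 z.2 ->
  forall i, [/\ g i z.1.1 <= 0, 0 <= z.2 0 i & g i z.1.1 * z.2 0 i = 0].
Proof.
move=> [_ _ /rowP H0] i; have := H0 i; rewrite !mxE.
move: (g i z.1.1) (z.2 0 i) => a b; rewrite maxEle; case: leP => ab E.
  by have -> : b = 0 by [apply/eqP; rewrite -oppr_eq0 E]; split; [lra| |ring].
by rewrite E mul0r; split => //; lra.
Qed.

Lemma feasible_gplus x : feasible F g x -> vmax (gvec g x) 0 = 0.
Proof. by move=> [_ gx]; apply/rowP => i; rewrite !mxE max_r. Qed.

Lemma feasible_Omega x : feasible F g x -> Omega x.
Proof.
move=> fx; split; first by rewrite /bfun feasible_gplus// psi0_gt0.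
have [-> _] := fx; rewrite normr0 expr0n/=.
by have [_ ->] := phi_eq0 phi_adm (lexx 0).
Qed.

Lemma feasible_phiF x : F x = 0 -> phiF F phi x = 0.
Proof.
move=> Fx; rewrite /phiF Fx normr0 expr0n/=.
by have [_ ->] := phi_eq0 phi_adm (lexx 0).
Qed.

Lemma kkt_feasible z : kkt z.1.1 z.1.2 z.2 -> feasible F g z.1.1.
Proof.
by move=> kz; split; [case: kz|move=> i; case: (kkt_slackness kz i)].
Qed.

Lemma kkt_Omega z : kkt z.1.1 z.1.2 z.2 -> Omega z.1.1.
Proof. by move=> /kkt_feasible/feasible_Omega. Qed.

Lemma kkt_qvec c z : 0 < c -> kkt z.1.1 z.1.2 z.2 -> qvec g psi c z = 0.
Proof.
move=> c0 kz; apply/rowP => i; rewrite !mxE.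
have [b0 _] := kkt_Omega kz; have p0 := pfun_gt0 z.2 b0.
have [g0 m0 gm] := kkt_slackness kz i.
have cp : 0 < c^-1 * pfun g psi z.1.1 z.2 by rewrite mulr_gt0// invr_gt0.
move/eqP: gm; rewrite mulf_eq0 => /orP[]/eqP ->; last by rewrite mulr0 max_r.
by rewrite max_l// mulNr oppr_le0 mulr_ge0// ltW.
Qed.

Lemma kkt_residual z : kkt z.1.1 z.1.2 z.2 -> residual f F g z = 0.
Proof.
move=> kz; have [L0 _ _] := kz.
rewrite /residual /gradL L0 !linear0; congr (_, _).
apply/rowP => i; rewrite !mxE linear0 add0r.
by have [_ _ gm] := kkt_slackness kz i; rewrite expr2 -mulrA gm mulr0.
Qed.

Lemma kkt_value c z : 0 < c -> kkt z.1.1 z.1.2 z.2 -> auglagr c z = (f z.1.1)%:E.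
Proof.
move=> c0 kz; rewrite auglagrE; last exact: kkt_Omega.
rewrite auglagr_fineE; last exact: kkt_Omega.
have [_ F0 _] := kz.
rewrite kkt_qvec// kkt_penaltyE// kkt_residual// F0 feasible_phiF//.
rewrite (ip0r (hilbertian_mult_dot (H := H) (m := m))) (ip0r (hilbertian_edot m)).
by rewrite (ip0r (hilbertian_dotp H)) enorm_sqr (ip0r (hilbertian_edot m)) !mulr0 !addr0.
Qed.

Lemma kkt_dL_x c z h : 0 < c -> kkt z.1.1 z.1.2 z.2 ->
  dL_x f F g psi dphi dpsi c z h = 0.
Proof.
move=> c0 kz; have [L0 F0 _] := kz.
rewrite /dL_x /barrier_weight /penalty_x /gradL L0 kkt_residual//.
rewrite kkt_qvec// (ip0r (hilbertian_edot m)) mulr0 mul0r subr0.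
have -> : penalty_weight F g psi dphi c z = 0.
  by rewrite /penalty_weight F0 kkt_qvec// !scaler0.
rewrite (linear_for0 (linear_mult_grad dF dg _)) addr0 (ip0l (hilbertian_dotp X)).
rewrite (ip0l (hilbertian_dotp H)) !add0r big1// => i _.
by rewrite mxE mul0r.
Qed.

Lemma kkt_dL_u c z u : 0 < c -> kkt z.1.1 z.1.2 z.2 ->
  dL_u f F g phi psi c z u = 0.
Proof.
move=> c0 kz; have [_ F0 _] := kz; have hM := hilbertian_mult_dot (H := H) (m := m).
rewrite /dL_u kkt_residual// (ip0l hM) addr0.
have -> : mult_rhs F g phi psi c z = 0.
  rewrite /mult_rhs F0 feasible_phiF// kkt_qvec// (ip0r (hilbertian_edot m)).
  by rewrite !mulr0 !scale0r !addr0.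
exact: (ip0l hM).
Qed.

(** Once [F], [q] and the residual vanish, every term of [dL_x] but [gradL] drops out; and as
    [c^-1 * p > 0], the equation [q = 0] carries the same sign conditions as the vanishing of the
    maximum of [g] and [- mu]. *)
Lemma kkt_of_stationary c z : 0 < c -> Omega z.1.1 ->
  F z.1.1 = 0 -> qvec g psi c z = 0 -> residual f F g z = 0 ->
  (forall h, dL_x f F g psi dphi dpsi c z h = 0) -> kkt z.1.1 z.1.2 z.2.
Proof.
move=> c0 [b0 _] F0 q0 r0 dx; split => //.
  apply: dotp_inj => h; rewrite (ip0l (hilbertian_dotp X)) -(dx h).
  rewrite /dL_x /barrier_weight /penalty_x q0 r0 (ip0r (hilbertian_edot m)) mulr0 mul0r subr0.
  have -> : penalty_weight F g psi dphi c z = 0.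
    by rewrite /penalty_weight F0 q0 !scaler0.
  rewrite (linear_for0 (linear_mult_grad dF dg _)) addr0.
  rewrite (ip0l (hilbertian_dotp H)) add0r big1 ?addr0// => i _.
  by rewrite mxE mul0r.
apply/rowP => i; have /rowP/(_ i) := q0; rewrite !mxE.
have p0 := pfun_gt0 z.2 b0.
have cp : 0 < c^-1 * pfun g psi z.1.1 z.2 by rewrite mulr_gt0// invr_gt0.
move: cp (g i z.1.1) (z.2 0 i) => + a b; move: (_ * _) => k k0.
rewrite !maxEle mulNr; case: leP => h1 E.
  have b00 : b = 0.
    by apply/eqP; move/eqP: E; rewrite oppr_eq0 mulf_eq0 gt_eqF.
  by rewrite b00 oppr0; rewrite b00 mulr0 oppr0 in h1; rewrite ifT.
rewrite E in h1 *; rewrite ltrNl oppr0 in h1; case: ifP => //.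
rewrite (pmulr_rgt0 _ k0) in h1; lra.
Qed.

End KktPoints.

(** * Stationary points with a large penalty parameter *)

Section MultiplierNorm.
Context {R : realType} {H : hilbertType R} {m : nat}.
Implicit Types u v : H * 'rV[R]_m.
Let hM := hilbertian_mult_dot (H := H) (m := m).

Definition mult_norm u : R := ipnorm (@mult_dot R H m) u.

Lemma mult_norm_ge0 u : 0 <= mult_norm u. Proof. exact: sqrtr_ge0. Qed.

Lemma mult_norm_sqr u : mult_norm u ^+ 2 = `|u.1| ^+ 2 + edot u.2 u.2.
Proof. by rewrite (ipnorm_sqr hM) /mult_dot dotp_norm. Qed.

Lemma norm_le_mult_norm u : `|u.1| <= mult_norm u.
Proof.
rewrite -(@ler_pXn2r _ 2) ?nnegrE ?mult_norm_ge0// mult_norm_sqr lerDl.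
exact: ip_ge0 (hilbertian_edot m) _.
Qed.

Lemma coord_le_mult_norm u i : `|u.2 0 i| <= mult_norm u.
Proof.
apply: le_trans (norm_coord_le _ _) _; apply: le_trans (norm_le_enorm _) _.
rewrite -(@ler_pXn2r _ 2) ?nnegrE ?mult_norm_ge0 ?enorm_ge0//.
by rewrite mult_norm_sqr enorm_sqr lerDr sqr_ge0.
Qed.

Lemma edot_le_mult_norm u : edot u.2 u.2 <= mult_norm u ^+ 2.
Proof. by rewrite mult_norm_sqr lerDr sqr_ge0. Qed.

Lemma mult_norm_scale_le a b u K : 0 <= K -> `|a| <= K -> `|b| <= K ->
  mult_norm (a *: u.1, b *: u.2) <= K * mult_norm u.
Proof.
move=> K0 aK bK.
rewrite -(@ler_pXn2r _ 2) ?nnegrE ?mulr_ge0 ?mult_norm_ge0// exprMn.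
rewrite !mult_norm_sqr mulrDr /= (ipZl (hilbertian_edot m)) (ipZr (hilbertian_edot m)).
have sq (t : R) : `|t| <= K -> t ^+ 2 <= K ^+ 2.
  by move=> tK; rewrite -[t ^+ 2]real_normK ?num_real// ler_pXn2r ?nnegrE.
rewrite lerD//; first by rewrite normrZ exprMn ler_wpM2r ?sqr_ge0// real_normK ?num_real// sq.
by rewrite mulrA -expr2 ler_wpM2r ?sq// (ip_ge0 (hilbertian_edot m)).
Qed.

Lemma mult_norm_scale_ge a b u k : 0 <= k -> k <= a -> k <= b ->
  k * mult_norm u <= mult_norm (a *: u.1, b *: u.2).
Proof.
move=> k0 ka kb.
rewrite -(@ler_pXn2r _ 2) ?nnegrE ?mulr_ge0 ?mult_norm_ge0// exprMn.
rewrite !mult_norm_sqr mulrDr /= (ipZl (hilbertian_edot m)) (ipZr (hilbertian_edot m)).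
have sq (t : R) : k <= t -> k ^+ 2 <= t ^+ 2.
  by move=> kt; rewrite ler_pXn2r ?nnegrE// (le_trans k0).
rewrite lerD//; first by rewrite normrZ exprMn ler_wpM2r ?sqr_ge0// real_normK ?num_real// sq.
by rewrite mulrA -expr2 ler_wpM2r ?sq// (ip_ge0 (hilbertian_edot m)).
Qed.

End MultiplierNorm.

(** Collects the bounds on the four terms of [stationary_x_identity]: [m * 2 M^2] from the slack
    terms, the middle product from [<res, W>] (factor [1]) and [penalty_x] (factor [M^2]), the last
    one from the barrier term. *)
Definition stationarity_const {R : realType} (m : nat) (a M : R) : R :=
  m%:R * (2 * M ^+ 2) + (1 + 2 * M ^+ 3) / Num.sqrt a * (1 + M ^+ 2)
  + (1 + M ^+ 2) * M ^+ 3 * (m%:R * M ^+ 2).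

(** * Estimate at a single stationary triplet, all constants being parameters *)

Section PointwiseEstimate.
Context {R : realType} {X H : hilbertType R} {m : nat}.
Variables (f : X -> R) (F : X -> H) (g : 'I_m -> X -> R).
Variables (phi : R -> \bar R) (psi : 'rV[R]_m -> R).
Variables (dphi : R -> R) (dpsi : 'rV[R]_m -> 'rV[R]_m).
Hypothesis df : forall x, differentiable f x.
Hypothesis dF : forall x, differentiable F x.
Hypothesis dg : forall i x, differentiable (g i) x.
Variables (c a k M : R) (z : X * H * 'rV[R]_m).
Let hM := hilbertian_mult_dot (H := H) (m := m).

Notation b := (bfun g psi).
Notation p := (pfun g psi).
Notation q := (qvec g psi c z).
Notation res := (residual f F g z).
Notation T := (mult_op F g z.1.1).
Notation S := (mult_grad F g z.1.1).
Let N := mult_norm (F z.1.1, q).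

Hypothesis c1 : 1 <= c.
Hypothesis a0 : 0 < a.
Hypothesis k0 : 0 < k.
Hypothesis M1 : 1 <= M.
Hypothesis b0 : 0 < b z.1.1.
Hypothesis HT : forall u, a * mult_dot u u <= mult_dot (T u) (T u).
Hypothesis HS : forall u, `|S u| <= M * mult_norm u.
Hypothesis HP : forall h, `|penalty_x f F g z h| <= M * mult_norm res * `|h|.
Hypothesis Hg : forall i h, `|'d (g i) (z.1.1) h| <= M * `|h|.
Hypothesis Hd : forall i, `|dpsi (vmax (gvec g z.1.1) 0) 0 i| <= 1.
Hypothesis Hu : mult_norm (z.1.2, z.2) <= M.
Hypothesis Hphi : 0 <= phiF F phi z.1.1 <= M * `|F z.1.1| ^+ 2.
Hypothesis Hdphi : k <= dphi (`|F z.1.1| ^+ 2).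
Hypothesis Hkp : k <= (p z.1.1 z.2)^-1.
Hypothesis HMp : (p z.1.1 z.2)^-1 <= M.
Hypothesis HMb : (b z.1.1)^-1 <= M.
Hypothesis HN : c * N ^+ 2 <= M.
Hypothesis Hx : forall h, dL_x f F g psi dphi dpsi c z h = 0.
Hypothesis Hl : forall u, dL_u f F g phi psi c z u = 0.

Let t := Num.sqrt c.
Let t1 : 1 <= t. Proof. by rewrite -sqrtr1 ler_sqrt// (le_trans ler01). Qed.
Let tt : t ^+ 2 = c. Proof. by rewrite sqr_sqrtr// (le_trans ler01). Qed.
Let t0 : 0 <= t. Proof. exact: sqrtr_ge0. Qed.
Let N0 : 0 <= N. Proof. exact: mult_norm_ge0. Qed.
Let M0 : 0 <= M. Proof. exact: le_trans ler01 M1. Qed.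
Let c0 : 0 < c. Proof. exact: lt_le_trans ltr01 c1. Qed.
Let p0 : 0 < p z.1.1 z.2. Proof. exact: pfun_gt0. Qed.

(** As [M >= 1], the hypothesis [c N^2 <= M] gives [(t N)^2 <= M <= M^2]. *)
Let tN_le : t * N <= M.
Proof.
rewrite -(@ler_pXn2r _ 2) ?nnegrE ?mulr_ge0// exprMn tt (le_trans HN)//.
by rewrite expr2 ler_peMl.
Qed.

Let N_le : N <= t * N. Proof. by rewrite ler_peMl. Qed.

Lemma qq_le : edot q q <= N ^+ 2.
Proof. exact: (edot_le_mult_norm (F z.1.1, q)). Qed.

Let q0 : 0 <= edot q q. Proof. exact: ip_ge0 (hilbertian_edot m) _. Qed.

Lemma mult_norm_T u : Num.sqrt a * mult_norm u <= mult_norm (T u).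
Proof.
rewrite -(@ler_pXn2r _ 2) ?nnegrE ?mulr_ge0 ?sqrtr_ge0 ?mult_norm_ge0//.
rewrite exprMn sqr_sqrtr ?(ltW a0)// !(ipnorm_sqr hM); exact: HT.
Qed.

Lemma T_residual : T res = - mult_rhs F g phi psi c z.
Proof.
apply: (ip_inj hM) => u; have := Hl u.
rewrite /dL_u -(mult_op_sym dF dg) (ipNl hM) => /eqP.
by rewrite addrC addr_eq0 => /eqP.
Qed.

(** [c N^2] is written as [(t N) (t N)] and one factor is bounded by [M], so the contributions
    quadratic in [N] become linear in [t N]. *)
Lemma mult_rhs_le : mult_norm (mult_rhs F g phi psi c z) <= t * N * (1 + 2 * M ^+ 3).
Proof.
pose A := c * phiF F phi z.1.1; pose B := c / b z.1.1 * edot q q.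
have -> : mult_rhs F g phi psi c z = (F z.1.1, q) + (A *: z.1.2, B *: z.2) by [].
rewrite (le_trans (ipnormD hM _ _))// mulrDr mulr1 lerD//.
have [phi0 phiM] := andP Hphi.
have FN : `|F z.1.1| ^+ 2 <= N ^+ 2 by rewrite mult_norm_sqr lerDl.
have cN : c * N ^+ 2 * M <= t * N * M ^+ 2.
  have -> : c * N ^+ 2 * M = (t * N) * (t * N) * M by rewrite -tt; ring.
  have -> : t * N * M ^+ 2 = (t * N) * M * M by ring.
  by rewrite ler_wpM2r// ler_wpM2l// mulr_ge0.
have A_le : `|A| <= t * N * M ^+ 2.
  rewrite ger0_norm; last by rewrite mulr_ge0// ltW.
  apply: le_trans cN; rewrite -mulrA ler_wpM2l ?(ltW c0)// (le_trans phiM)//.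
  by rewrite mulrC ler_wpM2r.
have B_le : `|B| <= t * N * M ^+ 2.
  rewrite ger0_norm; last by rewrite !mulr_ge0// ?invr_ge0 ltW.
  apply: le_trans cN; rewrite /B -mulrA -[leRHS]mulrA ler_wpM2l ?(ltW c0)// [leLHS]mulrC.
  by apply: ler_pM => //; [rewrite invr_ge0 ltW|exact: qq_le].
have K0 : 0 <= t * N * M ^+ 2 by rewrite !mulr_ge0// sqr_ge0.
apply: le_trans (mult_norm_scale_le (z.1.2, z.2) K0 A_le B_le) _.
apply: le_trans (_ : t * N * M ^+ 2 * M <= _); first by rewrite ler_wpM2l.
have := mulr_ge0 (mulr_ge0 t0 N0) (exprn_ge0 3 M0); rewrite !exprS expr0; lra.
Qed.

Lemma residual_le : Num.sqrt a * mult_norm res <= t * N * (1 + 2 * M ^+ 3).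
Proof.
apply: le_trans (mult_norm_T _) _.
by rewrite T_residual /mult_norm (ipnormN hM); exact: mult_rhs_le.
Qed.

Let v := penalty_weight F g psi dphi c z.
Let W := T v.

(** Both weights are at least [c k]; [c] is split as [t * t] to isolate [t N], the quantity in which
    all the upper bounds are expressed. *)
Lemma penalty_weight_ge : t * k * (t * N) <= mult_norm v.
Proof.
have -> : t * k * (t * N) = (c * k) * N by rewrite -tt; ring.
rewrite -[N]/(mult_norm (F z.1.1, q)).
apply: mult_norm_scale_ge => /=.
- by rewrite mulr_ge0// ltW.
- rewrite -mulrA ler_wpM2l ?(ltW c0)//.
  by rewrite (le_trans Hdphi)// ler_peMl ?lerDl ?sqr_ge0// (le_trans (ltW k0)).
- by rewrite ler_wpM2l// ltW.
Qed.

(* The derivative in [x] evaluated along [S (T v)]. *)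
Lemma stationary_x_identity :
  mult_dot W W = \sum_i g i z.1.1 ^+ 2 * (z.2 0 i + v.2 0 i) * W.2 0 i
   - mult_dot res W
   + barrier_weight g psi c z *
      \sum_i dpsi (vmax (gvec g z.1.1) 0) 0 i * 'd (g i) (z.1.1) (S W)
   - penalty_x f F g z (S W).
Proof.
have := Hx (S W); rewrite /dL_x -/v dotpDl.
have -> : dotp (gradL f F g z) (S W) = mult_dot res W -
    \sum_i g i z.1.1 ^+ 2 * z.2 0 i * W.2 0 i.
  rewrite dotpC dotp_mult_grad// /mult_dot/= [dotp W.1 _]dotpC -addrA; congr (_ + _).
  rewrite -sumrB; apply: eq_bigr => i _; rewrite !mxE; ring.
have -> : dotp (S v) (S W) = mult_dot W W -
    \sum_i g i z.1.1 ^+ 2 * v.2 0 i * W.2 0 i.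
  rewrite dotpC dotp_mult_grad// /mult_dot -addrA; congr (_ + _).
  rewrite -sumrB; apply: eq_bigr => i _.
  by rewrite [X in _ = X * _ - _]mxE; ring.
have -> : \sum_i g i z.1.1 ^+ 2 * (z.2 0 i + v.2 0 i) * W.2 0 i =
  \sum_i g i z.1.1 ^+ 2 * z.2 0 i * W.2 0 i + \sum_i g i z.1.1 ^+ 2 * v.2 0 i * W.2 0 i.
  by rewrite -big_split; apply: eq_bigr => i _ /=; ring.
lra.
Qed.

(** The decisive use of complementarity. Either [z.2 0 i + v.2 0 i = 0] exactly, whatever the size
    of [g_i], or [q_i = g_i]; then [g_i^2 = q_i^2], and the dangerous product is [c q_i^3 / p],
    bounded by [(c N^2) N / p]. *)
Lemma slack_le i : `|g i z.1.1 ^+ 2 * (z.2 0 i + v.2 0 i)| <= 2 * M ^+ 2 * (t * N).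
Proof.
have qiN : `|q 0 i| <= N by exact: (coord_le_mult_norm (F z.1.1, q)).
have muM : `|z.2 0 i| <= M by exact: le_trans (coord_le_mult_norm (z.1.2, z.2) i) Hu.
have qE : q 0 i = Num.max (g i z.1.1) (- (c^-1 * p z.1.1 z.2) * z.2 0 i).
  by rewrite !mxE.
have vE : v.2 0 i = c / p z.1.1 z.2 * q 0 i by rewrite mxE.
have [qg|qm] : q 0 i = g i z.1.1 \/ z.2 0 i + v.2 0 i = 0.
  rewrite vE qE maxEle; case: ifP => _; [right|by left].
  by field; rewrite !gt_eqF.
- rewrite -qg vE mulrDr (le_trans (ler_normD _ _))//.
  have q2 : `|q 0 i ^+ 2| <= N * N by rewrite normrX expr2 ler_pM.
  have NN : N * N <= M * (t * N).
    by rewrite ler_pM// (le_trans N_le).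
  have h1 : `|q 0 i ^+ 2 * z.2 0 i| <= M ^+ 2 * (t * N).
    rewrite normrM (le_trans (ler_pM _ _ q2 muM))//.
    have -> : M ^+ 2 * (t * N) = M * (t * N) * M by ring.
    by rewrite ler_wpM2r.
  have h2 : `|q 0 i ^+ 2 * (c / p z.1.1 z.2 * q 0 i)| <= M ^+ 2 * (t * N).
    rewrite (normrM (_ ^+ 2)) (normrM (c / _)) [`|c / _|]ger0_norm; last first.
      by rewrite divr_ge0 ?ltW.
    apply: le_trans (_ : N * N * (c * M * N) <= _).
      rewrite ler_pM//; first by rewrite !mulr_ge0 ?invr_ge0 ?(ltW c0) ?(ltW p0).
      by rewrite ler_pM ?mulr_ge0 ?invr_ge0 ?(ltW c0) ?(ltW p0)// ler_wpM2l ?(ltW c0).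
    have -> : N * N * (c * M * N) = (c * N ^+ 2) * (M * N) by ring.
    have -> : M ^+ 2 * (t * N) = M * (M * (t * N)) by ring.
    by rewrite ler_pM// ?mulr_ge0 ?sqr_ge0 ?(ltW c0)// ler_wpM2l.
  by apply: (le_trans (lerD h1 h2)); rewrite -mulrA mulr_natl mulr2n.
- by rewrite qm mulr0 normr0 !mulr_ge0// sqr_ge0.
Qed.

(** As in [mult_rhs_le], [c |q|^2 <= (t N)^2 <= M (t N)]. *)
Lemma barrier_weight_le :
  0 <= barrier_weight g psi c z <= (1 + M ^+ 2) * M ^+ 3 * (t * N).
Proof.
have mm : 0 <= edot z.2 z.2 by exact: ip_ge0 (hilbertian_edot m) _.
rewrite /barrier_weight; apply/andP; split.
  by rewrite !mulr_ge0 ?invr_ge0 ?addr_ge0 ?mulr_ge0 ?sqr_ge0// ltW.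
have mmM : edot z.2 z.2 <= M ^+ 2.
  apply: le_trans (edot_le_mult_norm (z.1.2, z.2)) _.
  by rewrite ler_pXn2r ?nnegrE// mult_norm_ge0.
have bM : (2 * b z.1.1 ^+ 2)^-1 <= M ^+ 2.
  rewrite invfM -exprVn.
  apply: le_trans (_ : 1 * (b z.1.1)^-1 ^+ 2 <= _).
    by rewrite ler_wpM2r ?sqr_ge0// invf_le1// ler1n.
  by rewrite mul1r ler_pXn2r ?nnegrE// invr_ge0 ltW.
have -> : (1 + M ^+ 2) * M ^+ 3 * (t * N) = ((1 + M ^+ 2) * M ^+ 2) * (M * (t * N)).
  by ring.
have -> : c * (1 + edot z.2 z.2) / (2 * b z.1.1 ^+ 2) * edot q q =
  ((1 + edot z.2 z.2) * (2 * b z.1.1 ^+ 2)^-1) * (c * edot q q) by ring.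
have b20 : 0 <= (2 * b z.1.1 ^+ 2)^-1 by rewrite invr_ge0 mulr_ge0 ?sqr_ge0.
apply: ler_pM.
- by rewrite mulr_ge0// addr_ge0.
- by rewrite mulr_ge0// ltW.
- by rewrite ler_pM// ?addr_ge0// lerD.
apply: le_trans (_ : (t * N) * (t * N) <= _); last by rewrite ler_wpM2r// mulr_ge0.
have -> : t * N * (t * N) = c * N ^+ 2 by rewrite -tt; ring.
by rewrite ler_wpM2l ?(ltW c0)// qq_le.
Qed.

Let K1 := stationarity_const m a M.

(** Each term of [stationary_x_identity] is at most a constant times [(t N) |W|]. One factor [|W|]
    is cancelled, hence the separate case [|W| = 0]. *)
Lemma T_penalty_weight_le : mult_norm W <= K1 * (t * N).
Proof.
have tN0 : 0 <= t * N by rewrite mulr_ge0.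
have K10 : 0 <= K1.
  rewrite /K1 /stationarity_const !addr_ge0 ?mulr_ge0 ?invr_ge0 ?addr_ge0
    ?mulr_ge0 ?exprn_ge0 ?sqrtr_ge0//.
have [W0|W0] := eqVneq (mult_norm W) 0; first by rewrite W0 mulr_ge0.
have Wp : 0 < mult_norm W by rewrite lt_neqAle eq_sym W0 mult_norm_ge0.
rewrite -(ler_pM2r Wp) -expr2 (ipnorm_sqr hM) stationary_x_identity.
have sumle (e : 'I_m -> R) C : (forall i, `|e i| <= C) -> `|\sum_i e i| <= m%:R * C.
  move=> eC; apply: le_trans (ler_norm_sum _ _ _) _.
  apply: le_trans (ler_sum _ (fun i _ => eC i)) _.
  by rewrite sumr_const card_ord mulr_natl.
have h1 : \sum_i g i z.1.1 ^+ 2 * (z.2 0 i + v.2 0 i) * W.2 0 i <=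
    m%:R * (2 * M ^+ 2 * (t * N) * mult_norm W).
  apply: le_trans (ler_norm _) _; apply: sumle => i.
  rewrite normrM ler_pM//; first exact: slack_le.
  exact: coord_le_mult_norm.
have D_le : mult_norm res <= (1 + 2 * M ^+ 3) / Num.sqrt a * (t * N).
  have sa : 0 < Num.sqrt a by rewrite sqrtr_gt0.
  by rewrite mulrAC ler_pdivlMr// mulrC (le_trans residual_le)// mulrC.
have h2 : - mult_dot res W <= (1 + 2 * M ^+ 3) / Num.sqrt a * (t * N) * mult_norm W.
  apply: le_trans (ler_norm _) _; rewrite normrN.
  apply: le_trans (ip_le_ipnorm hM _ _) _.
  by rewrite ler_wpM2r// mult_norm_ge0.
have SW := HS W.
have h3 : barrier_weight g psi c z *
      \sum_i dpsi (vmax (gvec g z.1.1) 0) 0 i * 'd (g i) (z.1.1) (S W) <=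
    (1 + M ^+ 2) * M ^+ 3 * (t * N) * (m%:R * (M * (M * mult_norm W))).
  have [bw0 bwM] := andP barrier_weight_le.
  apply: le_trans (ler_norm _) _; rewrite normrM ler_pM// ?(ger0_norm bw0)//.
  apply: sumle => i; rewrite normrM -[leRHS]mul1r ler_pM//.
  by rewrite (le_trans (Hg _ _))// ler_wpM2l.
have h4 : - penalty_x f F g z (S W) <=
   M * ((1 + 2 * M ^+ 3) / Num.sqrt a * (t * N)) * (M * mult_norm W).
  apply: le_trans (ler_norm _) _; rewrite normrN (le_trans (HP _))//.
  rewrite ler_pM// ?mulr_ge0 ?mult_norm_ge0//.
  by rewrite ler_wpM2l.
apply: le_trans (lerD (lerD (lerD h1 h2) h3) h4) _.
rewrite le_eqVlt; apply/orP; left; apply/eqP; rewrite /K1 /stationarity_const -/(mult_norm W); ring.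
Qed.

(** The lower bound on [|T v|] has one more factor [t] than the upper bound, so [t N > 0] is
    impossible once [t] exceeds the ratio of the constants. *)
Lemma infeasibility_eq0 : K1 < Num.sqrt a * k * t -> N = 0.
Proof.
move=> K1t; apply/eqP; case: (eqVneq N 0) => // Nn0.
have tN : 0 < t * N.
  by rewrite mulr_gt0 ?(lt_le_trans ltr01 t1)// lt_neqAle eq_sym Nn0.
have := le_trans (mult_norm_T v) T_penalty_weight_le.
have h : Num.sqrt a * (t * k * (t * N)) <= Num.sqrt a * mult_norm v.
  by rewrite ler_wpM2l ?sqrtr_ge0// penalty_weight_ge.
move=> /(le_trans h).
have -> : Num.sqrt a * (t * k * (t * N)) = Num.sqrt a * k * t * (t * N) by ring.
by rewrite ler_pM2r// leNgt K1t.
Qed.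

Lemma infeasibility_residual_eq0 : K1 < Num.sqrt a * k * t ->
  [/\ F z.1.1 = 0, q = 0 & res = 0].
Proof.
move=> /infeasibility_eq0 NE.
have /(congr1 fst)/= F0 := ipnorm_eq0 hM NE.
have /(congr1 snd)/= qE := ipnorm_eq0 hM NE.
split => //; apply: (ipnorm_eq0 hM); apply/eqP.
rewrite eq_le ipnorm_ge0 andbT; have := residual_le.
by rewrite NE mulr0 mul0r pmulr_rle0// sqrtr_gt0.
Qed.

End PointwiseEstimate.

(** * Uniform bounds on sublevel sets *)

Section PenaltyBounds.
Context {R : realType}.

Lemma phi_fineK (phi : R -> \bar R) t : phi_admissible phi -> edom phi t ->
  phi t = (fine (phi t))%:E.
Proof.
move=> pA [t0 tlt]; rewrite fineK// ge0_fin_numE//; exact: phi_ge0.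
Qed.

Lemma phi0 (phi : R -> \bar R) : phi_admissible phi -> phi 0 = 0%E.
Proof. by move=> pA; have [_ ->] := phi_eq0 pA (lexx 0). Qed.

Lemma phi_slope_near0 (phi : R -> \bar R) dphi : phi_admissible phi ->
  is_cont_derive_on_dom phi dphi -> forall e, 0 < e ->
  exists2 d, 0 < d & forall t, edom phi t -> t <= d ->
    `|fine (phi t) - dphi 0 * t| <= e * t.
Proof.
move=> pA [dphiP _] e e0.
have D0 : edom phi 0 by split; rewrite ?phi0.
have /nbhs_normP[d /= d0 dP] := is_derive_within_near (dphiP 0 D0) e0.
exists (d / 2) => [|t Dt td]; first by rewrite divr_gt0.
have [t0 _] := Dt.
have td' : t < d by rewrite (le_lt_trans td)// ltr_pdivrMr// mulr_natr mulr2n ltrDl.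
have := dP t; rewrite /ball_ /= sub0r normrN ger0_norm// => /(_ td' Dt).
by rewrite phi0//= !subr0 (ger0_norm t0).
Qed.

(** Convexity gives [phi (l t) <= l phi t], while for small [l] the derivative at [0] gives
    [phi (l t) >= l (dphi 0 * t - e)]; dividing by [l] leaves the tangent bound up to [e]. *)
Lemma phi_ge_linear (phi : R -> \bar R) dphi t : phi_admissible phi ->
  is_cont_derive_on_dom phi dphi -> edom phi t -> dphi 0 * t <= fine (phi t).
Proof.
move=> pA dphiP Dt; have [t0 tlt] := Dt.
have [->|tn0] := eqVneq t 0; first by rewrite mulr0 phi0.
have tp : 0 < t by rewrite lt0r tn0.
apply/ler_addgt0Pr => e e0.
have [|d d0 dP] := @phi_slope_near0 _ _ pA dphiP (e / t); first by rewrite divr_gt0.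
pose l := Num.min 1 (d / t).
have l0 : 0 < l by rewrite lt_min ltr01 divr_gt0.
have l1 : l <= 1 by rewrite ge_min lexx.
have lt_d : l * t <= d by rewrite -ler_pdivlMr// ge_min lexx orbT.
have := phi_convex pA t0 (lexx 0) (l := l); rewrite (ltW l0) l1 => /(_ isT).
rewrite mulr0 addr0 phi0// mule0 adde0 (phi_fineK pA Dt) -EFinM => H.
have Dl : edom phi (l * t).
  by split; [rewrite mulr_ge0// ltW|rewrite (le_lt_trans H)// ltry].
move: H; rewrite (phi_fineK pA Dl) lee_fin => H.
have := dP _ Dl lt_d; rewrite ler_distl => /andP[H1 _].
have et : e / t * (l * t) = e * l by field.
rewrite et in H1.
rewrite -(ler_pM2l l0); lra.
Qed.

(** Two facts near feasibility: a slope bounded away from zero, for the lower bound on [v], and a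
    linear bound on the value, for the term [c phi lambda]. *)
Lemma dphi_near0 (phi : R -> \bar R) dphi : phi_admissible phi ->
  is_cont_derive_on_dom phi dphi -> 0 < dphi 0 ->
  exists2 d, 0 < d & forall t, edom phi t -> t <= d ->
    dphi 0 / 2 <= dphi t /\ fine (phi t) <= 2 * dphi 0 * t.
Proof.
move=> pA dphiP k0; have [d1 d10 d1P] := phi_slope_near0 pA dphiP k0.
have D0 : edom phi 0 by split; rewrite ?phi0.
have [_ /subspace_continuousP/(_ 0 D0)/cvgrPdist_le] := dphiP.
have k20 : 0 < dphi 0 / 2 by rewrite divr_gt0.
move=> /(_ _ k20); rewrite near_withinE => /nbhs_normP[d /= d0 dP].
exists (Num.min d1 (d / 2)) => [|t Dt].
  by rewrite lt_min d10 divr_gt0.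
rewrite le_min => /andP[td1 td]; have [t0 _] := Dt; split.
  have td' : t < d by rewrite (le_lt_trans td)// ltr_pdivrMr// mulr_natr mulr2n ltrDl.
  have := dP t; rewrite /ball_ /= sub0r normrN ger0_norm// => /(_ td' Dt).
  by rewrite /from_subspace ler_distl => /andP[_]; lra.
by have := d1P t Dt td1; rewrite ler_distl => /andP[_]; lra.
Qed.

(** All coordinates of the origin vanish, so [dpsi 0 = 0]: the first-order estimate with error [1]
    then controls [psi], and continuity controls [dpsi]. *)
Lemma psi_near0 m (psi : 'rV[R]_m -> R) dpsi : psi_admissible psi ->
  is_cont_gradient_on_orthant psi dpsi ->
  (forall y i, orthant y -> y 0 i = 0 -> dpsi y 0 i = 0) ->
  exists2 d, 0 < d & forall y, orthant y -> enorm y <= d ->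
    psi 0 / 2 <= psi y /\ forall i, `|dpsi y 0 i| <= 1.
Proof.
move=> pA [psiP dpsiC] dpsi0; have B0 := psi0_gt0 pA.
have O0 : orthant (0 : 'rV[R]_m) by move=> i; rewrite mxE.
have d00 : dpsi 0 = 0 by apply/rowP => i; rewrite dpsi0 ?mxE.
have /nbhs_normP[d1 /= d10 d1P] := psiP 0 1 O0 ltr01.
have /subspace_continuousP/(_ 0 O0)/cvgrPdist_le/(_ 1 ltr01) := dpsiC.
rewrite near_withinE => /nbhs_normP[d2 /= d20 d2P].
exists (Num.min (psi 0 / 2) (Num.min (d1 / 2) (d2 / 2))) => [|y Oy].
  by rewrite !lt_min !divr_gt0.
rewrite !le_min => /and3P[yB yd1 yd2].
have half (s : R) : 0 < s -> s / 2 < s by move=> s0; lra.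
have y1 : `|y| < d1 by rewrite (le_lt_trans (norm_le_enorm _))// (le_lt_trans yd1)// half.
have y2 : `|y| < d2 by rewrite (le_lt_trans (norm_le_enorm _))// (le_lt_trans yd2)// half.
split.
  have := d1P y; rewrite /ball_ /= sub0r normrN => /(_ y1 Oy).
  rewrite d00 (ip0l (hilbertian_edot m)) !subr0 mul1r ler_distl => /andP[+ _].
  by apply: le_trans; lra.
move=> i; have := d2P y; rewrite /ball_ /= sub0r normrN => /(_ y2 Oy).
rewrite /from_subspace d00 sub0r normrN => H; exact: le_trans (norm_coord_le _ _) H.
Qed.

(* completing the square [(A u t - 1)^2 / (2 A)] *)
Lemma half_square_bound (A s u t : R) : 0 < A -> `|s| <= u * t ->
  A / 2 * t ^+ 2 - (2 * A)^-1 <= s + A / 2 * (1 + u ^+ 2) * t ^+ 2.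
Proof.
move=> A0 sut; have s1 : - (u * t) <= s by rewrite lerNl (le_trans (ler_norm _))// normrN.
have : 0 <= (A * u * t - 1) ^+ 2 / (2 * A).
  by rewrite mulr_ge0 ?sqr_ge0// invr_ge0 mulr_ge0// ltW.
have -> : (A * u * t - 1) ^+ 2 / (2 * A) = A / 2 * u ^+ 2 * t ^+ 2 - u * t + (2 * A)^-1.
  by field; rewrite gt_eqF.
lra.
Qed.

End PenaltyBounds.

(** * Lower bound on the augmented Lagrangian, uniform in the multipliers *)

Section LowerBound.
Context {R : realType} {X H : hilbertType R} {m : nat}.
Variables (f : X -> R) (F : X -> H) (g : 'I_m -> X -> R).
Variables (phi : R -> \bar R) (psi : 'rV[R]_m -> R).
Variables (dphi : R -> R).
Hypothesis df : forall x, differentiable f x.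
Hypothesis dF : forall x, differentiable F x.
Hypothesis dg : forall i x, differentiable (g i) x.
Hypothesis phi_adm : phi_admissible phi.
Hypothesis psi_adm : psi_admissible psi.
Hypothesis dphiP : is_cont_derive_on_dom phi dphi.
Hypothesis dphi0 : 0 < dphi 0.
Implicit Types (x : X) (z : X * H * 'rV[R]_m).

Notation p := (pfun g psi).
Notation Omega := (Omega F g phi psi).
Notation auglagr := (auglagr f F g phi psi).
Notation gplus x := (vmax (gvec g x) 0).

Lemma bfun_le x : bfun g psi x <= psi 0.
Proof. by apply: psi0_max => //; exact: orthant_vmax0. Qed.

Lemma Omega_edom x : Omega x -> edom phi (`|F x| ^+ 2).
Proof. by move=> [_ ?]; split => //; exact: sqr_ge0. Qed.

Lemma gplus_le_qvec c z : edot (gplus z.1.1) (gplus z.1.1) <=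
  edot (qvec g psi c z) (qvec g psi c z).
Proof.
apply: ler_sum => i _; rewrite -!expr2 !mxE.
rewrite [Num.max _ 0]maxEle; case: ifP => [_|/negbT]; first by rewrite expr0n/= sqr_ge0.
rewrite -ltNge => g0; rewrite ler_pXn2r ?nnegrE ?(ltW g0) ?le_max ?lexx//.
by rewrite (ltW g0).
Qed.

(** Completing squares with [A = c * dphi 0] and [A = c / psi 0] leaves coefficients [A / 2] and
    losses [(2 A)^-1]: the rate is the smaller coefficient and [lower_gap] the sum of the losses,
    both freed of [c]. *)
Definition lower_rate : R := Num.min (dphi 0 / 2) ((2 * psi 0)^-1).
Definition lower_gap : R := (2 * dphi 0)^-1 + psi 0 / 2.

Lemma lower_rate_gt0 : 0 < lower_rate.
Proof. by rewrite lt_min !divr_gt0//= invr_gt0 mulr_gt0// psi0_gt0. Qed.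

Lemma lower_gap_gt0 : 0 < lower_gap.
Proof. by rewrite addr_gt0// ?divr_gt0 ?psi0_gt0// invr_gt0 mulr_gt0. Qed.

(** The factor [1 + |lambda|^2], and its counterpart [1 + |mu|^2] inside [1 / p], absorb the terms
    linear in the multipliers; the loss [lower_gap / c] does not depend on them. *)
Lemma auglagr_ge c z : 0 < c -> Omega z.1.1 ->
  f z.1.1 + c * lower_rate * (`|F z.1.1| ^+ 2 + edot (gplus z.1.1) (gplus z.1.1))
    - lower_gap / c + kkt_penalty f F g z.1.1 z.1.2 z.2 <= fine (auglagr c z).
Proof.
move=> c0 Oz; rewrite auglagr_fineE//; have [b0 _] := Oz.
have B0 := psi0_gt0 psi_adm.
have p0 := pfun_gt0 z.2 b0.
have h1 : c * dphi 0 / 2 * `|F z.1.1| ^+ 2 - (2 * (c * dphi 0))^-1 <=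
    dotp z.1.2 (F z.1.1) + c / 2 * (1 + `|z.1.2| ^+ 2) * phiF F phi z.1.1.
  apply: le_trans (half_square_bound (mulr_gt0 c0 dphi0) (dotp_le z.1.2 _)) _.
  rewrite lerD2l.
  have -> : c * dphi 0 / 2 * (1 + `|z.1.2| ^+ 2) * `|F z.1.1| ^+ 2 =
    c / 2 * (1 + `|z.1.2| ^+ 2) * (dphi 0 * `|F z.1.1| ^+ 2) by ring.
  rewrite ler_wpM2l ?mulr_ge0 ?addr_ge0 ?sqr_ge0 ?(ltW c0)//.
  exact: phi_ge_linear (Omega_edom Oz).
have h2 : c / psi 0 / 2 * edot (qvec g psi c z) (qvec g psi c z) - (2 * (c / psi 0))^-1 <=
    edot z.2 (qvec g psi c z) + c / (2 * p z.1.1 z.2) * enorm (qvec g psi c z) ^+ 2.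
  have cB : 0 < c / psi 0 by rewrite divr_gt0.
  have := @half_square_bound _ (c / psi 0) (edot z.2 (qvec g psi c z)) (enorm z.2)
    (enorm (qvec g psi c z)) cB (ip_le_ipnorm (hilbertian_edot m) _ _).
  rewrite enorm_sqr => /le_trans; apply; rewrite lerD2l.
  rewrite ler_wpM2r ?(ip_ge0 (hilbertian_edot m))//.
  have -> : c / (2 * p z.1.1 z.2) = c / 2 * (1 + enorm z.2 ^+ 2) * (bfun g psi z.1.1)^-1.
    rewrite /pfun; field; rewrite gt_eqF//= gt_eqF//.
    by rewrite ltr_wpDr// sqr_ge0.
  have -> : c / psi 0 / 2 * (1 + enorm z.2 ^+ 2) = c / 2 * (1 + enorm z.2 ^+ 2) * (psi 0)^-1.
    by ring.
  rewrite ler_wpM2l ?mulr_ge0 ?addr_ge0 ?sqr_ge0 ?(ltW c0)//.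
  by rewrite lef_pV2 ?posrE// bfun_le.
have h3 : c * lower_rate * `|F z.1.1| ^+ 2 <= c * dphi 0 / 2 * `|F z.1.1| ^+ 2.
  by rewrite ler_wpM2r ?sqr_ge0// -mulrA ler_wpM2l ?(ltW c0)// ge_min lexx.
have h4 : c * lower_rate * edot (gplus z.1.1) (gplus z.1.1) <=
    c / psi 0 / 2 * edot (qvec g psi c z) (qvec g psi c z).
  rewrite ler_pM ?gplus_le_qvec ?(ip_ge0 (hilbertian_edot m))//.
    by rewrite mulr_ge0 ?(ltW c0)// (ltW lower_rate_gt0).
  by rewrite -mulrA -invfM mulrC [_ * 2]mulrC mulrC ler_wpM2l ?(ltW c0)// ge_min lexx orbT.
have -> : lower_gap / c = (2 * (c * dphi 0))^-1 + (2 * (c / psi 0))^-1.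
  by rewrite /lower_gap; field; rewrite !gt_eqF.
lra.
Qed.

End LowerBound.

(** * Operator bounds derived from the bounds on the data *)

Section DerivativeBounds.
Context {R : realType}.

Lemma uniform_derivative_bound (U V : normedModType R) (D : set U) (f : U -> V) :
  bounded_with_derivatives_on D f ->
  exists M : R, 0 <= M /\ forall x, D x ->
    [/\ `|f x| <= M, opnorm_le ('d f x) M & bilnorm_le (diff2 f x) M].
Proof.
move=> [[M0 [_ f0]] [M1 f1] [M2 f2]].
pose A := `|M0| + 1; have A0 : 0 <= A by rewrite addr_ge0.
exists (A + `|M1| + `|M2|); split; first by rewrite !addr_ge0.
move=> x Dx; split.
- have : `|f x| <= A by apply: f0 => //; rewrite (le_lt_trans (ler_norm _))// ltrDl.
  by move/le_trans; apply; rewrite -addrA lerDl addr_ge0.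
- move=> h; apply: le_trans (f1 x Dx h) _; rewrite ler_wpM2r//.
  by rewrite (le_trans (ler_norm _))// addrAC lerDr addr_ge0.
- move=> h k; apply: le_trans (f2 x Dx h k) _; rewrite !ler_wpM2r//.
  by rewrite (le_trans (ler_norm _))// lerDr addr_ge0.
Qed.

Lemma opnorm_le_trans (U V : normedModType R) (A : U -> V) C D :
  opnorm_le A C -> C <= D -> opnorm_le A D.
Proof. by move=> leA CD h; apply: le_trans (leA h) _; rewrite ler_wpM2r. Qed.

Lemma bilnorm_le_trans (U V : normedModType R) (B : U -> U -> V) C D :
  bilnorm_le B C -> C <= D -> bilnorm_le B D.
Proof. by move=> BC CD h k; apply: le_trans (BC h k) _; rewrite !ler_wpM2r. Qed.

Lemma mult_norm_le (H : hilbertType R) m (u : H * 'rV[R]_m) K : 0 <= K ->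
  `|u.1| <= K -> (forall i, `|u.2 0 i| <= K) -> mult_norm u <= (1 + m%:R) * K.
Proof.
move=> K0 u1 u2.
rewrite -(@ler_pXn2r _ 2) ?nnegrE ?mulr_ge0 ?addr_ge0 ?mult_norm_ge0//.
rewrite mult_norm_sqr exprMn.
have h1 : `|u.1| ^+ 2 <= K ^+ 2 by rewrite ler_pXn2r ?nnegrE.
have h2 : edot u.2 u.2 <= m%:R * K ^+ 2.
  apply: (@le_trans _ _ (\sum_(i < m) K ^+ 2)).
    apply: ler_sum => i _; rewrite -expr2 -[_ ^+ 2]real_normK ?num_real//.
    by rewrite ler_pXn2r ?nnegrE.
  by rewrite sumr_const card_ord mulr_natl.
apply: le_trans (lerD h1 h2) _; rewrite -[X in X + _]mul1r -mulrDl.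
by rewrite ler_wpM2r ?sqr_ge0// expr2 ler_peMl ?addr_ge0// lerDl.
Qed.

Context {X H : hilbertType R} {m : nat}.
Variables (f : X -> R) (F : X -> H) (g : 'I_m -> X -> R).
Hypothesis df : forall x, differentiable f x.
Hypothesis dF : forall x, differentiable F x.
Hypothesis dg : forall i x, differentiable (g i) x.
Implicit Types (x : X) (z : X * H * 'rV[R]_m) (u : H * 'rV[R]_m).

Lemma grad_norm_le (k : X -> R) x M : differentiable k x -> 0 <= M ->
  opnorm_le ('d k x) M -> `|grad k x| <= M.
Proof.
move=> dk M0 kM; apply: norm_le_dotp => // h.
by rewrite dotp_grad//; exact: le_trans (ler_norm _) (kM h).
Qed.

Lemma mult_grad_norm_le x u M : 0 <= M -> opnorm_le ('d F x) M ->
  (forall i, opnorm_le ('d (g i) x) M) ->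
  `|mult_grad F g x u| <= (1 + m%:R) * M * mult_norm u.
Proof.
move=> M0 FM gM; have [lF _ _] := diff_frechet (dF x).
apply: le_trans (ler_normD _ _) _.
have -> : (1 + m%:R) * M * mult_norm u = M * mult_norm u + \sum_(i < m) M * mult_norm u.
  by rewrite sumr_const card_ord -mulr_natl; ring.
rewrite lerD//.
  apply: le_trans (opnorm_adjoint lF M0 FM _) _.
  by rewrite ler_wpM2l// norm_le_mult_norm.
apply: le_trans (ler_norm_sum _ _ _) _; apply: ler_sum => i _.
rewrite normrZ mulrC ler_pM//; last exact: coord_le_mult_norm.
exact: grad_norm_le.
Qed.

Variables (x0 : X) (M : R).
Hypothesis M0 : 0 <= M.
Hypothesis fM : opnorm_le ('d f x0) M.
Hypothesis FM : opnorm_le ('d F x0) M.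
Hypothesis gM : forall i, opnorm_le ('d (g i) x0) M.

Lemma gradL_norm_le z : z.1.1 = x0 -> `|gradL f F g z| <=
  M + (1 + m%:R) * M * mult_norm (z.1.2, z.2).
Proof.
move=> zx; rewrite gradLE// zx (le_trans (ler_normD _ _))// lerD//.
  exact: grad_norm_le.
exact: mult_grad_norm_le.
Qed.

(** The residual is [T (lambda, mu)] plus the contribution [e] of [grad f], so coercivity of [T]
    bounds the multipliers by the residual. *)
Lemma multipliers_bound z a : z.1.1 = x0 -> 0 < a ->
  (forall u, a * mult_dot u u <= mult_dot (mult_op F g x0 u) (mult_op F g x0 u)) ->
  Num.sqrt a * mult_norm (z.1.2, z.2) <=
    mult_norm (residual f F g z) + (1 + m%:R) * (M * M).
Proof.
move=> zx a0 HT; have hM := hilbertian_mult_dot (H := H) (m := m).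
have h : Num.sqrt a * mult_norm (z.1.2, z.2) <= mult_norm (mult_op F g x0 (z.1.2, z.2)).
  rewrite -(@ler_pXn2r _ 2) ?nnegrE ?mulr_ge0 ?sqrtr_ge0 ?mult_norm_ge0//.
  by rewrite exprMn sqr_sqrtr ?(ltW a0)// !(ipnorm_sqr hM).
apply: le_trans h _.
pose e : H * 'rV[R]_m := ('d F x0 (grad f x0), \row_i 'd (g i) x0 (grad f x0)).
have -> : mult_op F g x0 (z.1.2, z.2) = residual f F g z + - e.
  rewrite /residual /mult_op /e gradLE// zx; move: (mult_grad _ _ _ _) => w.
  congr (_, _); first by rewrite linearD/= addrAC subrr add0r.
  by apply/rowP => i; rewrite !mxE linearD/=; ring.
apply: le_trans (ipnormD hM _ _) _; rewrite (ipnormN hM) lerD2l.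
have gf : `|grad f x0| <= M by exact: grad_norm_le.
apply: mult_norm_le => [||i] /=; first by rewrite mulr_ge0.
  by rewrite (le_trans (FM _))// ler_wpM2l.
by rewrite mxE (le_trans (gM _ _))// ler_wpM2l.
Qed.

Hypothesis gv : forall i, `|g i x0| <= M.
Hypothesis f2M : bilnorm_le (diff2 f x0) M.
Hypothesis F2M : bilnorm_le (diff2 F x0) M.
Hypothesis g2M : forall i, bilnorm_le (diff2 (g i) x0) M.
Hypothesis f2 : twice_differentiable f x0.
Hypothesis F2 : twice_differentiable F x0.
Hypothesis g2 : forall i, twice_differentiable (g i) x0.

Let diff2_linear (V : normedModType R) (k : X -> V) h :
  twice_differentiable k x0 -> linear (diff2 k x0 h).
Proof. by move=> /twice_differentiable_diff2[_ [lk _] _ _]; exact: lk. Qed.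

Lemma hessL_norm_le z h : z.1.1 = x0 ->
  `|hessL f F g z h| <= (M + (1 + m%:R) * M * mult_norm (z.1.2, z.2)) * `|h|.
Proof.
move=> zx; rewrite /hessL zx; set U := mult_norm _.
have Mh : 0 <= M * `|h| by rewrite mulr_ge0.
have l1 : `|z.1.2| <= U by exact: (norm_le_mult_norm (z.1.2, z.2)).
have l2 i : `|z.2 0 i| <= U by exact: (coord_le_mult_norm (z.1.2, z.2)).
have -> : (M + (1 + m%:R) * M * U) * `|h| =
    M * `|h| + M * `|h| * U + \sum_(i < m) U * (M * `|h|).
  by rewrite sumr_const card_ord -mulr_natl; ring.
apply: le_trans (ler_normD _ _) _; rewrite lerD//.
  apply: le_trans (ler_normD _ _) _; rewrite lerD//.
    by apply: rieszv_norm_le => [||k]; [exact: diff2_linear|exact: Mh|exact: f2M].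
  have AF : opnorm_le (diff2 F x0 h) (M * `|h|) by move=> k; exact: F2M.
  apply: le_trans (opnorm_adjoint (diff2_linear _ F2) Mh AF _) _.
  by rewrite ler_wpM2l.
apply: le_trans (ler_norm_sum _ _ _) _; apply: ler_sum => i _.
rewrite normrZ; apply: ler_pM; [by []|by []|exact: l2|].
apply: rieszv_norm_le; [exact: (diff2_linear _ (g2 i))|exact: Mh|].
by move=> k; exact: (g2M i).
Qed.

(** Linearity in the residual is the point. In the constant, [2 M G] with [G = M + (1 + m) M K]
    covers the second derivatives along [gradL] and the images of [hessL], and [2 M M K] the
    derivative of [g_i^2 mu_i]. *)
Lemma penalty_x_le z h K : z.1.1 = x0 -> mult_norm (z.1.2, z.2) <= K ->
  `|penalty_x f F g z h| <=
   (1 + m%:R) * (2 * (M * (M + (1 + m%:R) * M * K)) + 2 * (M * M * K)) *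
   mult_norm (residual f F g z) * `|h|.
Proof.
move=> zx UK; rewrite /penalty_x zx.
set r := residual _ _ _ _; set D := mult_norm r.
pose G := M + (1 + m%:R) * M * K.
have K0 : 0 <= K by exact: le_trans (mult_norm_ge0 _) UK.
have G0 : 0 <= G by rewrite addr_ge0// !mulr_ge0// addr_ge0.
have GU : M + (1 + m%:R) * M * mult_norm (z.1.2, z.2) <= G.
  by rewrite lerD2l ler_wpM2l// mulr_ge0// addr_ge0.
have hL : `|gradL f F g z| <= G := le_trans (gradL_norm_le zx) GU.
have hH : `|hessL f F g z h| <= G * `|h|.
  by apply: le_trans (hessL_norm_le h zx) _; rewrite ler_wpM2r.
have D0 : 0 <= D by exact: mult_norm_ge0.
have part (V : normedModType R) (k : X -> V) : opnorm_le ('d k x0) M ->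
    bilnorm_le (diff2 k x0) M ->
    `|diff2 k x0 h (gradL f F g z) + 'd k x0 (hessL f F g z h)| <= 2 * (M * G) * `|h|.
  move=> k1 k2; apply: le_trans (ler_normD _ _) _.
  have -> : 2 * (M * G) * `|h| = M * `|h| * G + M * (G * `|h|) by ring.
  rewrite lerD//; first by rewrite (le_trans (k2 _ _))// ler_wpM2l// mulr_ge0.
  by rewrite (le_trans (k1 _))// ler_wpM2l.
pose C := 2 * (M * G) + 2 * (M * M * K).
have MGh : 0 <= 2 * (M * G) * `|h| by rewrite !mulr_ge0.
have MMh : 0 <= 2 * (M * M * K) * `|h| by rewrite !mulr_ge0.
rewrite -/G -/C.
have -> : (1 + m%:R) * C * D * `|h| = D * (C * `|h|) + \sum_(i < m) D * (C * `|h|).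
  by rewrite sumr_const card_ord -mulr_natl; ring.
apply: le_trans (ler_normD _ _) _; rewrite lerD//.
  apply: le_trans (dotp_le _ _) _; rewrite ler_pM//; first exact: norm_le_mult_norm.
  apply: le_trans (part _ _ FM F2M) _; by rewrite /C ler_wpM2r// lerDl !mulr_ge0.
apply: le_trans (ler_norm_sum _ _ _) _; apply: ler_sum => i _.
rewrite normrM ler_pM//; first exact: coord_le_mult_norm.
have -> : C * `|h| = 2 * (M * G) * `|h| + 2 * (M * M * K) * `|h| by rewrite /C; ring.
apply: le_trans (ler_normD _ _) _; apply: lerD.
  exact: (part _ _ (gM i) (g2M i)).
have -> : 2 * (M * M * K) * `|h| = 2 * M * (M * `|h|) * K by ring.
have h2g : `|2 * g i x0| <= 2 * M by rewrite normrM normr_nat ler_wpM2l.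
rewrite normrM; apply: ler_pM; [by []|by []| |].
  by rewrite normrM; apply: ler_pM; [by []|by []|exact: h2g|exact: gM].
exact: le_trans (coord_le_mult_norm (z.1.2, z.2) i) UK.
Qed.

End DerivativeBounds.

Lemma le_sum_mem {R : numDomainType} (s : seq R) x :
  all (fun y => 0 <= y) s -> x \in s -> x <= \sum_(y <- s) y.
Proof.
move=> /allP s0 xs; rewrite (big_rem x)//= lerDl big_seq sumr_ge0// => y /mem_rem ys.
exact: s0.
Qed.

Lemma max_sqr_le {R : realDomainType} (b s : R) :
  Num.max b s ^+ 2 <= Num.max b 0 ^+ 2 + s ^+ 2.
Proof.
rewrite !maxEle; case: (leP b s) => bs; first by rewrite lerDr sqr_ge0.
by case: (leP b 0) => b0; nra.
Qed.

(** * Choice of the constants on a sublevel set *)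

Section SublevelEstimates.
Context {R : realType} {X H : hilbertType R} {m : nat}.
Variables (f : X -> R) (F : X -> H) (g : 'I_m -> X -> R).
Variables (phi : R -> \bar R) (psi : 'rV[R]_m -> R).
Variables (dphi : R -> R) (dpsi : 'rV[R]_m -> 'rV[R]_m) (r eps gamma a : R).
Hypothesis df : forall x, differentiable f x.
Hypothesis dF : forall x, differentiable F x.
Hypothesis dg : forall i x, differentiable (g i) x.
Hypothesis phi_adm : phi_admissible phi.
Hypothesis psi_adm : psi_admissible psi.
Hypothesis dphiP : is_cont_derive_on_dom phi dphi.
Hypothesis dphi0 : 0 < dphi 0.
Hypothesis dpsiP : is_cont_gradient_on_orthant psi dpsi.
Hypothesis dpsi0 : forall y i, orthant y -> y 0 i = 0 -> dpsi y 0 i = 0.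
Hypothesis r_gt0 : 0 < r.
Hypothesis eps_gt0 : 0 < eps.
Hypothesis a_gt0 : 0 < a.
Notation Omega := (Omega F g phi psi).
Notation D := (Omega_sub f F g phi psi r (gamma + eps)).
Notation auglagr := (auglagr f F g phi psi).
Notation gplus x := (vmax (gvec g x) 0).
Hypothesis Q_coercive : forall x, D x -> forall (lambda : H) (mu : 'rV[R]_m),
  a * (`|lambda| ^+ 2 + enorm mu ^+ 2) <= Qform F g x lambda mu.
Hypothesis f_bounded : bounded_with_derivatives_on D f.
Hypothesis g_bounded : forall i, bounded_with_derivatives_on D (g i).
Hypothesis F_bounded : bounded_with_derivatives_on D F.
Hypothesis f2 : forall x, Omega x -> twice_differentiable f x.
Hypothesis g2 : forall i x, Omega x -> twice_differentiable (g i) x.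
Hypothesis F2 : forall x, Omega x -> twice_differentiable F x.
Implicit Types (x : X) (z : X * H * 'rV[R]_m) (u : H * 'rV[R]_m).

Lemma uniform_problem_bound : exists M : R, 0 <= M /\ forall x, D x ->
  [/\ `|f x| <= M /\ forall i, `|g i x| <= M,
      opnorm_le ('d f x) M, opnorm_le ('d F x) M,
      forall i, opnorm_le ('d (g i) x) M &
      [/\ bilnorm_le (diff2 f x) M, bilnorm_le (diff2 F x) M &
          forall i, bilnorm_le (diff2 (g i) x) M]].
Proof.
have [Mf [Mf0 fM]] := uniform_derivative_bound f_bounded.
have [MF [MF0 FM]] := uniform_derivative_bound F_bounded.
have [Mg MgP] := choice (fun i => uniform_derivative_bound (g_bounded i)).
have S0 : 0 <= \sum_i Mg i by apply: sumr_ge0 => i _; have [] := MgP i.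
have Sg i : Mg i <= \sum_i Mg i.
  rewrite (bigD1 i)//= lerDl; apply: sumr_ge0 => j _; by have [] := MgP j.
exists (Mf + MF + \sum_i Mg i); split; first by rewrite !addr_ge0.
have lf : Mf <= Mf + MF + \sum_i Mg i by lra.
have lF : MF <= Mf + MF + \sum_i Mg i by lra.
have lg i : Mg i <= Mf + MF + \sum_i Mg i by have := Sg i; lra.
move=> x Dx; have [f0 f1 fd2] := fM x Dx; have [_ F1 Fd2] := FM x Dx.
have gP i : [/\ `|g i x| <= Mg i, opnorm_le ('d (g i) x) (Mg i)
    & bilnorm_le (diff2 (g i) x) (Mg i)] by have [_] := MgP i; exact.
split.
- by split=> [|i]; [exact: le_trans f0 lf|have [h _ _] := gP i; exact: le_trans h (lg i)].
- exact: opnorm_le_trans f1 lf.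
- exact: opnorm_le_trans F1 lF.
- by move=> i; have [_ h _] := gP i; exact: opnorm_le_trans h (lg i).
split.
- exact: bilnorm_le_trans fd2 lf.
- exact: bilnorm_le_trans Fd2 lF.
- by move=> i; have [_ _ h] := gP i; exact: bilnorm_le_trans h (lg i).
Qed.

Lemma mult_op_coercive x u : D x ->
  (2 * a) * mult_dot u u <= mult_dot (mult_op F g x u) (mult_op F g x u).
Proof.
move=> Dx; have := Q_coercive Dx u.1 u.2; rewrite QformE// enorm_sqr.
have -> : mult_dot u u = `|u.1| ^+ 2 + edot u.2 u.2 by rewrite /mult_dot dotp_norm.
lra.
Qed.

Lemma sublevel_Omega c z : (auglagr c z <= gamma%:E)%E ->
  Omega z.1.1 /\ fine (auglagr c z) <= gamma.
Proof.
move=> zg; have [Oz|nOz] := pselect (Omega z.1.1).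
  by split => //; move: zg; rewrite auglagrE.
by move: zg; rewrite auglagr_notin.
Qed.

(** Membership in [D] has to come first: [f] is bounded below there, and this turns the estimate of
    [auglagr_ge] into absolute bounds on the infeasibility and on the residual. *)
Lemma sublevel_bounds : exists c1 C : R, [/\ 1 <= c1, 0 <= C &
  forall c z, c1 <= c -> (auglagr c z <= gamma%:E)%E ->
  [/\ D z.1.1, c * (`|F z.1.1| ^+ 2 + edot (gplus z.1.1) (gplus z.1.1)) <= C
    & mult_norm (z.1.2, z.2) <= C]].
Proof.
have [M [M0 MP]] := uniform_problem_bound.
pose kap := lower_rate psi dphi; pose gap := lower_gap psi dphi.
have kap0 : 0 < kap := lower_rate_gt0 psi_adm dphi0.
have gap0 : 0 < gap := lower_gap_gt0 psi_adm dphi0.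
pose B := `|gamma + eps + M|.
(* From [|res|^2 / 2 <= B] the residual is at most [sqrt (2 B)]; [multipliers_bound] then divides by
   [sqrt (2 a)]. *)
pose C2 := (Num.sqrt (2 * B) + (1 + m%:R) * (M * M)) / Num.sqrt (2 * a).
have C20 : 0 <= C2.
  by rewrite mulr_ge0 ?invr_ge0 ?sqrtr_ge0// addr_ge0 ?sqrtr_ge0// !mulr_ge0// addr_ge0.
have Bn : 0 <= B := normr_ge0 _.
have BK0 : 0 <= B / kap by rewrite divr_ge0 ?(ltW kap0).
have rk0 : 0 <= r / kap by rewrite divr_ge0 ?(ltW kap0) ?(ltW r_gt0).
have ge0 : 0 <= gap / eps by rewrite divr_ge0 ?(ltW gap0) ?(ltW eps_gt0).
(* [r / kap] ensures [c kap >= r], so the penalty in [Omega_sub] is dominated; [gap / eps] makes the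
   loss [gap / c] at most [eps]. *)
exists (1 + r / kap + gap / eps), (B / kap + C2); split; [lra|lra|].
move=> c z c1 zg; have [Oz Lg] := sublevel_Omega zg.
have c0 : 0 < c by lra.
have := le_trans (auglagr_ge f phi_adm psi_adm dphiP dphi0 c0 Oz) Lg.
rewrite kkt_penaltyE// -/kap -/gap; set E := `|_| ^+ 2 + _.
set res := residual _ _ _ _ => H1.
have E0 : 0 <= E by rewrite addr_ge0 ?sqr_ge0// (ip_ge0 (hilbertian_edot m)).
have r0 : 0 <= mult_dot res res by exact: ip_ge0 (hilbertian_mult_dot) _.
have gc : gap / c <= eps.
  rewrite ler_pdivrMr// mulrC -ler_pdivrMr//; lra.
have rc : r <= c * kap by rewrite -ler_pdivrMr//; lra.
have rE : r * E <= c * kap * E by rewrite ler_wpM2r.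
have ckE : 0 <= c * kap * E by rewrite !mulr_ge0// ltW.
have Dz : D z.1.1 by split => //; rewrite enorm_sqr -/E; lra.
have [[fM _] f1 F1 g1 _] := MP _ Dz.
have fMl : - M <= f z.1.1 by rewrite lerNl (le_trans (ler_norm _))// normrN.
have BB : gamma + eps + M <= B := ler_norm _.
split => //.
  have : c * E <= B / kap by rewrite ler_pdivlMr//; lra.
  lra.
have h := multipliers_bound df dF dg M0 f1 F1 g1 (erefl z.1.1)
  (mulr_gt0 (ltr0n _ 2) a_gt0) (fun u => mult_op_coercive u Dz).
have resB : mult_norm res <= Num.sqrt (2 * B).
  rewrite /mult_norm /ipnorm ler_wsqrtr//; lra.
have : mult_norm (z.1.2, z.2) <= C2.
  rewrite /C2 ler_pdivlMr ?sqrtr_gt0 ?mulr_gt0// mulrC (le_trans h)//.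
  by rewrite lerD2r.
lra.
Qed.

Lemma pfun_le x mu : 0 < bfun g psi x -> pfun g psi x mu <= bfun g psi x.
Proof.
move=> b0; rewrite /pfun ler_pdivrMr ?ltr_wpDr ?sqr_ge0//.
by rewrite ler_peMr ?(ltW b0)// lerDl sqr_ge0.
Qed.

Lemma stationary_kkt : exists c1 : R, 1 <= c1 /\
  forall c z, c1 <= c -> (auglagr c z <= gamma%:E)%E ->
  (forall h, dL_x f F g psi dphi dpsi c z h = 0) ->
  (forall u, dL_u f F g phi psi c z u = 0) ->
  kkt f F g z.1.1 z.1.2 z.2.
Proof.
have [M0 [M00 MP]] := uniform_problem_bound.
have [c1 [C [c11 C0 SP]]] := sublevel_bounds.
have [d1 d10 phiN] := dphi_near0 phi_adm dphiP dphi0.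
have [d2 d20 psiN] := psi_near0 psi_adm dpsiP dpsi0.
have B0 := psi0_gt0 psi_adm.
(* A lower bound common to [dphi] near [0] and to [1 / p], since [p <= psi 0]. *)
pose k := Num.min (dphi 0 / 2) (psi 0)^-1.
have k0 : 0 < k by rewrite lt_min divr_gt0//= invr_gt0.
(* In order, [M1] to [M6] bound the norm of [S], the [x]-derivative of [eta] relative to the
   residual, [phi] relative to [|F|^2], then [1 / p], [1 / b] and [c N^2]. *)
pose M1 := (1 + m%:R) * M0.
pose M2 := (1 + m%:R) * (2 * (M0 * (M0 + (1 + m%:R) * M0 * C)) + 2 * (M0 * M0 * C)).
pose M3 := 2 * dphi 0.
pose M4 := (1 + C ^+ 2) * (2 / psi 0).
pose M5 := 2 / psi 0.
pose M6 := 3 * C + 2 * psi 0 ^+ 2 * C ^+ 2.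
have n0 : 0 <= 1 + m%:R :> R by rewrite addr_ge0.
have M10 : 0 <= M1 by rewrite mulr_ge0.
have G0 : 0 <= M0 + (1 + m%:R) * M0 * C by rewrite addr_ge0// !mulr_ge0.
have M20 : 0 <= M2 by rewrite mulr_ge0// addr_ge0// !mulr_ge0.
have M30 : 0 <= M3 by rewrite mulr_ge0 ?(ltW dphi0).
have M40 : 0 <= M4 by rewrite mulr_ge0 ?addr_ge0 ?sqr_ge0 ?divr_ge0 ?(ltW B0).
have M50 : 0 <= M5 by rewrite divr_ge0 ?(ltW B0).
have M60 : 0 <= M6 by rewrite addr_ge0 ?(mulr_ge0, sqr_ge0, ltW B0).
pose Ms := [:: 1; M0; C; M1; M2; M3; M4; M5; M6]; pose M := \sum_(y <- Ms) y.
have Ms0 : all (fun y => 0 <= y) Ms by rewrite /= ler01 M00 C0 M10 M20 M30 M40 M50 M60.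
have M_ge y : y \in Ms -> y <= M by exact: le_sum_mem.
have M_ge1 : 1 <= M by apply: M_ge; rewrite !inE eqxx.
have M_ge0 : M0 <= M by apply: M_ge; rewrite !inE eqxx ?orbT.
have M_geC : C <= M by apply: M_ge; rewrite !inE eqxx ?orbT.
have M_ge1' : M1 <= M by apply: M_ge; rewrite !inE eqxx ?orbT.
have M_ge2 : M2 <= M by apply: M_ge; rewrite !inE eqxx ?orbT.
have M_ge3 : M3 <= M by apply: M_ge; rewrite !inE eqxx ?orbT.
have M_ge4 : M4 <= M by apply: M_ge; rewrite !inE eqxx ?orbT.
have M_ge5 : M5 <= M by apply: M_ge; rewrite !inE eqxx ?orbT.
have M_ge6 : M6 <= M by apply: M_ge; rewrite !inE eqxx ?orbT.
clearbody M.
pose K1 := stationarity_const m (2 * a) M.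
have sak : 0 < Num.sqrt (2 * a) * k by rewrite mulr_gt0// sqrtr_gt0 mulr_gt0.
pose K2 := `|K1| / (Num.sqrt (2 * a) * k) + 1.
have K20 : 0 < K2 by rewrite ltr_wpDl// divr_ge0// ltW.
have Cd1 : 0 <= C / d1 by rewrite divr_ge0 ?(ltW d10).
have Cd2 : 0 <= C / d2 ^+ 2 by rewrite divr_ge0// sqr_ge0.
(* [C / d1] and [C / d2 ^+ 2] force [|F|^2 <= d1] and [|g+| <= d2], where the local bounds on [phi]
   and [psi] hold; [K2 ^+ 2] forces [K2 <= sqrt c], the threshold of the pointwise estimate. *)
exists (c1 + C / d1 + C / d2 ^+ 2 + K2 ^+ 2); split.
  by have := sqr_ge0 K2; lra.
move=> c z cc zg Lx Lu; have K22 := sqr_ge0 K2.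
have cc1 : c1 <= c by lra.
have [Dz FgC uC] := SP c z cc1 zg.
have [Oz _] := sublevel_Omega zg.
have c0 : 0 < c by lra.
have c1' : 1 <= c by lra.
have [b0 phiz] := Oz.
have [[fM gM] f1 F1 g1 [fd2 Fd2 gd2]] := MP _ Dz.
have gp0 : 0 <= edot (gplus z.1.1) (gplus z.1.1) by exact: ip_ge0 (hilbertian_edot m) _.
have F0 : 0 <= `|F z.1.1| ^+ 2 by exact: sqr_ge0.
have FC : c * `|F z.1.1| ^+ 2 <= C.
  by apply: le_trans FgC; rewrite ler_wpM2l ?(ltW c0)// lerDl.
have gC : c * edot (gplus z.1.1) (gplus z.1.1) <= C.
  by apply: le_trans FgC; rewrite ler_wpM2l ?(ltW c0)// lerDr.
have Fd1 : `|F z.1.1| ^+ 2 <= d1.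
  rewrite -(ler_pM2l c0) (le_trans FC)// -ler_pdivrMr//; lra.
have gd2' : enorm (gplus z.1.1) <= d2.
  rewrite -(@ler_pXn2r _ 2) ?nnegrE ?enorm_ge0 ?(ltW d20)// enorm_sqr.
  rewrite -(ler_pM2l c0) (le_trans gC)// -ler_pdivrMr ?exprn_gt0//; lra.
have [phi1 phi2] := phiN _ (Omega_edom Oz) Fd1.
have [psi1 psi2] := psiN _ (orthant_vmax0 _) gd2'.
have psi1' : psi 0 / 2 <= bfun g psi z.1.1 by [].
have bV : (bfun g psi z.1.1)^-1 <= 2 / psi 0.
  by rewrite -[2 / _]invf_div lef_pV2 ?posrE// divr_gt0.
have p0 := pfun_gt0 z.2 b0.
have muC : edot z.2 z.2 <= C ^+ 2.
  apply: le_trans (edot_le_mult_norm (z.1.2, z.2)) _.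
  by rewrite ler_pXn2r ?nnegrE ?mult_norm_ge0.
have pV : (pfun g psi z.1.1 z.2)^-1 = (1 + edot z.2 z.2) / bfun g psi z.1.1.
  by rewrite /pfun invf_div enorm_sqr.
have mu0 : 0 <= edot z.2 z.2 by exact: ip_ge0 (hilbertian_edot m) _.
have p_psi : pfun g psi z.1.1 z.2 <= psi 0.
  by apply: le_trans (pfun_le z.2 b0) _; exact: bfun_le.
have [Fz qz rz] : [/\ F z.1.1 = 0, qvec g psi c z = 0 & residual f F g z = 0].
  apply: (@infeasibility_residual_eq0 R X H m f F g phi psi dphi dpsi dF dg c (2 * a) k M z).
  - exact: c1'.
  - by rewrite mulr_gt0.
  - exact: k0.
  - exact: M_ge1.
  - exact: b0.
  - by move=> u; exact: mult_op_coercive.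
  - move=> u; apply: le_trans (mult_grad_norm_le dF dg u M00 F1 g1) _.
    by rewrite ler_wpM2r// mult_norm_ge0.
  - move=> h.
    apply: le_trans (penalty_x_le df dF dg M00 f1 F1 g1 gM fd2 Fd2 gd2
      (f2 Oz) (F2 Oz) (fun i => g2 i Oz) h (erefl _) uC) _.
    by rewrite !ler_wpM2r// mult_norm_ge0.
  - by move=> i h; apply: le_trans (g1 i h) _; rewrite ler_wpM2r.
  - exact: psi2.
  - exact: le_trans uC M_geC.
  - apply/andP; split; first by rewrite fine_ge0// phi_ge0.
    by apply: le_trans phi2 _; rewrite ler_wpM2r.
  - by rewrite (le_trans _ phi1)// ge_min lexx.
  - by rewrite (le_trans (y := (psi 0)^-1)) ?ge_min ?lexx ?orbT// lef_pV2 ?posrE.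
  - apply: le_trans M_ge4; rewrite pV.
    by rewrite ler_pM ?addr_ge0 ?invr_ge0 ?(ltW b0)// lerD2l.
  - exact: le_trans bV M_ge5.
  - rewrite mult_norm_sqr /=.
    (* [q_i^2] is at most the square of the positive part of [g_i] plus that of [p mu_i / c]. With
       [p <= psi 0], the second part multiplied by [c] is of order [|mu|^2 / c], hence bounded. *)
    have q_le : edot (qvec g psi c z) (qvec g psi c z) <=
        2 * edot (gplus z.1.1) (gplus z.1.1) + 2 * (psi 0 / c) ^+ 2 * edot z.2 z.2.
      rewrite /edot !mulr_sumr -big_split; apply: ler_sum => i _ /=; rewrite !mxE.
      set s := - (c^-1 * _) * _.
      have s2 : s ^+ 2 <= (psi 0 / c) ^+ 2 * z.2 0 i ^+ 2.
        rewrite /s exprMn sqrrN ler_wpM2r ?sqr_ge0// ler_pXn2r ?nnegrE.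
        - by rewrite mulrC ler_wpM2r// invr_ge0 ltW.
        - by [].
        - by rewrite mulr_ge0 ?invr_ge0 ?(ltW c0) ?(ltW p0).
        - by rewrite divr_ge0 ?(ltW B0) ?(ltW c0).
      have gq := max_sqr_le (g i z.1.1) s.
      have := sqr_ge0 (Num.max (g i z.1.1) 0); rewrite -!expr2.
      have := le_trans gq (lerD (lexx _) s2); move: (psi 0 / c) => e.
      have := mulr_ge0 (sqr_ge0 e) (sqr_ge0 (z.2 0 i)).
      move: (Num.max _ _ ^+ 2) (Num.max _ _ ^+ 2) => A B'.
      rewrite -[2 * _ * _]mulrA; move: (e ^+ 2 * _) => G ? ? ?.
      lra.
    have h1 : c * edot (qvec g psi c z) (qvec g psi c z) <=
        2 * C + 2 * psi 0 ^+ 2 * C ^+ 2.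
      apply: le_trans (_ : c * (2 * edot (gplus z.1.1) (gplus z.1.1) +
          2 * (psi 0 / c) ^+ 2 * edot z.2 z.2) <= _); first by rewrite ler_wpM2l ?(ltW c0).
      have -> : c * (2 * edot (gplus z.1.1) (gplus z.1.1) +
          2 * (psi 0 / c) ^+ 2 * edot z.2 z.2) =
          2 * (c * edot (gplus z.1.1) (gplus z.1.1)) +
          2 * psi 0 ^+ 2 * (edot z.2 z.2 / c) by field; rewrite gt_eqF.
      apply: lerD; first by rewrite ler_wpM2l.
      apply: ler_wpM2l; first by rewrite mulr_ge0// sqr_ge0.
      by rewrite ler_pdivrMr// (le_trans muC)// ler_peMr// sqr_ge0.
    rewrite mulrDr; apply: le_trans (lerD FC h1) _.
    apply: le_trans M_ge6; rewrite /M6; lra.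
  - exact: Lx.
  - exact: Lu.
  - have sc : K2 <= Num.sqrt c.
      rewrite -(@ler_pXn2r _ 2) ?nnegrE ?sqrtr_ge0 ?(ltW K20)//.
      by rewrite sqr_sqrtr ?(ltW c0)//; lra.
    apply: lt_le_trans (_ : Num.sqrt (2 * a) * k * K2 <= _); last by rewrite ler_wpM2l// ltW.
    rewrite /K2 mulrDr mulr1 [_ * (_ / _)]mulrC divfK ?gt_eqF//.
    by rewrite (le_lt_trans (ler_norm _))// ltrDl.
exact: (kkt_of_stationary dF dg c0 Oz Fz qz rz Lx).
Qed.

End SublevelEstimates.

(** * Minimisers *)

Lemma frechet_loc_min {R : realType} {U : normedModType R} (G : U -> R) x A :
  frechet G x A -> (\forall y \near x, G x <= G y) -> forall h, A h = 0.
Proof.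
move=> [lA _ GA] minG.
have A_ge0 h : 0 <= A h.
  apply/ler_addgt0Pr => e e0.
  have h1 : 0 < `|h| + 1 by rewrite ltr_wpDl.
  have eh : 0 < e / (`|h| + 1) by rewrite divr_gt0.
  have /nbhs_normP[d /= d0 dP] : \forall y \near x,
      G x <= G y /\ `|G y - G x - A (y - x)| <= e / (`|h| + 1) * `|y - x|.
    by apply: filterS2 minG (GA _ eh).
  (* A step that keeps [x + s h] in the ball of radius [d]; dividing by [|h| + 1] also covers
     [h = 0]. *)
  pose s := d / 2 / (`|h| + 1).
  have s0 : 0 < s by rewrite !divr_gt0.
  have sh : s * `|h| < d.
    rewrite (@le_lt_trans _ _ (d / 2))//; last by lra.
    by rewrite /s mulrAC ler_pdivrMr// ler_pM2l ?divr_gt0// lerDl.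
  have := dP (x + s *: h); rewrite /ball_ /= opprD addrA subrr sub0r normrN.
  rewrite normrZ gtr0_norm// => /(_ sh)[G1].
  have -> : x + s *: h - x = s *: h by rewrite addrAC subrr add0r.
  rewrite normrZ gtr0_norm// (linear_for_scale _ _ lA) ler_distl => /andP[_ G2].
  have : 0 <= s * A h + e / (`|h| + 1) * (s * `|h|).
    by move: G2; rewrite /GRing.scale/=; lra.
  have -> : e / (`|h| + 1) * (s * `|h|) = s * (e * (`|h| / (`|h| + 1))) by ring.
  rewrite -mulrDr pmulr_rge0// => /le_trans; apply; rewrite lerD2l.
  by rewrite ler_piMr ?(ltW e0)// ler_pdivrMr// mul1r lerDl.
move=> h; apply/eqP; rewrite eq_le A_ge0 andbT.
by have := A_ge0 (- h); rewrite -scaleN1r (linear_for_scale _ _ lA) scaleN1r oppr_ge0.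
Qed.

(** The direct method: a minimising sequence in the sublevel set of [y0] is bounded, and [riesz]
    reduces weak convergence to convergence of inner products. *)
Lemma weakly_seq_lsc_min {R : realType} {V : normedModType R} (ip : V -> V -> R)
    (Phi : V -> \bar R) (y0 : V) (M : R) :
  hilbertian ip -> weakly_seq_lsc Phi ->
  (forall y, (Phi y <= Phi y0)%E -> `|y| <= M) ->
  exists y, forall w, (Phi y <= Phi w)%E.
Proof.
move=> hip lsc bnd.
pose S := [set Phi y | y in [set y | (Phi y <= Phi y0)%E]].
have S0 : S != set0 by apply/set0P; exists (Phi y0); exists y0 => //=.
have [v vS vinf] := ereal_inf_seq S0.
have /choice[u uP] : forall n, exists y, (Phi y <= Phi y0)%E /\ Phi y = v n.
  by move=> n; have [y yy <-] := vS n; exists y.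
have [|s sn [w wP]] := @weak_sequential_compactness _ _ _ hip u M.
  by move=> n; apply: bnd; have [] := uP n.
have wcv : weakly_cvg (u \o s) w.
  move=> l lc; have bl := linear_opnorm_le lc.
  have ll : linear l by move=> a b c; rewrite linearP.
  have [k kP] := riesz hip ll bl.
  have -> : (fun n => l ((u \o s) n)) = (fun n => ip (u (s n)) k).
    by apply/funext => n /=; rewrite kP (ipC hip).
  by rewrite kP (ipC hip); exact: wP.
have := lsc _ _ wcv.
have scv : s n @[n --> \oo] --> \oo.
  move=> A [N _ NA]; exists N => // n /= Nn; apply: NA => /=.
  exact: leq_trans Nn (sn n).
have Pcv : (Phi \o (u \o s)) @ \oo --> ereal_inf S.
  have -> : Phi \o (u \o s) = v \o s by apply/funext => n /=; have [_] := uP (s n).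
  exact: cvg_comp scv vinf.
have [-> _] := cvg_limn_einf_sup Pcv => wS.
exists w => y; have [yy0|/ltW yy0] := leP (Phi y) (Phi y0).
  by apply: le_trans wS _; apply: ereal_inf_lbound; exists y.
by apply: le_trans wS (le_trans _ yy0); apply: ereal_inf_lbound; exists y0 => /=.
Qed.

(** * Stationarity, values at feasible points and local optimality *)

Section Optimality.
Context {R : realType} {X H : hilbertType R} {m : nat}.
Variables (f : X -> R) (F : X -> H) (g : 'I_m -> X -> R).
Variables (phi : R -> \bar R) (psi : 'rV[R]_m -> R).
Variables (dphi : R -> R) (dpsi : 'rV[R]_m -> 'rV[R]_m).
Hypothesis df : forall x, differentiable f x.
Hypothesis dF : forall x, differentiable F x.
Hypothesis dg : forall i x, differentiable (g i) x.
Hypothesis phi_adm : phi_admissible phi.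
Hypothesis psi_adm : psi_admissible psi.
Hypothesis dphiP : is_cont_derive_on_dom phi dphi.
Hypothesis dpsiP : is_cont_gradient_on_orthant psi dpsi.
Hypothesis dpsi0 : forall y i, orthant y -> y 0 i = 0 -> dpsi y 0 i = 0.
Notation Omega := (Omega F g phi psi).
Notation auglagr := (auglagr f F g phi psi).
Hypothesis f2 : forall x, Omega x -> twice_differentiable f x.
Hypothesis g2 : forall i x, Omega x -> twice_differentiable (g i) x.
Hypothesis F2 : forall x, Omega x -> twice_differentiable F x.
Implicit Types (x : X) (z w : X * H * 'rV[R]_m) (u v : H * 'rV[R]_m).

Let hM := hilbertian_mult_dot (H := H) (m := m).

Let auglagr_frechet' c z (c0 : 0 < c) (Oz : Omega z.1.1) :=
  auglagr_frechet df dF dg phi_adm dphiP dpsiP dpsi0 c0 Oz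
    (f2 Oz) (F2 Oz) (fun i => g2 i Oz).

Lemma dL_eq0 c z :
  (forall w, dL_x f F g psi dphi dpsi c z w.1.1 +
     dL_u f F g phi psi c z (w.1.2, w.2) = 0) ->
  (forall h, dL_x f F g psi dphi dpsi c z h = 0) /\
  (forall u, dL_u f F g phi psi c z u = 0).
Proof.
move=> L0; have dLu0 : dL_u f F g phi psi c z 0 = 0.
  rewrite /dL_u (linear_for0 (linear_mult_op dF dg _)) !(ip0r hM) addr0//.
have dLx h : dL_x f F g psi dphi dpsi c z h = 0.
  by have := L0 (h, 0, 0); rewrite /= dLu0 addr0.
by split=> // u; have := L0 (0, u.1, u.2); rewrite /= dLx add0r; case: u.
Qed.

Lemma stationary_dL c z : 0 < c -> stationary f F g phi psi c z ->
  (forall h, dL_x f F g psi dphi dpsi c z h = 0) /\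
  (forall u, dL_u f F g phi psi c z u = 0).
Proof.
move=> c0 [Oz [_ d0]]; apply: dL_eq0 => w.
have [_ dE] := frechet_diff (auglagr_frechet' c0 Oz).
by have := d0 w; rewrite dE (ip0l (hilbertian_prod_dot X H m)).
Qed.

Lemma kkt_stationary c z : 0 < c -> kkt f F g z.1.1 z.1.2 z.2 ->
  stationary f F g phi psi c z.
Proof.
move=> c0 kz; have Oz := kkt_Omega phi_adm psi_adm kz; split => //.
have [dL dE] := frechet_diff (auglagr_frechet' c0 Oz).
split => // w; rewrite dE (ip0l (hilbertian_prod_dot X H m)).
rewrite (kkt_dL_x dphi dpsi dF dg phi_adm psi_adm)//.
by rewrite (kkt_dL_u phi_adm psi_adm)// addr0.
Qed.

Lemma loc_min_dL c z : 0 < c -> Omega z.1.1 -> loc_min f F g phi psi c z ->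
  (forall h, dL_x f F g psi dphi dpsi c z h = 0) /\
  (forall u, dL_u f F g phi psi c z u = 0).
Proof.
move=> c0 Oz zmin; apply: dL_eq0.
apply: (frechet_loc_min (auglagr_frechet' c0 Oz)).
have On := near_fst11 (H := H) (m := m) (z := z)
  (Omega_near dF dg phi_adm dpsiP dpsi0 Oz).
apply: filterS2 zmin On => w; rewrite auglagrE// => zw Ow.
by move: zw; rewrite (auglagrE f c Ow) lee_fin.
Qed.

(** In the form of [max_penaltyE] each inequality term is a positive multiple of
    [max (s, 0)^2 - mu_i^2], where [s = mu_i + c g_i / p <= mu_i] since [g_i <= 0]. *)
Lemma auglagr_feasible_le c z : 0 < c -> feasible F g z.1.1 ->
  residual f F g z = 0 -> (auglagr c z <= (f z.1.1)%:E)%E.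
Proof.
move=> c0 Fz rz; have Oz := feasible_Omega phi_adm psi_adm Fz.
rewrite auglagrE// lee_fin auglagr_fineE//.
have [Fx gx] := Fz; have [b0 _] := Oz.
rewrite kkt_penaltyE// rz (ip0r hM) mulr0 addr0 Fx (ip0r (hilbertian_dotp H)) addr0.
rewrite (feasible_phiF phi_adm Fx) mulr0 addr0 -addrA gerDl enorm_sqr.
rewrite mulr_sumr -big_split; apply: sumr_le0 => i _ /=; rewrite !mxE -expr2.
have p0 := pfun_gt0 z.2 b0.
rewrite (max_penaltyE _ _ c0 p0) pmulr_rle0; last first.
  by apply: divr_gt0 => //; exact: mulr_gt0.
rewrite subr_le0.
set s := z.2 0 i + _.
have sm : s <= z.2 0 i.
  by rewrite /s gerDl pmulr_lle0 ?invr_gt0// pmulr_rle0.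
rewrite maxEle; case: (leP s 0) => s0; first by rewrite expr0n sqr_ge0.
by rewrite ler_pXn2r ?nnegrE ?(ltW s0)// (le_trans (ltW s0)).
Qed.

Variables (D : set X) (a : R).
Hypothesis a_gt0 : 0 < a.
Hypothesis Q_coercive : forall x u, D x ->
  a * mult_dot u u <= mult_dot (mult_op F g x u) (mult_op F g x u).

Lemma linear_mult_op_bounded x : exists C, opnorm_le (mult_op F g x) C.
Proof.
have [_ [MF FM] _] := diff_frechet (dF x).
have /choice[Mg gM] : forall i, exists C, opnorm_le ('d (g i) x) C.
  by move=> i; have [] := diff_frechet (dg i x).
pose s := `|MF| :: [seq `|Mg i| | i <- enum 'I_m].
pose M := \sum_(y <- s) y.
have s0 : all (fun y => 0 <= y) s.
  by rewrite /= normr_ge0; apply/allP => _ /mapP[i _ ->].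
have M0 : 0 <= M by rewrite /M big_seq sumr_ge0// => y; exact: (allP s0).
have FM' : opnorm_le ('d F x) M.
  apply: opnorm_le_trans FM _; apply: le_trans (ler_norm _) _.
  by apply: le_sum_mem => //; rewrite inE eqxx.
have gM' i : opnorm_le ('d (g i) x) M.
  apply: opnorm_le_trans (gM i) _; apply: le_trans (ler_norm _) _.
  apply: le_sum_mem => //; rewrite inE; apply/orP; right.
  by apply/mapP; exists i; rewrite ?mem_enum.
have [K K0 KV] := ip_bounded hM.
have nle u : mult_norm u <= Num.sqrt K * `|u|.
  rewrite -(@ler_pXn2r _ 2) ?nnegrE ?mult_norm_ge0 ?mulr_ge0 ?sqrtr_ge0//.
  rewrite (ipnorm_sqr hM) exprMn sqr_sqrtr ?(ltW K0)//.
  by rewrite (le_trans (ler_norm _))// (le_trans (KV _ _))// -mulrA.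
pose C := (1 + m%:R) * M * Num.sqrt K.
have C0 : 0 <= C by rewrite !mulr_ge0 ?sqrtr_ge0 ?addr_ge0.
have SC u : `|mult_grad F g x u| <= C * `|u|.
  apply: le_trans (mult_grad_norm_le dF dg u M0 FM' gM') _.
  by rewrite /C -[leRHS]mulrA ler_wpM2l ?mulr_ge0 ?addr_ge0.
pose G := \sum_(i < m) g i x ^+ 2.
have G0 : 0 <= G by apply: sumr_ge0 => i _; exact: sqr_ge0.
exists (M * C + G) => u; rewrite prod_norm_le; apply/andP; split => /=.
  rewrite (le_trans (FM' _))// mulrDl -[leLHS]addr0 lerD// ?mulr_ge0//.
  by rewrite -mulrA ler_wpM2l.
apply: rV_norm_le => [|i]; first by rewrite mulr_ge0// addr_ge0// mulr_ge0.
rewrite mxE mulrDl (le_trans (ler_normD _ _))// lerD//.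
  by rewrite (le_trans (gM' i _))// -mulrA ler_wpM2l.
rewrite normrM ger0_norm ?sqr_ge0// ler_pM ?sqr_ge0//.
  by rewrite /G (bigD1 i)//= lerDl sumr_ge0// => j _; exact: sqr_ge0.
exact: le_trans (norm_coord_le _ _) (norm_snd_le _).
Qed.

(* [T] being self-adjoint and bounded below, [T u = - e] follows from the Riesz
   representation of [- <e, T v>] for the inner product [<T u, T v>]. *)
Lemma residual_solvable x : D x -> exists u, residual f F g (x, u.1, u.2) = 0.
Proof.
move=> Dx.
pose T := mult_op F g x; have lT : linear T by exact: linear_mult_op.
have bT := linear_mult_op_bounded x.
have hT := hilbertian_pullback hM lT bT a_gt0 (fun u => Q_coercive u Dx).
pose e := residual f F g (x, 0, 0).
have resE u : residual f F g (x, u.1, u.2) = T u + e.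
  rewrite /residual /e /residual /T /mult_op !gradLE//=.
  have -> : mult_grad F g x (0, 0) = 0 by exact: (linear_for0 (linear_mult_grad dF dg x)).
  rewrite addr0 -surjective_pairing; move: (mult_grad F g x u) => w.
  congr (_, _); first by rewrite linearD addrC.
  by apply/rowP => i; rewrite !mxE linearD/=; ring.
have [||u uP] := riesz hT (l := fun v => - mult_dot e (T v)).
- by move=> b v w; rewrite lT (ipDr hM) (ipZr hM) /GRing.scale/=; ring.
- have [C C0 TC] := opnorm_le_gt0 bT; have [K K0 KV] := ip_bounded hM.
  exists (K * `|e| * C) => v; rewrite normrN (le_trans (KV _ _))//.
  by rewrite -[leRHS]mulrA ler_wpM2l// mulr_ge0// ltW.
exists u; rewrite resE.
have T0 v : T v = 0 -> v = 0.
  move=> Tv; apply: (ip_eq0 hM); apply/eqP.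
  rewrite eq_le (ip_ge0 hM) andbT -(pmulr_rle0 _ a_gt0).
  by rewrite (le_trans (Q_coercive v Dx))// -/T Tv (ip0r hM).
(* The Riesz identity says [T (T u + e) = 0]; injectivity of [T] strips the outer [T]. *)
apply: T0; apply: (ip_inj hM) => v; rewrite (ip0l hM).
rewrite (mult_op_sym dF dg) (ipDl hM).
by have := uP v; rewrite -/T; lra.
Qed.

(** The multipliers solving the residual equation at a nearby feasible [y] differ from the given
    ones by some [w] with [a |w|^2 <= |T w|^2 = 2 eta (y, lambda, mu)], which is small because [eta]
    is continuous and vanishes at the KKT point. So the new triplet is a competitor for local
    minimality, and its value is at most [f y]. *)
Lemma loc_min_loc_opt c z : 0 < c -> kkt f F g z.1.1 z.1.2 z.2 ->
  (\forall y \near z.1.1, feasible F g y -> D y) ->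
  loc_min f F g phi psi c z -> loc_opt f F g z.1.1.
Proof.
move=> c0 kz nD zmin; split; first exact: kkt_feasible kz.
have Oz := kkt_Omega phi_adm psi_adm kz.
move: (zmin) => /nbhs_normP[d /= d0 dP].
have pencv := frechet_continuous (frechet_kkt_penalty df dF dg (f2 Oz) (F2 Oz) (fun i => g2 i Oz)).
have pen0 : kkt_penalty f F g z.1.1 z.1.2 z.2 = 0.
  by rewrite kkt_penaltyE// kkt_residual// (ip0r hM) mulr0.
have [K K0 KP] := ip_coercive hM.
(* Chosen so that [2 e = a K (d / 2)^2], which keeps the change of multipliers within [d / 2]. *)
pose e := a * K * (d / 2) ^+ 2 / 2.
have e0 : 0 < e by rewrite divr_gt0// !mulr_gt0// exprn_gt0// divr_gt0.
have /cvgrPdist_le/(_ e e0) := pencv; rewrite pen0.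
move=> /nbhs_normP[d' /= d'0 d'P].
have dm : 0 < Num.min (d / 2) (d' / 2) by rewrite lt_min !divr_gt0.
apply: filterS2 nD (near_dist z.1.1 dm) => y Dy.
rewrite le_min => /andP[yd yd'] fy; have {}Dy := Dy fy.
have [u uP] := residual_solvable Dy.
have half (s : R) : 0 < s -> s / 2 < s by move=> s0; lra.
have peny : kkt_penalty f F g y z.1.2 z.2 <= e.
  have := d'P (y, z.1.2, z.2); rewrite /ball_ /= sub0r normrN => peny.
  apply: le_trans (ler_norm _) _; apply: peny.
  rewrite (le_lt_trans _ (half _ d'0))// !prod_norm_le /= distrC yd' !subrr !normr0.
  by rewrite !divr_ge0// ltW.
have du : `|(z.1.2, z.2) - u| <= d / 2.
  rewrite -(@ler_pXn2r _ 2) ?nnegrE ?divr_ge0 ?(ltW d0)//.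
  rewrite -(ler_pM2l K0) (le_trans (KP _))// -(ler_pM2l a_gt0).
  apply: le_trans (Q_coercive _ Dy) _.
  have -> : mult_op F g y ((z.1.2, z.2) - u) = residual f F g (y, z.1.2, z.2).
    rewrite -[RHS]subr0 -uP (linear_for_sub _ _ (linear_mult_op dF dg y)).
    rewrite /residual /mult_op !gradLE//= -surjective_pairing.
    move: (mult_grad F g y u) (mult_grad F g y _) (grad f y) => w1 w2 w3.
    congr (_, _); first by rewrite !linearD/= opprD addrACA subrr add0r.
    by apply/rowP => i; rewrite !mxE !linearD/=; ring.
  have := peny; rewrite (kkt_penaltyE f F dg (y, z.1.2, z.2)) /e; lra.
have zd : (auglagr c z <= auglagr c (y, u.1, u.2))%E.
  apply: dP; rewrite /ball_ /= (le_lt_trans _ (half _ d0))//.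
  move: du; rewrite !prod_norm_le /= => /andP[-> ->].
  by rewrite distrC yd.
move: zd; rewrite (kkt_value dg phi_adm psi_adm)// => zd.
rewrite -lee_fin; apply: le_trans zd _.
exact: (@auglagr_feasible_le c (y, u.1, u.2)).
Qed.

End Optimality.

Theorem theorem5p7 (R : realType) (X H : hilbertType R) (m : nat)
    (f : X -> R) (F : X -> H) (g : 'I_m -> X -> R)
    (phi : R -> \bar R) (psi : 'rV[R]_m -> R) (r eps gamma : R)
    (fC1 : cont_differentiable f)
    (gC1 : forall i, cont_differentiable (g i))
    (FC1 : cont_differentiable F)
    (opt_exists : exists x, glob_opt f F g x)
    (phi_adm : phi_admissible phi)
    (psi_adm : psi_admissible psi)
    (kkt_exists : forall x, glob_opt f F g x ->
       exists (lambda : H) (mu : 'rV[R]_m), kkt f F g x lambda mu)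
    (r_gt0 : 0 < r) (eps_gt0 : 0 < eps) (gamma_gt : opt_value f F g < gamma)
    (fC2 : twice_cont_differentiable_on (Omega F g phi psi) f)
    (gC2 : forall i, twice_cont_differentiable_on (Omega F g phi psi) (g i))
    (FC2 : twice_cont_differentiable_on (Omega F g phi psi) F)
    (phiC1 : exists2 dphi : R -> R, is_cont_derive_on_dom phi dphi & 0 < dphi 0)
    (Omega_bounded : bounded_set (Omega_sub f F g phi psi r (gamma + eps)))
    (Q_coercive : exists2 a : R, 0 < a &
       forall x, Omega_sub f F g phi psi r (gamma + eps) x ->
         forall (lambda : H) (mu : 'rV[R]_m),
           a * (`|lambda| ^+ 2 + enorm mu ^+ 2) <= Qform F g x lambda mu)
    (f_bounded : bounded_with_derivatives_on
       (Omega_sub f F g phi psi r (gamma + eps)) f)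
    (g_bounded : forall i, bounded_with_derivatives_on
       (Omega_sub f F g phi psi r (gamma + eps)) (g i))
    (F_bounded : bounded_with_derivatives_on
       (Omega_sub f F g phi psi r (gamma + eps)) F)
    (auglagr_wlsc : forall c : R, 0 < c ->
       weakly_seq_lsc (auglagr f F g phi psi c)) :
  exists2 cstar : R, 0 < cstar & forall c : R, cstar <= c ->
    [/\ ereal_inf (range (auglagr f F g phi psi c)) = (opt_value f F g)%:E,
        forall (x : X) (lambda : H) (mu : 'rV[R]_m),
          glob_min f F g phi psi c (x, lambda, mu) <->
          glob_opt f F g x /\ kkt f F g x lambda mu,
        forall (x : X) (lambda : H) (mu : 'rV[R]_m),
          sublevel f F g phi psi c gamma (x, lambda, mu) /\
          stationary f F g phi psi c (x, lambda, mu) <->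
          kkt f F g x lambda mu /\ f x <= gamma
      & forall (x : X) (lambda : H) (mu : 'rV[R]_m),
          sublevel f F g phi psi c gamma (x, lambda, mu) ->
          loc_min f F g phi psi c (x, lambda, mu) ->
          [/\ loc_opt f F g x, f x <= gamma & kkt f F g x lambda mu]].
Proof.
have df x := fC1.1 x; have dg i x := (gC1 i).1 x; have dF x := FC1.1 x.
have [dphi dphiP dphi0] := phiC1.
have [dpsi [dpsiP dpsi0]] := psi_C1 psi_adm.
have [a a0 Qa] := Q_coercive.
have f2 x (Ox : Omega F g phi psi x) := fC2.1 x Ox.
have g2 i x (Ox : Omega F g phi psi x) := (gC2 i).1 x Ox.
have F2 x (Ox : Omega F g phi psi x) := FC2.1 x Ox.
have [c1 [C [c11 C0 SP]]] := sublevel_bounds df dF dg phi_adm psi_adm dphiP dphi0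
  r_gt0 eps_gt0 a0 Qa f_bounded g_bounded F_bounded.
have [c2 [c21 KS]] := stationary_kkt df dF dg phi_adm psi_adm dphiP dphi0 dpsiP dpsi0
  r_gt0 eps_gt0 a0 Qa f_bounded g_bounded F_bounded f2 g2 F2.
have [x0 x0opt] := opt_exists.
have optE : opt_value f F g = f x0.
  have [x0f x0min] := x0opt.
  have lb : lbound (f @` feasible F g) (f x0) by move=> _ [y yf <-]; exact: x0min.
  apply/eqP; rewrite eq_le; apply/andP; split.
    by apply: ge_inf; [exists (f x0)|exists x0].
  by apply: lb_le_inf => //; exists (f x0); exists x0.
have [l0 [mu0 kkt0]] := kkt_exists x0 x0opt.
exists (c1 + c2) => [|c cc]; first by lra.
have c0 : 0 < c by lra.
have cc1 : c1 <= c by lra.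
have cc2 : c2 <= c by lra.
pose L := auglagr f F g phi psi c.
have kktL z : kkt f F g z.1.1 z.1.2 z.2 -> L z = (f z.1.1)%:E.
  by move=> kz; exact: (kkt_value dg phi_adm psi_adm c0 kz).
have subO z : (L z <= gamma%:E)%E -> Omega F g phi psi z.1.1.
  by case/sublevel_Omega.
have loc_kkt z : (L z <= gamma%:E)%E -> loc_min f F g phi psi c z ->
    kkt f F g z.1.1 z.1.2 z.2.
  move=> zg zmin.
  have [Lx Lu] := loc_min_dL df dF dg phi_adm dphiP dpsiP dpsi0 f2 g2 F2 c0 (subO z zg) zmin.
  exact: (KS c z cc2 zg Lx Lu).
(* This competitor, of value below [gamma], puts every global minimiser in the sublevel set. *)
have Lz0 : L (x0, l0, mu0) = (opt_value f F g)%:E by rewrite kktL// optE.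
have glob_loc z : glob_min f F g phi psi c z -> loc_min f F g phi psi c z.
  by move=> zmin; near=> w; exact: zmin.
have glob_sub z : glob_min f F g phi psi c z -> (L z <= gamma%:E)%E.
  move=> zmin; apply: le_trans (zmin (x0, l0, mu0)) _.
  by rewrite -/L Lz0 lee_fin ltW.
have [zm zmP] : exists z, glob_min f F g phi psi c z.
  have [B [_ BP]] := Omega_bounded.
  (* Boundedness of [Omega_sub] is a bound by every number above [B], hence [|B| + 1] for [x]; [C]
     is for the multipliers. *)
  pose M := `|B| + 1 + C.
  apply: (@weakly_seq_lsc_min _ _ _ L (x0, l0, mu0) M
    (hilbertian_prod_dot X H m) (auglagr_wlsc c c0)) => y yL.
  have yg : (L y <= gamma%:E)%E.
    by apply: le_trans yL _; rewrite Lz0 lee_fin ltW.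
  have [Dy _ uC] := SP c y cc1 yg.
  rewrite !prod_norm_le; apply/andP; split; first (apply/andP; split).
  - have : `|y.1.1| <= `|B| + 1.
      by apply: (BP (`|B| + 1)) => //; rewrite (le_lt_trans (ler_norm _))// ltrDl.
    by move/le_trans; apply; rewrite lerDl.
  - apply: le_trans (norm_le_mult_norm (y.1.2, y.2)) _.
    by rewrite (le_trans uC)// lerDr addr_ge0.
  apply: rV_norm_le => [|i]; first by rewrite !addr_ge0.
  apply: le_trans (coord_le_mult_norm (y.1.2, y.2) i) _.
  by rewrite (le_trans uC)// lerDr addr_ge0.
have kktm := loc_kkt zm (glob_sub _ zmP) (glob_loc _ zmP).
have zmE : L zm = (opt_value f F g)%:E.
  apply/eqP; rewrite eq_le -{1}Lz0 zmP /= kktL// lee_fin optE.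
  by have [_] := x0opt; apply; exact: kkt_feasible kktm.
split.
- apply/eqP; rewrite eq_le; apply/andP; split.
    by rewrite -Lz0; apply: ereal_inf_lbound; exists (x0, l0, mu0).
  by apply: le_ereal_inf_tmp => _ [w _ <-]; rewrite -zmE; exact: zmP.
- move=> x l mu; split=> [zmin|[xopt kz] w].
    have kz := loc_kkt _ (glob_sub _ zmin) (glob_loc _ zmin).
    split => //; split; first exact: (kkt_feasible kz).
    move=> y yf; have := zmin zm; rewrite -/L zmE (kktL (x, l, mu))// lee_fin optE.
    by move/le_trans; apply; have [_] := x0opt; exact.
  apply: le_trans (zmP w); rewrite -/L zmE (kktL (x, l, mu))// lee_fin optE.
  by have [_ xmin] := xopt; apply: xmin; have [] := x0opt.
- move=> x l mu; split=> [[zg zst]|[kz fg]].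
    have [Lx Lu] := stationary_dL df dF dg phi_adm dphiP dpsiP dpsi0 f2 g2 F2 c0 zst.
    have kz := KS c (x, l, mu) cc2 zg Lx Lu.
    by split => //; move: (zg : (L (x, l, mu) <= gamma%:E)%E); rewrite kktL.
  have Lf : (L (x, l, mu) <= gamma%:E)%E by rewrite kktL.
  split; first exact: Lf.
  exact: (kkt_stationary df dF dg phi_adm psi_adm dphiP dpsiP dpsi0 f2 g2 F2 c0 (z := (x, l, mu))).
- move=> x l mu zg zmin.
  have kz := loc_kkt (x, l, mu) zg zmin.
  have fg : f x <= gamma by move: (zg : (L (x, l, mu) <= gamma%:E)%E); rewrite kktL.
  split => //.
  apply: (@loc_min_loc_opt _ _ _ _ f F g phi psi df dF dg phi_adm psi_adm f2 g2 F2
    (Omega_sub f F g phi psi r (gamma + eps)) (2 * a) _ _ c (x, l, mu) c0 kz _ zmin).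
  + by rewrite mulr_gt0.
  + by move=> y u; exact: (mult_op_coercive dg Qa).
  (* Feasible points near [x] have zero penalty and [f y < f x + eps <= gamma + eps], so they lie in
     [Omega_sub], where [T] is coercive. *)
  have cf : {for x, continuous f} by exact: differentiable_continuous.
  have /cvgrPdist_lt/(_ _ eps_gt0) := cf.
  apply: filterS => y fy yf; split; first exact: feasible_Omega.
  have [Fy _] := yf; rewrite Fy normr0 expr0n/= (feasible_gplus yf) enorm_sqr.
  rewrite (ip0l (hilbertian_edot m)) addr0 mulr0 addr0.
  by move: fy; rewrite /= ltr_distlC => /andP[_]; lra.
Unshelve. all: by end_near. Qed.
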